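(* Let $0<\lambda<1$ and $m>0$. As $\delta\to0$, the $\Gamma$-limit, with respect to the $L^1$-topology, of the functionals $E_{\lambda,\delta}$ restricted to $\mathcal A_m$ is given by $$E_{\lambda,0}(\Omega):=(1-\lambda)P(\Omega)$$ for $\Omega\in\mathcal A_m$.
   Context: For $m>0$ let $\mathcal A_m:=\{\Omega\subset\mathbb R^2 \text{ measurable}: P(\Omega)<\infty,\ |\Omega|=m\}$, where $P$ is the De Giorgi perimeter. For $\lambda>0$, $0<\delta<\frac12$, $$E_{\lambda,\delta}(\Omega):=P(\Omega)-\frac{\lambda}{4|\log\delta|}\int_{\mathbb R^2}\int_{\mathbb R^2}|\chi_\Omega(x+z)-\chi_\Omega(x)|^2\,\frac{g_\delta(|z|)}{|z|^3}\,\mathrm dz\,\mathrm dx,$$ with $g_\delta(r):=g(r/\delta)$, $g:=\chi_{(1,\infty)}$. $L^1$-$\Gamma$-convergence on $\mathcal A_m$ means: (liminf) if $\delta_n\to0$ and $\Omega_n,\Omega\in\mathcal A_m$ with $|\Omega_n\Delta\Omega|\to0$, then $\liminf_n E_{\lambda,\delta_n}(\Omega_n)\ge E_{\lambda,0}(\Omega)$; (limsup) for every $\Omega\in\mathcal A_m$ and $\delta_n\to0$ there are $\Omega_n\in\mathcal A_m$ with $|\Omega_n\Delta\Omega|\to0$ and $\limsup_n E_{\lambda,\delta_n}(\Omega_n)\le E_{\lambda,0}(\Omega)$. *)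

(* Defs.v *)
From HB Require Import structures.
From mathcomp Require Import all_boot all_order all_algebra.
From mathcomp Require Import all_classical all_reals all_analysis.

Set Implicit Arguments.
Unset Strict Implicit.
Unset Printing Implicit Defensive.

Import Order.TTheory GRing.Theory Num.Theory.
Import numFieldNormedType.Exports.

Local Open Scope classical_set_scope.
Local Open Scope ring_scope.

Notation plane R := (R * R)%type (only parsing).

(* The product measure lives on the Borel sigma-algebra of the plane; its
   completed extension is Lebesgue measure on all Lebesgue measurable sets,
   which are the measurable sets of [lplane R]. *)
Definition borel_plane_measure (R : realType) :
    {measure set (measurableTypeR R * measurableTypeR R) -> \bar R} :=
  (@lebesgue_measure R \x @lebesgue_measure R)%E.

Notation lplane R := (caratheodory_type (borel_plane_measure R)^*%mu).

Definition leb2 (R : realType) : {measure set (lplane R) -> \bar R} :=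
  @completed_measure_extension _ _ _ (borel_plane_measure R).

Definition lebesgue_measurable (R : realType) (A : set (plane R)) : Prop :=
  measurable (A : set (lplane R)).

(* The library norm on a product is the sup norm. *)
Definition enorm (R : realType) (z : plane R) : R :=
  Num.sqrt (z.1 ^+ 2 + z.2 ^+ 2).

Definition C1 (R : realType) (f : plane R -> R) : Prop :=
  [/\ forall x, differentiable f x,
      continuous (fun x => 'D_(1, 0) f x) &
      continuous (fun x => 'D_(0, 1) f x)].

Definition C1c_field (R : realType) (phi : plane R -> plane R) : Prop :=
  [/\ C1 (fun x => (phi x).1), C1 (fun x => (phi x).2) &
      compact (closure [set x | phi x != 0])].

Definition div (R : realType) (phi : plane R -> plane R) (x : plane R) : R :=
  'D_(1, 0) (fun y => (phi y).1) x + 'D_(0, 1) (fun y => (phi y).2) x.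

Definition perimeter (R : realType) (Omega : set (plane R)) : \bar R :=
  ereal_sup [set (\int[leb2 R]_(x in Omega) (div phi x)%:E)%E |
    phi in [set phi | C1c_field phi /\ forall x, enorm (phi x) <= 1]].

Definition admissible (R : realType) (m : R) : set (set (plane R)) :=
  [set Omega | [/\ lebesgue_measurable Omega,
    (perimeter Omega < +oo)%E & leb2 R Omega = m%:E]].

Definition cutoff (R : realType) (delta r : R) : R :=
  (\1_(`]1, +oo[%classic) : R -> R) (r / delta).

Definition nonlocal_term (R : realType) (delta : R) (Omega : set (plane R)) :
    \bar R :=
  (\int[leb2 R]_x \int[leb2 R]_z
    (`|\1_Omega ((x : plane R) + z) - \1_Omega x| ^+ 2 *
     (cutoff delta (enorm z) / enorm z ^+ 3))%:E)%E.

(* On admissible sets both terms are finite, so the difference in \bar R is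
   the real difference. *)
Definition energy (R : realType) (lambda delta : R) (Omega : set (plane R)) :
    \bar R :=
  (perimeter Omega -
   (lambda / (4 * `|ln delta|))%:E * nonlocal_term delta Omega)%E.

Definition energy0 (R : realType) (lambda : R) (Omega : set (plane R)) :
    \bar R :=
  ((1 - lambda)%:E * perimeter Omega)%E.

Definition L1_cvg (R : realType) (Omegas : nat -> set (plane R))
    (Omega : set (plane R)) : Prop :=
  leb2 R (Omegas n `+` Omega) @[n --> \oo] --> 0%E.

(* The functionals [E delta] are only defined for 0 < delta < 1/2. *)
Definition vanishing (R : realType) (delta : nat -> R) : Prop :=
  (forall n, 0 < delta n < 2^-1) /\ delta n @[n --> \oo] --> 0.

Definition L1_Gamma_limit (R : realType) (A : set (set (plane R)))
    (E : R -> set (plane R) -> \bar R) (E0 : set (plane R) -> \bar R) : Prop :=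
  (forall (delta : nat -> R) (Omegas : nat -> set (plane R))
      (Omega : set (plane R)),
    vanishing delta -> (forall n, A (Omegas n)) -> A Omega ->
    L1_cvg Omegas Omega ->
    (E0 Omega <= limn_einf (fun n => E (delta n) (Omegas n)))%E) /\
  (forall (delta : nat -> R) (Omega : set (plane R)),
    vanishing delta -> A Omega ->
    exists Omegas : nat -> set (plane R),
      [/\ forall n, A (Omegas n), L1_cvg Omegas Omega &
        (limn_esup (fun n => E (delta n) (Omegas n)) <= E0 Omega)%E]).

(* Main.v *)
(** Splitting the kernel at |z| = 1, the far part contributes at most 16 |Omega|
    and the near part is governed by the identity
      int_(delta < |z| <= 1) |a . z| / |z|^3 dz = 4 |log delta| |a|.
    If u is the mollification of the indicator chi of Omega, the identity with
    a = grad u(x) gives int_z |z|^-3 ||u(. + z) - u||_1 dz <= 4 |log delta| P(Omega),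
    and letting the mollification scale tend to 0 the same bound holds for chi;
    hence E_(lambda, delta) >= (1 - lambda) P - O(1 / |log delta|), and lower
    semicontinuity of the perimeter gives the liminf inequality.  Conversely, for
    a test field phi and a fixed small mollification scale,
    int_Omega div phi - eta <= int_K |grad u| for a compact K; the second order
    Taylor remainder of u costs only a constant independent of delta and
    translation energies decrease under mollification, so the nonlocal term is at
    least 4 |log delta| (int_Omega div phi - eta) - C.  Thus the constant sequence
    is a recovery sequence. *)

From HB Require Import structures.
Require Import Defs.
From mathcomp Require Import all_boot all_order all_algebra.
From mathcomp Require Import all_classical all_reals all_analysis.
From mathcomp Require Import measurable_realfun ring lra.

Set Implicit Arguments.
Unset Strict Implicit.
Unset Printing Implicit Defensive.

Import Order.TTheory GRing.Theory Num.Theory.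
Import numFieldNormedType.Exports.

Local Open Scope classical_set_scope.
Local Open Scope ring_scope.

(** * Borel versions of Lebesgue measurable sets *)

(** The bound [int |grad u| <= P(Omega)] behind the upper estimate comes from one explicit test
    field: the mollification of the normalised gradient [- grad u / |grad u|], truncated to a box. A
    mollifier of class C^(1,1) suffices, a multiple of the square of the positive part of
    [e^2 - |x|^2]; all that is used about its convolutions follows from finite difference estimates,
    which pass through the integral by linearity. The constant 4 in the kernel identity is the
    integral of [|cos|] over the circle. Lower semicontinuity enters through the continuity of
    [int_Omega div phi] for one fixed field [phi], so the energy is bounded below by this flux
    rather than by the perimeter. In the opposite bound the additive constant depends on the field
    and on the mollification scale; both are fixed before [delta] tends to 0, and dividing by
    [|log delta|] removes it. Tonelli's theorem is applied on the product of two planes, for which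
    Lebesgue measurable sets are replaced by Borel sets that agree with them off a Borel null
    set. *)

Section completion.
Context d (T : measurableType d) (R : realType) (mu : {measure set T -> \bar R}).
Local Notation I := (caratheodory_type (mu^*)%mu).
Local Notation nu := (@completed_measure_extension _ _ _ mu).

Lemma caratheodory_of_measurable (A : set T) :
  measurable A -> measurable (A : set I).
Proof. exact: (@caratheodory_measurable_mu_ext _ _ _ mu). Qed.

Lemma completed_measureE (A : set T) : measurable A -> nu A = mu A.
Proof. by move=> mA; rewrite /completed_measure_extension /= measurable_mu_extE. Qed.

(** Intersect over [n] the unions of countable measurable covers whose total measure exceeds the
    outer measure by less than [1/(n+1)]. The set [X] is arbitrary: [nu] is evaluated there as the
    outer measure. *)
Lemma outer_measure_measurable_cover (X : set T) : (nu X < +oo)%E ->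
  exists G, [/\ measurable G, X `<=` G & mu G = nu X].
Proof.
move=> Xoo.
have Xfin : nu X \is a fin_num.
  rewrite ge0_fin_numE //; exact: mu_ext_ge0.
have H n : exists F : nat -> set T, measurable_cover X F /\
    (\sum_(k <oo) mu (F k) < nu X + n.+1%:R^-1%:E)%E.
  have [|_ [F FX <-] Fn] := lb_ereal_inf_adherent (e := n.+1%:R^-1) _ Xfin.
    by rewrite invr_gt0.
  by exists F.
have [F HF] := choice H.
pose G := \bigcap_n \bigcup_k F n k.
have mF n : measurable (\bigcup_k F n k).
  by apply: bigcupT_measurable => k; apply: (HF n).1.1.
have mG : measurable G by apply: bigcapT_measurable.
have XG : X `<=` G by move=> x Xx n _; exact: (HF n).1.2.
exists G; split => //; apply/eqP; rewrite eq_le; apply/andP; split; last first.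
  by rewrite -(completed_measureE mG); apply: le_mu_ext.
apply/lee_addgt0Pr => e e0.
have [n ne] : exists n, n.+1%:R^-1 < e.
  exists (Num.truncn e^-1); rewrite invf_plt ?posrE //.
  by rewrite truncnS_gt.
apply: (@le_trans _ _ (\sum_(k <oo) mu (F n k))%E).
  apply: (@le_trans _ _ (mu (\bigcup_k F n k))).
    by apply: le_measure; rewrite ?inE // => x; apply.
  apply: (measure_sigma_subadditive mu) => //.
  by move=> k; apply: (HF n).1.1.
apply: (le_trans (ltW (HF n).2)).
by rewrite leeD2l // lee_fin ltW.
Qed.

(** A measurable cover [G] of the same measure differs from [X] by a null set of the completion;
    this difference need not lie in the original sigma-algebra, so it is covered once more, by
    [N]. *)
Lemma completed_measurable_version (X : set T) : measurable (X : set I) ->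
  (nu X < +oo)%E -> exists B N, [/\ measurable B, measurable N, mu N = 0%E &
    forall x, ~ N x -> (X x <-> B x)].
Proof.
move=> mX Xoo; have [G [mG XG GX]] := outer_measure_measurable_cover Xoo.
have D0 : nu (G `\` X) = 0%E.
  have mG' := caratheodory_of_measurable mG.
  have -> : nu (G `\` X) = (nu G - nu (G `&` X))%E.
    by apply: measureD => //; rewrite [ltLHS](completed_measureE mG) GX.
  rewrite completed_measureE // GX setIidr // subee //.
  rewrite ge0_fin_numE //; exact: mu_ext_ge0.
have [|N [mN DN N0]] := @outer_measure_measurable_cover (G `\` X).
  by rewrite D0.
exists G, N; split => //; first by rewrite N0.
move=> x Nx; split=> [/XG//|Gx]; apply: contrapT => Xx; exact/Nx/DN.
Qed.

Lemma measurable_id_completed : measurable_fun setT (id : I -> T).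
Proof. by move=> _ A mA; rewrite setTI; exact: caratheodory_of_measurable. Qed.

(** The identity map, from the completed to the original sigma-algebra, pushes [nu] forward to
    [mu]. *)
Lemma ge0_integral_completed (D : set T) (f : T -> \bar R) : measurable D ->
  measurable_fun D f -> (forall x, D x -> 0 <= f x)%E ->
  (\int[nu]_(x in D) f x = \int[mu]_(x in D) f x)%E.
Proof.
move=> mD mf f0.
transitivity (\int[pushforward nu (id : I -> T)]_(x in D) f x)%E.
  rewrite (ge0_integral_pushforward measurable_id_completed) //.
  by move=> x /set_mem; exact: f0.
apply: eq_measure_integral => [|? A mA _]; first exact: measurable_id_completed.
exact: completed_measureE.
Qed.

Lemma measurable_fun_completed (f : T -> \bar R) : measurable_fun setT f ->
  measurable_fun setT (f : I -> \bar R).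
Proof. by move=> mf; apply: (measurableT_comp mf measurable_id_completed). Qed.

Lemma ge0_integral_version (X B N : set T) (f : T -> \bar R) :
  measurable (X : set I) -> measurable B -> measurable N -> mu N = 0%E ->
  (forall x, ~ N x -> (X x <-> B x)) -> measurable_fun setT f ->
  (forall x, 0 <= f x)%E ->
  (\int[nu]_(x in X) f x = \int[mu]_(x in B) f x)%E.
Proof.
move=> mX mB mN N0 XB mf f0.
rewrite -ge0_integral_completed //; last exact: measurable_funTS.
have mf' := measurable_fun_completed mf.
have N0' : nu N = 0%E by rewrite completed_measureE.
have mN' := caratheodory_of_measurable mN.
have mB' := caratheodory_of_measurable mB.
rewrite [LHS](ge0_negligible_integral mN' mX _ _ N0') //; last exact: measurable_funTS.
rewrite [RHS](ge0_negligible_integral mN' mB' _ _ N0') //; last exact: measurable_funTS.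
by congr integral; apply/seteqP; split=> x [] /[swap] Nx /XB-/(_ Nx).
Qed.

Lemma integral_version (X B N : set T) (f : T -> \bar R) :
  measurable (X : set I) -> measurable B -> measurable N -> mu N = 0%E ->
  (forall x, ~ N x -> (X x <-> B x)) -> measurable_fun setT f ->
  (\int[nu]_(x in X) f x = \int[mu]_(x in B) f x)%E.
Proof.
move=> mX mB mN N0 XB mf; rewrite [LHS]integralE [RHS]integralE.
by congr (_ - _)%E; apply: (ge0_integral_version mX mB mN N0 XB) => //;
  [exact: measurable_funepos|exact: measurable_funeneg].
Qed.

End completion.

(** * Changes of variables in the plane *)

Section affine_change_of_variable.
Context {R : realType}.
Local Notation mu := (@lebesgue_measure R).

Lemma measurable_affine (c b : R) :
  measurable_fun setT ((fun x => c * x + b) : measurableTypeR R -> measurableTypeR R).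
Proof. by apply: measurable_funD => //; exact: mulrl_measurable. Qed.

(** The scaled pushforward is a measure, so by uniqueness of Lebesgue measure only half-open
    intervals have to be checked. *)
Lemma lebesgue_measure_affine (c b : R) (A : set (measurableTypeR R)) : c != 0 ->
  measurable A -> mu A = (`|c|%:E * mu ((fun x => (c * x + b)%R) @^-1` A))%E.
Proof.
move=> c0 mA.
pose nu := mscale (NngNum (normr_ge0 c))
  (pushforward mu ((fun x => c * x + b) : measurableTypeR R -> measurableTypeR R)).
have mpf := measurable_affine c b.
suff : mu A = nu mpf A by [].
apply: (@lebesgue_measure_unique R (nu mpf) _ A mA) => X [[x y] _ <-].
rewrite /nu /mscale /pushforward.
(* A negative factor reverses the interval, so its preimage is closed on the other side; the length
   is the same. *)
have /orP[c_lt0|c_gt0] : (c < 0) || (0 < c) by rewrite -neq_lt.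
  rewrite [X in _ = (_ * mu X)%E](_ : _ = `[(y - b) / c, (x - b) / c[%classic); last first.
    apply/seteqP; split=> t /=; rewrite !in_itv /= ltr_ndivlMr // ler_ndivrMr //;
      by rewrite [t * c]mulrC ltrBlDr lerBrDr andbC.
  rewrite !lebesgue_measure_itv /= !lte_fin ltr_nM2r ?invr_lt0 // ltrD2r.
  case: ifPn => _; rewrite ?mule0 // -!EFinB -EFinM ltr0_norm //.
  by congr (_%:E); field; rewrite lt_eqF.
rewrite [X in _ = (_ * mu X)%E](_ : _ = `](x - b) / c, (y - b) / c]%classic); last first.
  apply/seteqP; split=> t /=; rewrite !in_itv /= ltr_pdivrMr // ler_pdivlMr //;
    by rewrite [t * c]mulrC ltrBlDr lerBrDr.
rewrite !lebesgue_measure_itv /= !lte_fin ltr_pM2r ?invr_gt0 // ltrD2r.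
case: ifPn => _; rewrite ?mule0 // -!EFinB -EFinM gtr0_norm //.
by congr (_%:E); field; rewrite gt_eqF.
Qed.

Lemma ge0_integral_affine (c b : R) (f : R -> \bar R) : c != 0 ->
  measurable_fun setT f -> (forall x, 0 <= f x)%E ->
  (\int[mu]_x f x = `|c|%:E * \int[mu]_x f (c * x + b)%R)%E.
Proof.
move=> c0 mf f0.
have mpf := measurable_affine c b.
rewrite [X in (_ * X)%E](_ : _ =
  \int[pushforward mu ((fun x => (c * x + b)%R) : measurableTypeR R -> measurableTypeR R)]_x f x)%E; last first.
  by rewrite (ge0_integral_pushforward mpf).
rewrite -[`|c|]/((NngNum (normr_ge0 c))%:num) -ge0_integral_mscale //.
by apply: eq_measure_integral => A mA _; exact: lebesgue_measure_affine.
Qed.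

End affine_change_of_variable.

Section plane_measure.
Context {R : realType}.
Local Notation mu := (@lebesgue_measure R).
Local Notation T := (measurableTypeR R * measurableTypeR R)%type.

Local Notation pm := (mu \x mu)%E.

Lemma measurable_translation (z : T) : measurable_fun setT (fun x : T => x + z : T).
Proof.
have m1 : measurable_fun setT (fun x : T => x.1 + z.1 : measurableTypeR R).
  by apply: measurable_funD => //; exact: measurable_fst.
have m2 : measurable_fun setT (fun x : T => x.2 + z.2 : measurableTypeR R).
  by apply: measurable_funD => //; exact: measurable_snd.
exact: (measurable_fun_pair m1 m2).
Qed.

Lemma plane_measure_translation (z : T) (A : set T) : measurable A ->
  pm A = pm ((fun x : T => x + z) @^-1` A).
Proof.
move=> mA; have mz := measurable_translation z.
suff : pm A = pushforward pm (fun x : T => x + z : T) A by [].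
apply: product_measure_unique => // B C mB mC.
transitivity (pm (((fun x => 1 * x + z.1) @^-1` B) `*`
    ((fun x => 1 * x + z.2) @^-1` C))).
  rewrite /pushforward; congr (pm _).
  by apply/seteqP; split=> -[a b] /=; rewrite !mul1r.
have m1 : measurable ((fun x : measurableTypeR R => 1 * x + z.1) @^-1` B).
  by rewrite -[X in measurable X]setTI; exact: measurable_affine.
have m2 : measurable ((fun x : measurableTypeR R => 1 * x + z.2) @^-1` C).
  by rewrite -[X in measurable X]setTI; exact: measurable_affine.
rewrite product_measure1E //.
congr (_ * _)%E; apply: esym.
  by apply: etrans (lebesgue_measure_affine z.1 (oner_neq0 R) mB) _; rewrite normr1 mul1e.
by apply: etrans (lebesgue_measure_affine z.2 (oner_neq0 R) mC) _; rewrite normr1 mul1e.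
Qed.

Lemma ge0_integral_translation (z : T) (f : T -> \bar R) :
  measurable_fun setT f -> (forall x, 0 <= f x)%E ->
  (\int[pm]_x f (x + z)%R = \int[pm]_x f x)%E.
Proof.
move=> mf f0; have mz := measurable_translation z.
rewrite [LHS](_ : _ = \int[pushforward pm (fun x : T => (x + z)%R : T)]_x f x)%E; last first.
  by rewrite (ge0_integral_pushforward mz).
by apply: eq_measure_integral => A mA _; apply/esym; exact: plane_measure_translation.
Qed.

End plane_measure.

(** * The angular part of the kernel integral *)

Section angular_integral.
Context {R : realType}.
Local Notation mu := (@lebesgue_measure R).

Let w (t : R) := Num.sqrt (1 + t ^+ 2).

Let w_gt0 t : 0 < w t.
Proof. by rewrite sqrtr_gt0 ltr_pwDl // sqr_ge0. Qed.

Let w_sqr t : w t ^+ 2 = 1 + t ^+ 2.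
Proof. by rewrite sqr_sqrtr // addr_ge0 // sqr_ge0. Qed.

Let is_derive_w (t : R) : is_derive t 1 w (t / w t).
Proof.
have d1 : is_derive t 1 (fun t : R => 1 + t ^+ 2) (0 + (2%:R * t ^+ 1) *: 1).
  exact: (is_deriveD (is_derive_cst (1 : R) t 1) (is_deriveX 2 (is_derive_id t 1))).
have d2 : is_derive (1 + t ^+ 2) 1 Num.sqrt (2 * Num.sqrt (1 + t ^+ 2))^-1.
  by apply: is_derive1_sqrt; rewrite ltr_pwDl // sqr_ge0.
have d3 : is_derive t 1 w ((2 * Num.sqrt (1 + t ^+ 2))^-1 * (0 + (2%:R * t ^+ 1) *: 1)).
  exact: (@is_derive1_comp R Num.sqrt (fun t => 1 + t ^+ 2) t _ _ d2 d1).
apply: (is_derive_eq d3).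
rewrite -/(w t) add0r expr1 /GRing.scale /= mulr1.
by field; rewrite gt_eqF.
Qed.

(** With [t = tan theta] this is [a sin theta - b cos theta], the primitive of
    [a cos theta + b sin theta]. *)
Let F (a b t : R) := (a * t - b) * (w t)^-1.

Let is_derive_F (a b t : R) : is_derive t 1 (F a b) ((a + b * t) / w t ^+ 3).
Proof.
have d1 : is_derive t 1 (fun t : R => a * t - b) (a *: 1 - 0).
  exact: (is_deriveB (is_deriveZ a (is_derive_id t 1)) (is_derive_cst b t 1)).
have wt0 : w t != 0 by rewrite gt_eqF.
have d2 := is_deriveV wt0 (is_derive_w t).
apply: (is_derive_eq (is_deriveM d1 d2)).
rewrite subr0 /GRing.scale /= mulr1.
have -> : a + b * t = a * w t ^+ 2 - (a * t - b) * t by rewrite w_sqr; ring.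
by field.
Qed.

Let continuous_w : continuous w.
Proof.
move=> t; apply/differentiable_continuous/derivable1_diffP.
by have [] := is_derive_w t.
Qed.

Let cvg_F (a b : R) : F a b t @[t --> +oo] --> a.
Proof.
apply/cvgrPdist_le => e e0.
near=> t.
have t0 : 0 < t by near: t; exact: nbhs_pinfty_gt.
have te : (`|a| + `|b|) / e <= t by near: t; apply: nbhs_pinfty_ge; rewrite num_real.
have tw : t <= w t.
  by rewrite /w -[leLHS](gtr0_norm t0) -sqrtr_sqr; apply: ler_wsqrtr; rewrite lerDr.
have wt1 : w t <= t + 1.
  rewrite /w -[leRHS]ger0_norm ?addr_ge0 ?(ltW t0) // -sqrtr_sqr; apply: ler_wsqrtr.
  by rewrite sqrrD1 mulr2n; lra.
have -> : a - F a b t = (a * (w t - t) + b) / w t.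
  by rewrite /F; field; rewrite gt_eqF.
rewrite normrM normfV (gtr0_norm (w_gt0 t)) ler_pdivrMr //.
apply: (@le_trans _ _ (`|a| + `|b|)).
  apply: (le_trans (ler_normD _ _)); rewrite lerD2r normrM ler_piMr //.
  by rewrite ger0_norm; lra.
by move: te; rewrite ler_pdivrMr // => /le_trans; apply; rewrite mulrC ler_pM2l.
Unshelve. all: by end_near. Qed.

Lemma integral_angular_half (a b c : R) :
  (forall t, c <= t -> 0 <= a + b * t) ->
  (\int[mu]_(t in `[c, +oo[) ((a + b * t) / Num.sqrt (1 + t ^+ 2) ^+ 3)%:E =
   (a - (a * c - b) / Num.sqrt (1 + c ^+ 2))%:E)%E.
Proof.
move=> abc.
rewrite (@ge0_continuous_FTC2y _ _ (F a b) _ a) //.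
- by move=> x cx; rewrite divr_ge0 ?exprn_ge0 ?abc // ltW.
- apply: continuous_subspaceT => t.
  apply: cvgM.
    by apply: cvgD; [exact: cvg_cst|apply: cvgM; [exact: cvg_cst|exact: cvg_id]].
  apply: cvgV; first by apply: expf_neq0; rewrite gt_eqF //; exact: w_gt0.
  apply: (@cvg_comp _ _ _ w (fun x => x ^+ 3) _ (nbhs (w t))); first exact: continuous_w.
  exact: exprn_continuous.
- by move=> x _; have [] := is_derive_F a b x.
- apply: cvg_at_right_filter.
  by apply/differentiable_continuous/derivable1_diffP; have [] := is_derive_F a b c.
- by move=> x _; rewrite derive1E; have [_ ->] := is_derive_F a b x.
Qed.

(** Reflecting the left half makes both pieces rays to [+oo], the only domain for which
    [integral_angular_half] gives a value. *)
Lemma ge0_integral_split_at (c : R) (f : R -> \bar R) :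
  measurable_fun setT f -> (forall x, 0 <= f x)%E ->
  (\int[mu]_x f x =
   \int[mu]_(x in `[c, +oo[) f x + \int[mu]_(x in `[(- c)%R, +oo[) f (- x)%R)%E.
Proof.
move=> mf f0.
have -> : [set: R] = `[c, +oo[ `|` `]-oo, c[.
  apply/seteqP; split=> // x _ /=; rewrite !in_itv /= andbT.
  by case: (leP c x); [left|right].
rewrite ge0_integral_setU //; last 2 first.
- exact: measurable_funTS.
- apply/disj_setPS => x /= []; rewrite !in_itv /= andbT => cx xc.
  by move: (le_lt_trans cx xc); rewrite ltxx.
congr (_ + _)%E.
have mfN : measurable_fun setT (fun x : R => f (- x)).
  by apply: measurableT_comp => //; exact: oppr_measurable.
rewrite -(@integral_itv_obnd_cbnd _ (- c)); last exact: measurable_funTS.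
rewrite integral_mkcond.
rewrite (ge0_integral_affine 0 (c := -1)) //; last 2 first.
- by apply/(measurable_restrictT _ _).1 => //; exact: measurable_funTS.
- by move=> x; rewrite patchE; case: ifP.
rewrite normrN1 mul1e [RHS]integral_mkcond; apply: eq_integral => x _.
rewrite !patchE mulN1r addr0; congr (if _ then _ else _).
by apply/idP/idP => /set_mem /= H; apply/mem_set => /=; move: H;
  rewrite !in_itv /= andbT ltrNl.
Qed.

(** With [t = tan theta] this is the integral of [|a cos theta + b sin theta|] over a half
    circle. *)
Lemma integral_angular (a b : R) :
  (\int[mu]_t (`|a + b * t| / Num.sqrt (1 + t ^+ 2) ^+ 3)%:E =
   (2 * Num.sqrt (a ^+ 2 + b ^+ 2))%:E)%E.
Proof.
pose f (a b t : R) := `|a + b * t| / Num.sqrt (1 + t ^+ 2) ^+ 3.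
have mf a' b' : measurable_fun setT (f a' b').
  apply: continuous_measurable_fun => t.
  apply: cvgM.
    apply: cvg_norm.
    by apply: cvgD; [exact: cvg_cst|apply: cvgM; [exact: cvg_cst|exact: cvg_id]].
  apply: cvgV; first by apply: expf_neq0; rewrite gt_eqF //; exact: w_gt0.
  apply: (@cvg_comp _ _ _ w (fun x => x ^+ 3) _ (nbhs (w t))); first exact: continuous_w.
  exact: exprn_continuous.
have f0 a' b' t : 0 <= f a' b' t.
  by rewrite divr_ge0 // exprn_ge0 // ltW // w_gt0.
have half a' b' c : (forall t, c <= t -> 0 <= a' + b' * t) ->
    (\int[mu]_(t in `[c, +oo[) (f a' b' t)%:E =
    (a' - (a' * c - b') / Num.sqrt (1 + c ^+ 2))%:E)%E.
  move=> H; rewrite -integral_angular_half //; apply: eq_integral => t.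
  by rewrite inE /= in_itv /= andbT => /H ct; rewrite /f ger0_norm.
have split a' b' c : (\int[mu]_t (f a' b' t)%:E = \int[mu]_(t in `[c, +oo[) (f a' b' t)%:E +
    \int[mu]_(t in `[(- c)%R, +oo[) (f (- a') b' t)%:E)%E.
  rewrite (ge0_integral_split_at c) //; last 2 first.
  - by apply/measurable_EFinP.
  - by move=> x; rewrite lee_fin.
  congr (_ + _)%E; apply: eq_integral => t _; rewrite /f sqrrN.
  by rewrite -normrN; congr (`|_| / _)%:E; ring.
(* The line is split at the root [- (a' / b')], which resolves the absolute value; on the reflected
   ray the form is [- a' + b' t], again nonnegative. *)
have main a' b' : 0 < b' -> (\int[mu]_t (f a' b' t)%:E =
   (2 * Num.sqrt (a' ^+ 2 + b' ^+ 2))%:E)%E.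
  move=> b0; rewrite (split _ _ (- (a' / b'))) opprK half; last first.
    by move=> t; rewrite lerNl ler_pdivlMr //; lra.
  rewrite half; last first.
    by move=> t; rewrite ler_pdivrMr //; lra.
  rewrite -EFinD; congr (_%:E).
  rewrite sqrrN.
  have -> : 1 + (a' / b') ^+ 2 = (a' ^+ 2 + b' ^+ 2) / b' ^+ 2.
    by field; rewrite gt_eqF.
  have s0 : 0 < Num.sqrt (a' ^+ 2 + b' ^+ 2).
    by rewrite sqrtr_gt0 ltr_wpDl ?sqr_ge0 // exprn_gt0.
  rewrite sqrtrM ?addr_ge0 ?sqr_ge0 // sqrtrV ?sqr_ge0 // sqrtr_sqr gtr0_norm //.
  have ss : Num.sqrt (a' ^+ 2 + b' ^+ 2) ^+ 2 = a' ^+ 2 + b' ^+ 2.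
    by rewrite sqr_sqrtr // addr_ge0 ?sqr_ge0.
  move: s0 ss; set s := Num.sqrt _ => s0 ss.
  rewrite -[LHS](_ : 2 * (a' ^+ 2 + b' ^+ 2) / s = _); last first.
    by field; rewrite !gt_eqF.
  by rewrite -ss; field; rewrite gt_eqF.
rewrite -/(f a b).
(* A negative [b] is handled by changing both signs. For [b = 0] the form is constant and the line
   is split at 0. *)
have [b0|b0|b0] := ltgtP b 0.
- rewrite -(sqrrN a) -(sqrrN b) -main ?oppr_gt0 //.
  by apply: eq_integral => t _; rewrite /f -normrN; congr (`|_| / _)%:E; ring.
- exact: main.
- subst b; rewrite expr0n addr0 sqrtr_sqr.
  have E t : f a 0 t = f `|a| 0 t by rewrite /f !mul0r !addr0 normr_id.
  transitivity (\int[mu]_t (f `|a| 0 t)%:E)%E.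
    by apply: eq_integral => t _; congr (_%:E); exact: E.
  rewrite (split _ _ 0) oppr0.
  have E' t : f (- `|a|) 0 t = f `|a| 0 t by rewrite /f !mul0r !addr0 normrN.
  rewrite [X in (_ + X)%E](_ : _ = \int[mu]_(t in `[0%R, +oo[) (f `|a| 0 t)%:E)%E; last first.
    by apply: eq_integral => t _; congr (_%:E); exact: E'.
  rewrite half; last by move=> t _; rewrite mul0r addr0.
  by rewrite !mulr0 subr0 mul0r subr0 -EFinD; congr (_%:E); ring.
Qed.

End angular_integral.

(** * Radial integrals against linear forms *)

Section polar.
Context {R : realType}.
Local Notation mu := (@lebesgue_measure R).
Local Notation T := (measurableTypeR R * measurableTypeR R)%type.
Local Notation pm := (mu \x mu)%E.

Lemma measurable_sqrt : measurable_fun setT (@Num.sqrt R).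
Proof. by apply: continuous_measurable_fun; exact: sqrt_continuous. Qed.

Lemma measurable_enorm : measurable_fun setT (fun z : T => enorm z).
Proof.
apply: (measurableT_comp measurable_sqrt).
by apply: measurable_funD; apply: measurable_funX.
Qed.

Lemma measurable_dot (a b : R) : measurable_fun setT (fun z : T => a * z.1 + b * z.2).
Proof.
by apply: measurable_funD; apply: measurable_funM.
Qed.

(* The substitution z = (s, s t) replaces polar coordinates. *)
Lemma integral_radial_dot (h : R -> R) (a b : R) :
  measurable_fun setT h -> (forall r, 0 <= h r) ->
  (\int[pm]_z (h (enorm z) * `|a * z.1 + b * z.2|)%:E =
   (2 * Num.sqrt (a ^+ 2 + b ^+ 2))%:E * \int[mu]_r (h `|r| * r ^+ 2)%:E)%E.
Proof.
move=> mh h0.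
pose f (z : T) := (h (enorm z) * `|a * z.1 + b * z.2|)%:E.
have mf : measurable_fun setT f.
  apply/measurable_EFinP; apply: measurable_funM.
    exact: (measurableT_comp mh measurable_enorm).
  by apply: measurableT_comp => //; exact: measurable_dot.
have f0 z : (0 <= f z)%E by rewrite lee_fin mulr_ge0.
pose w (t : R) := Num.sqrt (1 + t ^+ 2).
have w_gt0 t : 0 < w t by rewrite sqrtr_gt0 ltr_pwDl // sqr_ge0.
have mw : measurable_fun setT w.
  by apply: (measurableT_comp measurable_sqrt); apply: measurable_funD => //;
    apply: measurable_funX.
have mwV n : measurable_fun setT (fun t => w t ^- n).
  apply: continuous_measurable_fun => t.
  apply: cvgV; first by apply: expf_neq0; rewrite gt_eqF //; exact: w_gt0.
  apply: (@cvg_comp _ _ _ w (fun x => x ^+ n) _ (nbhs (w t))); last exact: exprn_continuous.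
  apply: (@cvg_comp _ _ _ (fun t => 1 + t ^+ 2) Num.sqrt _ (nbhs (1 + t ^+ 2))).
    by apply: cvgD; [exact: cvg_cst|exact: exprn_continuous].
  exact: sqrt_continuous.
pose k t := `|a + b * t|.
have mk : measurable_fun setT k.
  by apply: measurableT_comp => //; apply: measurable_funD => //;
    apply: measurable_funM.
pose H r := h `|r| * r ^+ 2.
have mH : measurable_fun setT H.
  apply: measurable_funM; last exact: measurable_funX.
  have mn : measurable_fun setT (fun r : R => `|r|) by exact: normr_measurable.
  exact: (measurableT_comp mh mn).
have H0 r : 0 <= H r by rewrite mulr_ge0 ?sqr_ge0.
(* [G] is the integrand after the substitution, Jacobian [|s|] included. It sees [s] only through
   [w t * s], so rescaling [s] for fixed [t] separates the variables. *)
pose G (z : T) := (k z.2 * (w z.2 ^- 2 * H (w z.2 * z.1)))%:E.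
have mG : measurable_fun setT G.
  have m1 : measurable_fun setT (fun z : T => w z.2) by apply: (measurableT_comp mw); exact: measurable_snd.
  apply/measurable_EFinP; apply: measurable_funM.
    by apply: (measurableT_comp mk); exact: measurable_snd.
  apply: measurable_funM.
    apply: (measurableT_comp (mwV 2)); exact: measurable_snd.
  apply: (measurableT_comp mH); apply: measurable_funM => //; exact: measurable_fst.
have G0 z : (0 <= G z)%E.
  rewrite lee_fin; apply: mulr_ge0; first exact: normr_ge0.
  by apply: mulr_ge0; [rewrite invr_ge0 exprn_ge0 // ltW|exact: H0].
rewrite -[LHS]/(\int[pm]_z f z)%E.
rewrite (fubini_tonelli1 f) //.
transitivity (\int[mu]_s \int[mu]_t G (s, t))%E.
  (* The substitution [t -> s t] degenerates at [s = 0], a null set in the outer variable. *)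
  have E (F : R -> \bar R) : measurable_fun setT F ->
      (\int[mu]_x F x = \int[mu]_(x in setT `\ 0%R) F x)%E.
    move=> mF; rewrite integral_setD1 //; last exact: measurable_funTS.
    exact: (measurableD measurableT (measurable_set1 0)).
  rewrite [LHS]E; last exact: (measurable_fun_fubini_tonelli_F f).
  rewrite [RHS]E; last exact: (measurable_fun_fubini_tonelli_F G).
  apply: eq_integral => s /set_mem[_ /= /eqP s0].
  rewrite /fubini_F (ge0_integral_affine 0 s0) //; last first.
    by apply: (measurableT_comp mf); exact: measurable_fun_pair.
  rewrite -ge0_integralZl //; last first.
    by apply: (measurableT_comp mf); apply: measurable_fun_pair => //;
      exact: measurable_affine.
  apply: eq_integral => t _; rewrite /f /G -EFinM; congr (_%:E).
  rewrite /= /k /H addr0 /enorm /=.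
  have -> : s ^+ 2 + (s * t) ^+ 2 = (s * w t) ^+ 2.
    by rewrite exprMn exprMn sqr_sqrtr ?addr_ge0 ?sqr_ge0 //; ring.
  rewrite sqrtr_sqr [w t * s]mulrC.
  have -> : a * s + b * (s * t) = s * (a + b * t) by ring.
  rewrite !normrM exprMn.
  rewrite -[s ^+ 2](real_normK (num_real s)); field; by rewrite gt_eqF.
rewrite (fubini_tonelli G) //.
(* Rescaling the radius by [w t] supplies the third inverse power and leaves a radial integral
   independent of [t]. *)
transitivity (\int[mu]_t ((k t / w t ^+ 3)%:E * \int[mu]_r (H r)%:E))%E.
  apply: eq_integral => t _; rewrite /G /=.
  have mHE : measurable_fun setT (fun r => (H r)%:E) by apply/measurable_EFinP.
  rewrite (ge0_integral_affine 0 (lt0r_neq0 (w_gt0 t)) mHE); last first.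
    by move=> x; rewrite lee_fin.
  rewrite gtr0_norm // muleA -EFinM -ge0_integralZl //; last 3 first.
  - apply/measurable_EFinP; apply: (measurableT_comp mH); exact: measurable_affine.
  - by move=> x _; rewrite lee_fin.
  - rewrite lee_fin; apply: mulr_ge0; last exact: ltW.
    by apply: divr_ge0; [exact: normr_ge0|exact/exprn_ge0/ltW].
  apply: eq_integral => s _; rewrite -EFinM addr0; congr (_%:E).
  by field; rewrite gt_eqF.
rewrite ge0_integralZr //; last 3 first.
- by apply/measurable_EFinP; apply: measurable_funM => //; exact: (mwV 3).
- move=> t _; rewrite lee_fin.
  by apply: divr_ge0; [exact: normr_ge0|exact/exprn_ge0/ltW].
- by apply: integral_ge0 => r _; rewrite lee_fin.
by rewrite integral_angular.
Qed.

End polar.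

(** * The near and far parts of the kernel *)

Section radial_estimates.
Context {R : realType}.
Local Notation mu := (@lebesgue_measure R).
Local Notation T := (measurableTypeR R * measurableTypeR R)%type.
Local Notation pm := (mu \x mu)%E.

(** The inverse takes the value 0 at 0 and is discontinuous there, so this point is treated
    apart. *)
Lemma measurable_inv : measurable_fun setT (@GRing.inv R).
Proof.
have mD : measurable ([set~ 0] : set R) by exact: measurableC.
have m1 : measurable_fun ([set~ 0] : set R) (@GRing.inv R).
  apply: open_continuous_measurable_fun; first by apply: closed_openC; exact: (@closed_eq R 0).
  by move=> x /set_mem/eqP x0; exact: inv_continuous.
have m2 : measurable_fun ([set 0] : set R) (@GRing.inv R) by exact: measurable_fun_set1.
by rewrite -(setUv [set 0]); apply/measurable_funU.
Qed.

Lemma measurable_exprnV n : measurable_fun setT (fun r : R => r ^- n).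
Proof.
have m : measurable_fun setT (fun r : R => r ^+ n) by exact: exprn_measurable.
exact: (measurableT_comp measurable_inv m).
Qed.

Lemma ge0_integral_abs (g : R -> R) : measurable_fun setT g -> (forall r, 0 <= g r) ->
  (\int[mu]_r (g `|r|)%:E = 2%:E * \int[mu]_(r in `[0%R, +oo[) (g r)%:E)%E.
Proof.
move=> mg g0.
have mn : measurable_fun setT (fun r : R => `|r|) by exact: normr_measurable.
rewrite (ge0_integral_split_at 0); last 2 first.
- by apply/measurable_EFinP; exact: (measurableT_comp mg mn).
- by move=> x; rewrite lee_fin.
rewrite oppr0 (_ : 2%:E = (1 : R)%:E + (1 : R)%:E)%E // ge0_muleDl ?lee_fin // mul1e.
congr (_ + _)%E; apply: eq_integral => r /set_mem /=; rewrite in_itv /= andbT => r0.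
  by rewrite ger0_norm.
by rewrite normrN ger0_norm.
Qed.

Definition near_weight (delta r : R) : R := \1_(`]delta, 1]%classic : set R) r / r ^+ 3.

Lemma near_weight_ge0 delta r : 0 < delta -> 0 <= near_weight delta r.
Proof.
move=> d0; rewrite /near_weight indicE.
case: (boolP (r \in `]delta, 1]%classic)) => [/set_mem /=|_]; last by rewrite mul0r.
 rewrite in_itv /= => /andP[dr _].
by rewrite mul1r invr_ge0 exprn_ge0 // ltW // (lt_trans d0).
Qed.

Lemma measurable_near_weight delta : measurable_fun setT (near_weight delta).
Proof.
apply: measurable_funM; first exact: measurable_indic.
exact: measurable_exprnV.
Qed.

(** The constant 4 is 2 for the half circle of directions [(1, t)] times 2 for the two signs of the
    radius; [r^-3 * r^2] leaves [dr / r] on [[delta, 1]], whence the logarithm. *)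
Lemma integral_near_weight_dot (delta a b : R) : 0 < delta < 1 ->
  (\int[pm]_z (near_weight delta (enorm z) * `|a * z.1 + b * z.2|)%:E =
   (4 * ln delta^-1 * Num.sqrt (a ^+ 2 + b ^+ 2))%:E)%E.
Proof.
move=> /andP[d0 d1].
rewrite integral_radial_dot; [|exact: measurable_near_weight|by move=> r; exact: near_weight_ge0].
pose g r := near_weight delta r * r ^+ 2.
have mg : measurable_fun setT g.
  by apply: measurable_funM; [exact: measurable_near_weight|exact: exprn_measurable].
transitivity ((2 * Num.sqrt (a ^+ 2 + b ^+ 2))%:E * \int[mu]_r (g `|r|)%:E)%E.
  congr (_ * _)%E; apply: eq_integral => r _; rewrite /g real_normK ?num_real //.
rewrite ge0_integral_abs //; last first.
  by move=> r; rewrite mulr_ge0 ?sqr_ge0 // near_weight_ge0.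
have -> : (\int[mu]_(r in `[0%R, +oo[) (g r)%:E = \int[mu]_(r in `[delta, 1%R]) (r^-1)%:E)%E.
  rewrite -[RHS]integral_itv_obnd_cbnd; last first.
    by apply: measurable_funTS; apply/measurable_EFinP; exact: measurable_inv.
  rewrite [LHS]integral_mkcond [RHS]integral_mkcond; apply: eq_integral => r _.
  rewrite !patchE /g /near_weight indicE.
  case: (boolP (r \in `]delta, 1]%classic)) => [|_]; last first.
    by case: ifP => //; rewrite !mul0r.
  move=> /set_mem /=; rewrite in_itv /= => /andP[dr r1].
  have r0 : 0 < r by exact: lt_trans dr.
  rewrite ifT; last by apply/mem_set; rewrite /= in_itv /= ltW.
  by congr (_%:E); field; rewrite gt_eqF.
rewrite (@continuous_FTC2 _ _ (@ln R)) //.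
- rewrite ln1 -!EFinB -!EFinM lnV ?posrE // ; congr (_%:E); ring.
- apply: continuous_in_subspaceT => r /set_mem /=; rewrite in_itv /= => /andP[dr _].
  by apply: inv_continuous; rewrite gt_eqF // (lt_le_trans d0).
- split.
  + by move=> r; rewrite in_itv /= => /andP[dr _]; have [] := is_derive1_ln (lt_trans d0 dr).
  + by apply: cvg_at_right_filter; apply: continuous_ln.
  + by apply: cvg_at_left_filter; apply: continuous_ln.
- move=> r; rewrite in_itv /= => /andP[dr _]; rewrite derive1E.
  by have [_ ->] := is_derive1_ln (lt_trans d0 dr).
Qed.

Lemma enorm_le (z : plane R) : enorm z <= `|1 * z.1 + 0 * z.2| + `|0 * z.1 + 1 * z.2|.
Proof.
rewrite !mul0r !mul1r addr0 add0r -[leRHS]ger0_norm ?addr_ge0 // -sqrtr_sqr.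
apply: ler_wsqrtr; rewrite sqrrD !real_normK ?num_real //.
by rewrite lerD2r lerDl mulrn_wge0 // mulr_ge0.
Qed.

(** The radial formula is available for linear forms only, so [|z|] is bounded by [|z.1| + |z.2|],
    each of which contributes [4 M]. The sharp constant would be [2 pi]. *)
Lemma integral_radial_enorm_le (h : R -> R) (M : R) :
  measurable_fun setT h -> (forall r, 0 <= h r) ->
  (\int[mu]_(r in `[0%R, +oo[) (h r * r ^+ 2)%:E <= M%:E)%E ->
  (\int[pm]_z (h (enorm z) * enorm z)%:E <= (8 * M)%:E)%E.
Proof.
move=> mh h0 hM.
have I a b : a ^+ 2 + b ^+ 2 = 1 ->
    (\int[pm]_z (h (enorm z) * `|a * z.1 + b * z.2|)%:E <= (4 * M)%:E)%E.
  move=> ab; rewrite integral_radial_dot // ab sqrtr1 mulr1.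
  pose g r := h r * r ^+ 2.
  have mg : measurable_fun setT g.
    by apply: measurable_funM => //; exact: exprn_measurable.
  rewrite (_ : (\int[mu]_r (h `|r| * r ^+ 2)%:E = \int[mu]_r (g `|r|)%:E)%E); last first.
    by apply: eq_integral => r _; rewrite /g real_normK ?num_real.
  rewrite ge0_integral_abs //; last by move=> r; rewrite mulr_ge0 ?sqr_ge0.
  rewrite muleA -EFinM (_ : 2 * 2 = 4); last by ring.
  by rewrite EFinM lee_pmul2l.
have mhe := measurableT_comp mh measurable_enorm.
have mI a b : measurable_fun setT (fun z : T => h (enorm z) * `|a * z.1 + b * z.2|).
  by apply: measurable_funM => //; apply: measurableT_comp => //; exact: measurable_dot.
apply: (@le_trans _ _ (\int[pm]_z ((h (enorm z) * `|1 * z.1 + 0 * z.2|)%:E +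
   (h (enorm z) * `|0 * z.1 + 1 * z.2|)%:E))%E).
  apply: ge0_le_integral => //.
  - by move=> z _; rewrite lee_fin mulr_ge0 // sqrtr_ge0.
  - by apply/measurable_EFinP; apply: measurable_funM => //; exact: measurable_enorm.
  - by apply: emeasurable_funD; apply/measurable_EFinP; exact: mI.
  - by move=> z _; rewrite -EFinD lee_fin -mulrDr ler_wpM2l // enorm_le.
rewrite ge0_integralD //; last 4 first.
- by move=> z _; rewrite lee_fin mulr_ge0.
- by apply/measurable_EFinP; exact: mI.
- by move=> z _; rewrite lee_fin mulr_ge0.
- by apply/measurable_EFinP; exact: mI.
rewrite (_ : 8 * M = 4 * M + 4 * M) ?EFinD; last by ring.
by apply: leeD; apply: I; rewrite expr0n expr1n ?addr0 ?add0r.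
Qed.

Lemma integral_tail_le :
  (\int[pm]_z (\1_(`]1, +oo[%classic : set R) (enorm z) / enorm z ^+ 3)%:E <= 8%:E)%E.
Proof.
(* Writing [|z|^-3] as [|z|^-4 * |z|] leaves the radial integrand [r^-2], whose integral over [[1,
   +oo[] is 1. *)
pose h (r : R) := \1_(`]1, +oo[%classic : set R) r / r ^+ 4.
have -> : (\int[pm]_z (\1_(`]1, +oo[%classic : set R) (enorm z) / enorm z ^+ 3)%:E =
    \int[pm]_z (h (enorm z) * enorm z)%:E)%E.
  apply: eq_integral => z _; congr (_%:E); rewrite /h indicE.
  case: (boolP (enorm z \in `]1, +oo[%classic)) => [/set_mem /=|_]; last by rewrite !mul0r.
  rewrite in_itv /= andbT => z1.
  by field; rewrite gt_eqF // (lt_trans _ z1).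
rewrite -[8]mulr1; apply: integral_radial_enorm_le.
- apply: measurable_funM; first exact: measurable_indic.
  exact: measurable_exprnV.
- move=> r; rewrite /h indicE; case: (boolP (r \in `]1, +oo[%classic)) => [/set_mem /=|_]; last by rewrite mul0r.
  rewrite in_itv /= andbT => r1.
  by rewrite mul1r invr_ge0 exprn_ge0 // ltW // (lt_trans _ r1).
have -> : (\int[mu]_(r in `[0%R, +oo[) (h r * r ^+ 2)%:E = \int[mu]_(r in `[1%R, +oo[) (r ^- 2)%:E)%E.
  rewrite -[RHS]integral_itv_obnd_cbnd; last first.
    apply: measurable_funTS; apply/measurable_EFinP.
    exact: measurable_exprnV.
  rewrite [LHS]integral_mkcond [RHS]integral_mkcond; apply: eq_integral => r _.
  rewrite !patchE /h indicE.
  case: (boolP (r \in `]1, +oo[%classic)) => [|_]; last first.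
    by case: ifP => //; rewrite !mul0r.
  move=> /set_mem /=; rewrite in_itv /= andbT => r1.
  have r0 : 0 < r by exact: lt_trans r1.
  rewrite ifT; last by apply/mem_set; rewrite /= in_itv /= ltW.
  by congr (_%:E); field; rewrite gt_eqF.
have D (r : R) : 0 < r -> is_derive r 1 (fun r : R => - r^-1) (r ^- 2).
  move=> r0; have r0' : id r != 0 by rewrite gt_eqF.
  have H := is_deriveN (is_deriveV r0' (is_derive_id r 1)).
  by apply: (is_derive_eq H); rewrite /GRing.scale /= mulr1 opprK.
rewrite (@ge0_continuous_FTC2y _ _ (fun r : R => - r^-1) _ 0) //.
- by rewrite invr1 -EFinB sub0r opprK.
- by move=> x x1; rewrite invr_ge0 sqr_ge0.
- apply: continuous_in_subspaceT => r /set_mem /=; rewrite in_itv /= andbT => r1.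
  have r0 : 0 < r by exact: lt_le_trans r1.
  apply: cvgV; first by rewrite expf_neq0 // gt_eqF.
  exact: exprn_continuous.
- rewrite -oppr0; apply: cvgN; by apply/gtr0_cvgV0; [exact: nbhs_pinfty_gt|exact: cvg_id].
- by move=> x x1; have [] := D _ (lt_trans ltr01 x1).
- apply: cvg_at_right_filter; apply: cvgN; apply: cvgV => //; exact: cvg_id.
- move=> r; rewrite in_itv /= andbT => r1; rewrite derive1E.
  by have [_ ->] := D _ (lt_trans ltr01 r1).
Qed.

(** The bound is uniform in [delta] because [1 / |z|] is integrable at the origin of the plane. It
    is what makes the second order Taylor remainder cost only a constant. *)
Lemma integral_near_weight_sqr_le (delta : R) : 0 < delta ->
  (\int[pm]_z (near_weight delta (enorm z) * enorm z ^+ 2)%:E <= 8%:E)%E.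
Proof.
move=> d0.
pose h r := near_weight delta r * r.
have -> : (\int[pm]_z (near_weight delta (enorm z) * enorm z ^+ 2)%:E =
   \int[pm]_z (h (enorm z) * enorm z)%:E)%E.
  by apply: eq_integral => z _; rewrite /h -mulrA -expr2.
have h0 r : 0 <= h r.
  rewrite /h /near_weight indicE; case: (boolP (r \in `]delta, 1]%classic)) => [/set_mem /=|_]; last by rewrite !mul0r.
  rewrite in_itv /= mul1r => /andP[r1 _]; have r0 := ltW (lt_trans d0 r1).
  by rewrite mulr_ge0 // invr_ge0 exprn_ge0.
have mh : measurable_fun setT h.
  by apply: measurable_funM => //; exact: measurable_near_weight.
rewrite -[8]mulr1; apply: integral_radial_enorm_le => //.
apply: (@le_trans _ _ (\int[mu]_(r in `[0%R, +oo[) (\1_(`]0%R, 1%R]%classic : set R) r)%:E)%E).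
  apply: ge0_le_integral => //.
  - by move=> r _; rewrite lee_fin mulr_ge0 // sqr_ge0.
  - apply: measurable_funTS; apply/measurable_EFinP; apply: measurable_funM => //.
  - by apply: measurable_funTS; apply/measurable_EFinP; exact: measurable_indic.
  - move=> r _; rewrite lee_fin /h /near_weight !indicE.
    case: (boolP (r \in `]delta, 1]%classic)) => [/set_mem /=|_]; last by rewrite !mul0r.
    rewrite in_itv /= mul1r => /andP[r1 rle]; have r0 := lt_trans d0 r1.
    rewrite mem_set /= ?in_itv /= ?r0 //.
    by rewrite le_eqVlt; apply/orP; left; apply/eqP; field; rewrite gt_eqF.
rewrite integral_indic //.
apply: (@le_trans _ _ (mu `]0, 1]%classic)); first by apply: le_measure; rewrite ?inE //; exact: measurableI.
by rewrite lebesgue_measure_itv /= lte_fin ltr01 -EFinB subr0.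
Qed.

End radial_estimates.

(** * Convolution with a C^(1,1) kernel *)

Lemma differentiable_of_quadratic (R : realType) (V W : normedModType R)
    (f : V -> W) (df : {linear V -> W}) (x : V) (C : R) : continuous df ->
  (forall h, `|h| <= 2^-1 -> `|f (x + h) - f x - df h| <= C * `|h| ^+ 2) ->
  differentiable f x /\ 'd f x = df :> (V -> W).
Proof.
move=> cdf H.
have E : f \o shift x = cst (f x) + df +o_ 0 id.
  apply/eqaddoP => e e0; near=> h.
  have h1 : `|h| <= 2^-1.
    near: h; apply/nbhs_le_nbhs_norm; exists 2^-1 => //= h /=.
    by rewrite /= distrC subr0 => /ltW.
  have h2 : `|h| <= e / (`|C| + 1).
    near: h; apply/nbhs_le_nbhs_norm; exists (e / (`|C| + 1)) => /=.
      by rewrite divr_gt0 // ltr_wpDl.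
    by move=> h /=; rewrite distrC subr0 => /ltW.
  rewrite !fctE /= opprD addrA [h + x]addrC (le_trans (H _ h1)) //.
  rewrite expr2 mulrA ler_wpM2r //.
  move: h2; rewrite ler_pdivlMr ?ltr_wpDl // => h2.
  rewrite (le_trans _ h2) // mulrC ler_wpM2l //.
  by rewrite (le_trans (ler_norm C)) // lerDl.
have dE := diff_unique cdf E.
split; last exact: dE.
by apply/diff_locallyP; rewrite dE; split.
Unshelve. all: by end_near. Qed.

Section plane_C1.
Context {R : realType}.
Local Notation plane := (R * R)%type.

Definition linear_form (a b : R) (h : plane) : R := a * h.1 + b * h.2.

Lemma linear_form_is_linear (a b : R) : linear (linear_form a b).
Proof. by move=> k x y; rewrite /linear_form /= /GRing.scale /=; ring. Qed.

HB.instance Definition _ (a b : R) :=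
  GRing.isLinear.Build R plane R _ (linear_form a b) (linear_form_is_linear a b).

Lemma continuous_linear_form (a b : R) : continuous (linear_form a b).
Proof.
move=> x; apply: cvgD; apply: cvgM; try exact: cvg_cst.
  exact: cvg_fst.
exact: cvg_snd.
Qed.

Lemma prod_norm_le1 (h : plane) : `|h.1| <= `|h|.
Proof. by rewrite prod_normE le_max lexx. Qed.

Lemma prod_norm_le2 (h : plane) : `|h.2| <= `|h|.
Proof. by rewrite prod_normE le_max lexx orbT. Qed.

(** The quadratic bound identifies [f1] and [f2] as the partial derivatives, and the Lipschitz
    bounds make them continuous. In this form the criterion applies to convolutions without
    differentiating under the integral sign. *)
Lemma C1_of_quadratic (f f1 f2 : plane -> R) (C : R) :
  (forall x h, `|h| <= 2^-1 ->
    `|f (x + h) - f x - linear_form (f1 x) (f2 x) h| <= C * `|h| ^+ 2) ->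
  (forall x h, `|h| <= 2^-1 -> `|f1 (x + h) - f1 x| <= C * `|h|) ->
  (forall x h, `|h| <= 2^-1 -> `|f2 (x + h) - f2 x| <= C * `|h|) ->
  [/\ C1 f, (fun x => 'D_(1, 0) f x) = f1 & (fun x => 'D_(0, 1) f x) = f2].
Proof.
move=> H H1 H2.
have D x : differentiable f x /\ 'd f x = linear_form (f1 x) (f2 x) :> (plane -> R).
  by apply: differentiable_of_quadratic (H x); exact: continuous_linear_form.
have E1 : (fun x => 'D_(1, 0) f x) = f1.
  apply/funext => x; have [dfx E] := D x.
  by rewrite deriveE // E /linear_form /= mulr1 mulr0 addr0.
have E2 : (fun x => 'D_(0, 1) f x) = f2.
  apply/funext => x; have [dfx E] := D x.
  by rewrite deriveE // E /linear_form /= mulr1 mulr0 add0r.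
have cont g : (forall x h, `|h| <= 2^-1 -> `|g (x + h) - g x| <= C * `|h|) ->
    continuous g.
  move=> Hg x; apply/cvgrPdist_le => e e0; near=> y.
  have h1 : `|y - x| <= 2^-1.
    near: y; apply/nbhs_le_nbhs_norm; exists 2^-1 => //= h /=.
    by rewrite distrC => /ltW.
  have h2 : `|y - x| <= e / (`|C| + 1).
    near: y; apply/nbhs_le_nbhs_norm; exists (e / (`|C| + 1)) => /=.
      by rewrite divr_gt0 // ltr_wpDl.
    by move=> h /=; rewrite distrC => /ltW.
  have := Hg x _ h1; rewrite [x + _]addrC subrK distrC => /le_trans; apply.
  move: h2; rewrite ler_pdivlMr ?ltr_wpDl // => h2.
  rewrite (le_trans _ h2) // mulrC ler_wpM2l //.
  by rewrite (le_trans (ler_norm C)) // lerDl.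
split => //; split; first by move=> x; have [] := D x.
  by rewrite E1; exact: cont.
by rewrite E2; exact: cont.
Unshelve. all: by end_near. Qed.

End plane_C1.

Section convolution.
Context {R : realType}.
Local Notation mu := (@lebesgue_measure R).
Local Notation T := (measurableTypeR R * measurableTypeR R)%type.
Local Notation pm := (mu \x mu)%E.
Implicit Types (f g K : T -> R).

Definition convol K f (x : T) : R := (\int[pm]_y (f y * K (x - y)))%R.

Lemma measurable_reflection (x : T) : measurable_fun setT (fun y : T => x - y : T).
Proof.
have m1 : measurable_fun setT (fun y : T => x.1 - y.1 : measurableTypeR R).
  by apply: measurable_funB => //; exact: measurable_fst.
have m2 : measurable_fun setT (fun y : T => x.2 - y.2 : measurableTypeR R).
  by apply: measurable_funB => //; exact: measurable_snd.
exact: (measurable_fun_pair m1 m2).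
Qed.

Lemma integrable_mul_bounded f g (C : R) : measurable_fun setT g ->
  (forall x, `|g x| <= C) -> pm.-integrable setT (EFin \o f) ->
  pm.-integrable setT (fun x => (f x * g x)%:E).
Proof.
move=> mg gC fi.
have mf : measurable_fun setT f by apply/measurable_EFinP; exact: measurable_int fi.
apply: (@le_integrable _ _ _ _ _ _ _ (fun x => C%:E * (f x)%:E)%E) => //.
- by apply/measurable_EFinP; exact: measurable_funM.
- move=> x _; rewrite -EFinM !abse_EFin lee_fin !normrM mulrC ler_wpM2r //.
  by rewrite (le_trans (gC x)) // ler_norm.
- exact: integrableZl.
Qed.

Lemma integrable_conv K f (C : R) (x : T) : measurable_fun setT K ->
  (forall x, `|K x| <= C) -> pm.-integrable setT (EFin \o f) ->
  pm.-integrable setT (fun y => (f y * K (x - y))%:E).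
Proof.
move=> mK KC fi; apply: (@integrable_mul_bounded f (fun y => K (x - y)) C) => //.
exact: (measurableT_comp mK (measurable_reflection x)).
Qed.

Lemma le_norm_conv K f (C : R) (x : T) : measurable_fun setT K ->
  (forall x, `|K x| <= C) -> pm.-integrable setT (EFin \o f) ->
  `|convol K f x| <= C * (\int[pm]_y `|f y|)%R.
Proof.
move=> mK KC fi.
have ci := integrable_conv x mK KC fi.
rewrite (le_trans (le_normr_Rintegral _ ci)) //.
rewrite -RintegralZl //; last exact: integrable_norm.
apply: le_Rintegral => //.
- exact: integrable_norm ci.
- apply: (@integrableZl _ _ _ _ _ measurableT C (EFin \o (fun y => `|f y|))).
  exact: integrable_norm.
- by move=> y _; rewrite normrM mulrC ler_wpM2r.
Qed.

(** [K1] and [K2] stand for the partial derivatives of [K]. They are specified by finite difference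
    estimates, each inherited by the convolution with an integrable function, with [C] multiplied by
    its [L^1] norm. *)
Record C11_kernel K (K1 K2 : T -> R) (C : R) : Prop := {
  kernel_meas : measurable_fun setT K ;
  kernel_meas1 : measurable_fun setT K1 ;
  kernel_meas2 : measurable_fun setT K2 ;
  kernel_le : forall x, `|K x| <= C ;
  kernel_le1 : forall x, `|K1 x| <= C ;
  kernel_le2 : forall x, `|K2 x| <= C ;
  kernel_quad : forall x h : (R * R)%type, `|h| <= 2^-1 ->
    `|K (x + h) - K x - linear_form (K1 x) (K2 x) h| <= C * `|h| ^+ 2 ;
  kernel_lip1 : forall x h : (R * R)%type, `|h| <= 2^-1 -> `|K1 (x + h) - K1 x| <= C * `|h| ;
  kernel_lip2 : forall x h : (R * R)%type, `|h| <= 2^-1 -> `|K2 (x + h) - K2 x| <= C * `|h| }.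

Lemma conv_translation_diff K f (C : R) (x h : T) : measurable_fun setT K ->
  (forall x, `|K x| <= C) -> pm.-integrable setT (EFin \o f) ->
  convol K f (x + h) - convol K f x = convol (fun y => K (y + h) - K y) f x.
Proof.
move=> mK KC fi.
rewrite /convol -RintegralB //; last 2 first.
- exact: (integrable_conv (x + h) mK KC fi).
- exact: (integrable_conv x mK KC fi).
by apply: eq_Rintegral => y _; rewrite mulrBr addrAC.
Qed.

Lemma conv_lipschitz K f (C : R) (x h : T) : measurable_fun setT K ->
  (forall x, `|K x| <= C) -> pm.-integrable setT (EFin \o f) ->
  (forall x, `|K (x + h) - K x| <= C * `|h : (R * R)%type|) ->
  `|convol K f (x + h) - convol K f x| <=
    C * (\int[pm]_y `|f y|)%R * `|h : (R * R)%type|.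
Proof.
move=> mK KC fi Kh; rewrite (conv_translation_diff _ _ mK KC fi).
rewrite mulrAC; apply: le_norm_conv => //.
by apply: measurable_funB => //; exact: (measurableT_comp mK (measurable_translation h)).
Qed.

(** By linearity the Taylor remainder of the convolution is the convolution of [f] with the Taylor
    remainder of [K]. *)
Lemma conv_quadratic K K1 K2 f (C : R) (x h : T) : C11_kernel K K1 K2 C ->
  pm.-integrable setT (EFin \o f) -> `|h : (R * R)%type| <= 2^-1 ->
  `|convol K f (x + h) - convol K f x - linear_form (convol K1 f x) (convol K2 f x) h| <=
    C * (\int[pm]_y `|f y|)%R * `|h : (R * R)%type| ^+ 2.
Proof.
move=> kK fi h1.
rewrite (conv_translation_diff _ _ (kernel_meas kK) (kernel_le kK) fi).
have mKh : measurable_fun setT (fun y : T => K (y + h) - K y).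
  apply: measurable_funB; last exact: kernel_meas kK.
  exact: (measurableT_comp (kernel_meas kK) (measurable_translation h)).
have bKh (y : T) : `|K (y + h) - K y| <= C + C.
  by rewrite (le_trans (ler_normB _ _)) // lerD // (kernel_le kK).
have bl (y : T) : `|linear_form (K1 y) (K2 y) h| <= C * `|h.1| + C * `|h.2|.
  rewrite (le_trans (ler_normD _ _)) // !normrM.
  by rewrite lerD // ler_wpM2r // ?(kernel_le1 kK) ?(kernel_le2 kK).
have ml : measurable_fun setT (fun y : T => linear_form (K1 y) (K2 y) h).
  by apply: measurable_funD; apply: measurable_funM => //;
    [exact: kernel_meas1 kK|exact: kernel_meas2 kK].
have -> : linear_form (convol K1 f x) (convol K2 f x) h =
    convol (fun y => linear_form (K1 y) (K2 y) h) f x.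
  rewrite /linear_form /convol -!RintegralZr //; last 2 first.
  - exact: integrable_conv x (kernel_meas2 kK) (kernel_le2 kK) fi.
  - exact: integrable_conv x (kernel_meas1 kK) (kernel_le1 kK) fi.
  rewrite -RintegralD //; last 2 first.
  - apply: (@integrableZr _ _ _ _ _ _ h.1 (fun y => (f y * K1 (x - y))%:E)) => //.
    exact: integrable_conv x (kernel_meas1 kK) (kernel_le1 kK) fi.
  - apply: (@integrableZr _ _ _ _ _ _ h.2 (fun y => (f y * K2 (x - y))%:E)) => //.
    exact: integrable_conv x (kernel_meas2 kK) (kernel_le2 kK) fi.
  by apply: eq_Rintegral => y _; rewrite mulrDr !mulrA.
have -> : convol (fun y => K (y + h) - K y) f x -
    convol (fun y => linear_form (K1 y) (K2 y) h) f x =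
    convol (fun y => K (y + h) - K y - linear_form (K1 y) (K2 y) h) f x.
  rewrite /convol -RintegralB //; last 2 first.
  - exact: (integrable_conv x mKh bKh fi).
  - exact: (integrable_conv x ml bl fi).
  by apply: eq_Rintegral => y _; rewrite [RHS]mulrBr.
rewrite mulrAC; apply: le_norm_conv => //.
  exact: measurable_funB.
by move=> y; exact: kernel_quad.
Qed.

Lemma conv_C1 K K1 K2 f (C : R) : C11_kernel K K1 K2 C ->
  pm.-integrable setT (EFin \o f) ->
  [/\ C1 (convol K f), (fun x => 'D_(1, 0) (convol K f : (R * R)%type -> R) x) = convol K1 f &
    (fun x => 'D_(0, 1) (convol K f : (R * R)%type -> R) x) = convol K2 f].
Proof.
move=> kK fi.
apply: (@C1_of_quadratic R _ _ _ (C * (\int[pm]_y `|f y|)%R)) => x h h1.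
- exact: conv_quadratic.
- apply: conv_lipschitz => //; [exact: kernel_meas1 kK|exact: kernel_le1 kK|].
  by move=> y; exact: (kernel_lip1 kK).
- apply: conv_lipschitz => //; [exact: kernel_meas2 kK|exact: kernel_le2 kK|].
  by move=> y; exact: (kernel_lip2 kK).
Qed.

End convolution.

(** * A compactly supported kernel of class C^(1,1) *)

Section bump_fun.
Context {R : realType}.
Local Notation mu := (@lebesgue_measure R).
Local Notation T := (measurableTypeR R * measurableTypeR R)%type.
Local Notation pm := (mu \x mu)%E.
Implicit Types (e : R) (x h : R * R).

(** The kernel is built from the square of this function: squaring the positive part makes it
    differentiable across the circle of radius [e], with Lipschitz partial derivatives. *)
Definition bump_base e x : R := Num.max 0 (e ^+ 2 - x.1 ^+ 2 - x.2 ^+ 2).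

Lemma bump_base_ge0 e x : 0 <= bump_base e x.
Proof. by rewrite /bump_base le_max lexx. Qed.

Lemma bump_baseP e x :
  (bump_base e x = 0 /\ e ^+ 2 <= x.1 ^+ 2 + x.2 ^+ 2) \/
  (bump_base e x = e ^+ 2 - x.1 ^+ 2 - x.2 ^+ 2 /\ x.1 ^+ 2 + x.2 ^+ 2 < e ^+ 2).
Proof.
rewrite /bump_base; case: (leP (e ^+ 2 - x.1 ^+ 2 - x.2 ^+ 2) 0) => H.
  by left; split => //; move: H; lra.
by right; split => //; move: H; lra.
Qed.

Lemma bump_base_le1 e x : 0 < e <= 1 -> bump_base e x <= 1.
Proof.
move=> /andP[e0 e1]; have := sqr_ge0 x.1; have := sqr_ge0 x.2.
by case: (bump_baseP e x) => -[-> _] //; nra.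
Qed.

Let dot_sqr_le (a b u v : R) : (a * u + b * v) ^+ 2 <= (a ^+ 2 + b ^+ 2) * (u ^+ 2 + v ^+ 2).
Proof.
rewrite -subr_ge0 (_ : _ - _ = (a * v - b * u) ^+ 2) ?sqr_ge0 //; ring.
Qed.

(** With [d = x . h] and [N = |h|^2], the squared modulus changes by [2 d + N], and [d^2 <= N]
    inside the disc since [e <= 1]. Then [(2 d + N)^2 <= 8 d^2 + 2 N^2 <= 10 N]. When only [x + h]
    lies in the disc, [d + N] takes the place of [d]. *)
Lemma bump_base_diff e x h : 0 < e <= 1 -> h.1 ^+ 2 + h.2 ^+ 2 <= 1 ->
  (bump_base e (x + h) - bump_base e x) ^+ 2 <= 10 * (h.1 ^+ 2 + h.2 ^+ 2).
Proof.
move=> /andP[e0 e1].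
have := bump_baseP e x; have := bump_baseP e (x + h).
move: (bump_base e x) (bump_base e (x + h)) => p p'.
case: x h => x1 x2 [h1 h2] /=.
set N := h1 ^+ 2 + h2 ^+ 2 => Hp' Hp N1.
have N0 : 0 <= N by rewrite addr_ge0 ?sqr_ge0.
pose d := x1 * h1 + x2 * h2.
have E' : (x1 + h1) ^+ 2 + (x2 + h2) ^+ 2 = x1 ^+ 2 + x2 ^+ 2 + 2 * d + N.
  by rewrite /N /d; ring.
have e2 : e ^+ 2 <= 1 by nra.
have D : x1 ^+ 2 + x2 ^+ 2 < e ^+ 2 -> d ^+ 2 <= N.
  move=> xe; rewrite (le_trans (dot_sqr_le _ _ _ _)) // -/N.
  by rewrite ler_piMl //; lra.
have D' : (x1 + h1) ^+ 2 + (x2 + h2) ^+ 2 < e ^+ 2 -> (d + N) ^+ 2 <= N.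
  move=> xe; have -> : d + N = (x1 + h1) * h1 + (x2 + h2) * h2 by rewrite /d /N; ring.
  rewrite (le_trans (dot_sqr_le _ _ _ _)) // -/N.
  by rewrite ler_piMl //; lra.
have NN : N ^+ 2 <= N by rewrite expr2 ler_piMl.
case: Hp => -[-> Hp]; case: Hp' => -[-> Hp'].
- by rewrite subrr expr0n mulr_ge0.
- have {}D' := D' Hp'.
  have H : 0 <= e ^+ 2 - (x1 + h1) ^+ 2 - (x2 + h2) ^+ 2 <= - 2 * (d + N) + N.
    by apply/andP; split; lra.
  rewrite subr0.
  apply: (@le_trans _ _ ((- 2 * (d + N) + N) ^+ 2)).
    by rewrite ler_sqr ?nnegrE; case/andP: H => // H1 H2; rewrite (le_trans H1).
  have := sqr_ge0 (2 * (d + N) + N); nra.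
- have {}D := D Hp.
  have H : 0 <= e ^+ 2 - x1 ^+ 2 - x2 ^+ 2 <= 2 * d + N.
    by apply/andP; split; lra.
  rewrite sub0r sqrrN.
  apply: (@le_trans _ _ ((2 * d + N) ^+ 2)).
    by rewrite ler_sqr ?nnegrE; case/andP: H => // H1 H2; rewrite (le_trans H1).
  have := sqr_ge0 (2 * d - N); nra.
- have {}D := D Hp.
  have -> : e ^+ 2 - (x1 + h1) ^+ 2 - (x2 + h2) ^+ 2 - (e ^+ 2 - x1 ^+ 2 - x2 ^+ 2) = - (2 * d + N).
    by rewrite /d /N; ring.
  have := sqr_ge0 (2 * d - N); nra.
Qed.

Lemma bump_quadratic e x h : 0 < e <= 1 -> h.1 ^+ 2 + h.2 ^+ 2 <= 1 ->
  `|bump_base e (x + h) ^+ 2 - bump_base e x ^+ 2 +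
    4 * bump_base e x * (x.1 * h.1 + x.2 * h.2)| <= 10 * (h.1 ^+ 2 + h.2 ^+ 2).
Proof.
move=> e01 h1.
have := bump_base_diff x e01 h1.
have := bump_base_le1 x e01; have := bump_base_ge0 e x; have := bump_base_ge0 e (x + h).
move/andP : e01 => [e0 e1].
have := bump_baseP e x; have := bump_baseP e (x + h).
move: (bump_base e x) (bump_base e (x + h)) h1 => p p'.
case: x h => x1 x2 [h1 h2] /=.
set N := h1 ^+ 2 + h2 ^+ 2 => N1 Hp' Hp p'0 p0 p1 pp'.
have N0 : 0 <= N by rewrite addr_ge0 ?sqr_ge0.
pose d := x1 * h1 + x2 * h2.
have E' : (x1 + h1) ^+ 2 + (x2 + h2) ^+ 2 = x1 ^+ 2 + x2 ^+ 2 + 2 * d + N.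
  by rewrite /N /d; ring.
rewrite -/d.
(* Adding [2 p N] turns the remainder into [(p' - p)^2] when both points lie in the disc. If only
   [x] does, then [p' = 0] and with [A = 2 d + N >= p] the shifted quantity is [2 p A - p^2],
   between 0 and [A^2]. *)
suff : 0 <= p' ^+ 2 - p ^+ 2 + 2 * p * (2 * d + N) <= 10 * N.
  move=> /andP[X0 X1]; have pN : 0 <= p * N by exact: mulr_ge0.
  have pN1 : p * N <= N by rewrite ler_piMl.
  by rewrite ler_norml; apply/andP; split; lra.
have p'E : p' = 0 \/ p' = p - (2 * d + N) \/ p = 0.
  by case: Hp => -[-> Hp]; case: Hp' => -[-> Hp']; [left|do 2 right|left|right; left; lra].
case: Hp => -[pE Hp].
  by rewrite pE mulr0 mul0r addr0 expr0n subr0 sqr_ge0 /=; move: pp'; rewrite pE subr0.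
case: Hp' => -[p'E' Hp'].
  have e2 : e ^+ 2 <= 1 by nra.
  have D : d ^+ 2 <= N.
    rewrite (le_trans (dot_sqr_le _ _ _ _)) // -/N.
    by rewrite ler_piMl //; lra.
  have NN : N ^+ 2 <= N by rewrite expr2 ler_piMl.
  have pa : p <= 2 * d + N by rewrite pE; lra.
  have H := sqr_ge0 (2 * d - N).
  have A2 : (2 * d + N) ^+ 2 <= 10 * N by nra.
  move: pa A2; set A := 2 * d + N => pa A2.
  have Ap : 0 <= p * (A - p) by rewrite mulr_ge0 // subr_ge0.
  have := sqr_ge0 (A - p).
  by rewrite p'E' expr0n /= => H2; apply/andP; split; nra.
have -> : 2 * d + N = p - p' by rewrite pE p'E'; lra.
have -> : p' ^+ 2 - p ^+ 2 + 2 * p * (p - p') = (p' - p) ^+ 2 by ring.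
by rewrite sqr_ge0.
Qed.

Definition bump_fun (c e : R) (x : R * R) : R := c * bump_base e x ^+ 2.
Definition bump1 (c e : R) (x : R * R) : R := c * (- 4 * x.1 * bump_base e x).
Definition bump2 (c e : R) (x : R * R) : R := c * (- 4 * x.2 * bump_base e x).

Lemma measurable_bump_base e : measurable_fun setT (bump_base e : T -> R).
Proof.
apply: measurable_maxr => //.
by apply: measurable_funB; [apply: measurable_funB => //|]; apply: measurable_funX.
Qed.

Lemma norm_sqr_le (h : R * R) : h.1 ^+ 2 + h.2 ^+ 2 <= 2 * `|h| ^+ 2.
Proof.
rewrite mulr_natl mulr2n -(real_normK (num_real h.1)) -(real_normK (num_real h.2)).
by rewrite lerD // lerXn2r ?nnegrE // ?prod_norm_le1 ?prod_norm_le2.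
Qed.

Lemma bump_support_coord e x : 0 < e <= 1 -> bump_base e x != 0 ->
  `|x.1| <= e /\ `|x.2| <= e.
Proof.
move=> /andP[e0 e1]; case: (bump_baseP e x) => -[-> H]; rewrite ?eqxx // => _.
have := sqr_ge0 x.1; have := sqr_ge0 x.2 => a b.
by split; rewrite -ler_sqr ?nnegrE ?(ltW e0) // real_normK ?num_real //; lra.
Qed.

(** One constant serves all six bounds. Up to the factor [c], the largest ones obtained are 20 for
    the Taylor remainder and [4 * (1 + 5) = 24] for the Lipschitz constant of the partial
    derivatives. *)
Lemma bump_kernel c e : 0 < c -> 0 < e <= 1 ->
  C11_kernel (bump_fun c e) (bump1 c e) (bump2 c e) (c * 40).
Proof.
move=> c0 e01.
have b0 := bump_base_ge0 e; have b1 := fun x => bump_base_le1 x e01.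
(* The norm of the plane is the sup norm; the threshold 1/2 keeps the Euclidean norm below 1, as the
   bump estimates require. *)
have N1 (h : R * R) : `|h| <= 2^-1 -> h.1 ^+ 2 + h.2 ^+ 2 <= 1.
  move=> h1; apply: (le_trans (norm_sqr_le h)).
  by have := normr_ge0 h; nra.
have m1 : measurable_fun setT (fun x : T => x.1 : R) by exact: measurable_fst.
have m2 : measurable_fun setT (fun x : T => x.2 : R) by exact: measurable_snd.
have mb := measurable_bump_base e.
have xb (y t : R) : `|y| <= e -> 0 <= t <= 1 -> `|- 4 * y * t| <= 4.
  move=> ye /andP[t0 t1]; case/andP: e01 => e0 e1.
  rewrite !normrM normrN (ger0_norm t0) normr_nat -mulrA ler_piMr //.
  by rewrite mulr_ile1 // (le_trans ye).
have bd (g : R * R -> R) : (forall x, bump_base e x != 0 -> `|g x| <= e) ->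
    forall x, `|c * (- 4 * g x * bump_base e x)| <= c * 40.
  move=> Hg x; rewrite normrM gtr0_norm // ler_pM2l //.
  have [E|nz] := eqVneq (bump_base e x) 0; first by rewrite E mulr0 normr0.
  by rewrite (le_trans (xb _ _ (Hg x nz) _)) ?b0 ?b1 //; lra.
have diff (x h : R * R) : `|h| <= 2^-1 ->
    `|bump_base e (x + h) - bump_base e x| <= 5 * `|h|.
  move=> h1; rewrite -ler_sqr ?nnegrE ?mulr_ge0 // real_normK ?num_real //.
  apply: (le_trans (bump_base_diff x e01 (N1 h h1))).
  have := norm_sqr_le h; have := sqr_ge0 `|h|; rewrite exprMn; lra.
have lip (g : R * R -> R) : (forall x, bump_base e x != 0 -> `|g x| <= e) ->
    (forall x h, `|g (x + h) - g x| <= `|h|) ->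
    forall x h, `|h| <= 2^-1 ->
    `|c * (- 4 * g (x + h) * bump_base e (x + h)) - c * (- 4 * g x * bump_base e x)|
      <= c * 40 * `|h|.
  move=> Hg Lg x h h1; case/andP: (e01) => e0 e1.
  rewrite -mulrBr normrM gtr0_norm // -[leRHS]mulrA ler_pM2l //.
  have Hd := diff x h h1; have Hl := Lg x h.
  (* The coordinate [g] is bounded only where the base does not vanish, so the product difference is
     expanded around whichever of the two points lies in the disc. *)
  have [E|nz] := eqVneq (bump_base e x) 0.
    rewrite E mulr0 subr0.
    have [E'|nz'] := eqVneq (bump_base e (x + h)) 0; first by rewrite E' mulr0 normr0 mulr_ge0.
    have G := Hg _ nz'; rewrite E subr0 in Hd.
    rewrite !normrM normrN normr_nat -!mulrA.
    have : `|g (x + h)| * `|bump_base e (x + h)| <= 1 * (5 * `|h|).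
      by apply: ler_pM => //; rewrite (le_trans G).
    have := normr_ge0 h; lra.
  have G := Hg _ nz.
  have -> : - 4 * g (x + h) * bump_base e (x + h) - - 4 * g x * bump_base e x =
    - 4 * ((g (x + h) - g x) * bump_base e (x + h) +
           g x * (bump_base e (x + h) - bump_base e x)) by ring.
  rewrite normrM normrN normr_nat.
  have A1 : `|(g (x + h) - g x) * bump_base e (x + h)| <= `|h| * 1.
    by rewrite normrM ler_pM // ger0_norm ?b0 ?b1.
  have A2 : `|g x * (bump_base e (x + h) - bump_base e x)| <= 1 * (5 * `|h|).
    by rewrite normrM ler_pM // (le_trans G).
  have := ler_normD ((g (x + h) - g x) * bump_base e (x + h)) (g x * (bump_base e (x + h) - bump_base e x)).
  have := normr_ge0 h; lra.
have S1 x : bump_base e x != 0 -> `|x.1| <= e by move=> /(bump_support_coord e01)[].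
have S2 x : bump_base e x != 0 -> `|x.2| <= e by move=> /(bump_support_coord e01)[].
split.
- by apply: measurable_funM => //; exact: measurable_funX.
- by apply: measurable_funM => //; apply: measurable_funM => //; apply: measurable_funM.
- by apply: measurable_funM => //; apply: measurable_funM => //; apply: measurable_funM.
- move=> x; rewrite /bump_fun normrM gtr0_norm // ler_pM2l // ger0_norm ?sqr_ge0 //.
  by have := b0 x; have := b1 x; nra.
- exact: bd.
- exact: bd.
- move=> x h h1; rewrite /bump_fun /bump1 /bump2 /linear_form.
  rewrite [X in `|X|](_ : _ = c * (bump_base e (x + h) ^+ 2 - bump_base e x ^+ 2 +
    4 * bump_base e x * (x.1 * h.1 + x.2 * h.2))); last by ring.
  rewrite normrM gtr0_norm // -[leRHS]mulrA ler_pM2l //.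
  apply: (le_trans (bump_quadratic x e01 (N1 h h1))).
  by have := norm_sqr_le h; have := sqr_ge0 `|h|; lra.
- apply: (lip (fun x => x.1)) => // x h /=.
  by rewrite [x.1 + h.1]addrC addrK prod_norm_le1.
- apply: (lip (fun x => x.2)) => // x h /=.
  by rewrite [x.2 + h.2]addrC addrK prod_norm_le2.
Qed.

End bump_fun.

(** * Borel measurability of continuous functions on the plane *)

Section plane_continuous_measurable.
Context {R : realType}.
Local Notation T := (measurableTypeR R * measurableTypeR R)%type.

(** The topology comes from the product norm while the sigma-algebra is the product one; they are
    linked by writing an open set as the countable union of the rational squares it contains. *)
Lemma plane_open_measurable (A : set (R * R)) : open A -> measurable (A : set T).
Proof.
move=> oA.
pose B (i : rat * rat * nat) : set (R * R) :=
  ball (ratr i.1.1 : R) (i.2.+1%:R^-1) `*` ball (ratr i.1.2 : R) (i.2.+1%:R^-1).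
have -> : A = \bigcup_i (if `[< B i `<=` A >] then B i else set0).
  apply/seteqP; split=> [x Ax|x [i _]]; last by case: asboolP => // BA; exact: BA.
  have /nbhs_ballP[r /= r0 rA] : nbhs x A by exact: open_nbhs_nbhs.
  (* The factor 2 pays for passing through the rational centre: two points of one square are at
     distance less than [2 / (n + 1) < r]. *)
  pose n := Num.truncn (2 / r).
  have nr : 2 * n.+1%:R^-1 < r.
    by rewrite ltr_pdivrMr // mulrC -ltr_pdivrMr // truncnS_gt.
  have dens (t : R) : exists q : rat, ball (ratr q : R) (n.+1%:R^-1) t.
    have [] := @dense_rat R (ball t (n.+1%:R^-1)).
    - by exists t; exact: ballxx.
    - exact: ball_open.
    - move=> s [ts [q _ qs]]; exists q; rewrite qs; exact: ball_sym.
  have [q1 Hq1] := dens x.1; have [q2 Hq2] := dens x.2.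
  exists (q1, q2, n) => //; rewrite asboolT //.
  move=> y [/= y1 y2]; apply: rA; split.
    apply: (@le_ball _ _ _ (n.+1%:R^-1 + n.+1%:R^-1)).
      by move: nr; move: (n.+1%:R^-1 : R) => s; lra.
    exact: (ball_triangle (ball_sym Hq1) y1).
  apply: (@le_ball _ _ _ (n.+1%:R^-1 + n.+1%:R^-1)).
    by move: nr; move: (n.+1%:R^-1 : R) => s; lra.
  exact: (ball_triangle (ball_sym Hq2) y2).
apply: countable_bigcupT_measurable => // i; case: ifP => // _.
by apply: measurableX; exact: measurable_ball.
Qed.

Lemma plane_continuous_measurable (f : R * R -> R) :
  continuous f -> measurable_fun setT (f : T -> R).
Proof.
move=> /continuousP cf; apply: (measurability _ (RGenOpens.measurableE R)).
move=> _ [_ [a [b ->] <-]]; rewrite setTI; apply: plane_open_measurable.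
exact/cf/interval_open.
Qed.

Lemma measurable_addT : measurable_fun setT (fun p : T * T => p.1 + p.2 : T).
Proof.
have m11 : measurable_fun setT (fun p : T * T => p.1.1) by apply: (measurableT_comp measurable_fst); exact: measurable_fst.
have m12 : measurable_fun setT (fun p : T * T => p.1.2) by apply: (measurableT_comp measurable_snd); exact: measurable_fst.
have m21 : measurable_fun setT (fun p : T * T => p.2.1) by apply: (measurableT_comp measurable_fst); exact: measurable_snd.
have m22 : measurable_fun setT (fun p : T * T => p.2.2) by apply: (measurableT_comp measurable_snd); exact: measurable_snd.
have m1 : measurable_fun setT (fun p : T * T => p.1.1 + p.2.1 : measurableTypeR R).
  exact: measurable_funD.
have m2 : measurable_fun setT (fun p : T * T => p.1.2 + p.2.2 : measurableTypeR R).
  exact: measurable_funD.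
exact: (measurable_fun_pair m1 m2).
Qed.

End plane_continuous_measurable.

(** * The normalised kernel *)

Section mollifier.
Context {R : realType}.
Local Notation mu := (@lebesgue_measure R).
Local Notation T := (measurableTypeR R * measurableTypeR R)%type.
Local Notation pm := (mu \x mu)%E.
Implicit Types (e : R) (f : T -> R).

Definition box (r : R) : set T := `[- r, r]%classic `*` `[- r, r]%classic.

Lemma measurable_box r : measurable (box r).
Proof. by apply: measurableX; exact: measurable_itv. Qed.

Lemma box_measure r : 0 <= r -> (pm : {measure set T -> \bar R}) (box r) = ((2 * r) ^+ 2)%:E.
Proof.
move=> r0.
have E : mu `[- r, r]%classic = (2 * r)%:E.
  rewrite lebesgue_measure_itv /= lte_fin; case: ltP => rr.
    by rewrite -EFinB; congr (_%:E); ring.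
  by have -> : r = 0 by [move: rr; lra]; rewrite mulr0.
transitivity (mu `[(- r)%R, r]%classic * mu `[(- r)%R, r]%classic)%E.
  by apply: product_measure1E; exact: measurable_itv.
by rewrite E -EFinM.
Qed.

Lemma boxP r (x : T) : box r x <-> `|x.1| <= r /\ `|x.2| <= r.
Proof. by rewrite /box /= !in_itv /= !ler_norml. Qed.

Let mass e := (\int[pm]_x (bump_base e x ^+ 2)%:E)%E.

Let measurable_bump_base_sqr e : measurable_fun setT (fun x : T => (bump_base e x ^+ 2)%:E).
Proof. by apply/measurable_EFinP; apply: measurable_funX; exact: measurable_bump_base. Qed.

Let mass_fin e : 0 < e <= 1 -> mass e \is a fin_num.
Proof.
move=> e01; rewrite ge0_fin_numE; last first.
  by apply: integral_ge0 => x _; rewrite lee_fin sqr_ge0.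
apply: (@le_lt_trans _ _ (\int[pm]_x (\1_(box 1) x)%:E)%E); last first.
  rewrite integral_indic //; last exact: measurable_box.
  by rewrite setIT box_measure // ltry.
apply: ge0_le_integral => //.
- by move=> x _; rewrite lee_fin sqr_ge0.
- by apply/measurable_EFinP; apply: measurable_indic; exact: measurable_box.
- move=> x _; rewrite lee_fin.
  have [->|nz] := eqVneq (bump_base e x) 0; first by rewrite expr0n.
  rewrite indicE mem_set.
    by rewrite exprn_ile1 ?bump_base_ge0 ?bump_base_le1.
  have [H1 H2] := bump_support_coord e01 nz.
  by case/andP: e01 => _ e1; apply/boxP; split; exact: le_trans e1.
Qed.

Let mass_gt0 e : 0 < e <= 1 -> (0 < mass e)%E.
Proof.
move=> /andP[e0 e1].
(* On the box of half-width [e / 2] the base is at least [e^2 - 2 * e^2 / 4 = e^2 / 2]. *)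
apply: (@lt_le_trans _ _ (\int[pm]_x ((e ^+ 2 / 2) ^+ 2 * \1_(box (e / 2)) x)%:E)%E).
  under eq_integral do rewrite EFinM.
  rewrite ge0_integralZl //; last 2 first.
  - by apply/measurable_EFinP; apply: measurable_indic; exact: measurable_box.
  - by rewrite lee_fin sqr_ge0.
  rewrite integral_indic //; last exact: measurable_box.
  rewrite setIT box_measure ?divr_ge0 ?(ltW e0) // -EFinM lte_fin.
  by rewrite mulr_gt0 // exprn_gt0 // ?divr_gt0 ?mulr_gt0 ?exprn_gt0 ?divr_gt0.
apply: ge0_le_integral => //.
- by move=> x _; rewrite lee_fin mulr_ge0 // sqr_ge0.
- apply/measurable_EFinP; apply: measurable_funM => //.
  by apply: measurable_indic; exact: measurable_box.
- move=> x _; rewrite lee_fin indicE.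
  case: (boolP (x \in box (e / 2))) => [/set_mem/boxP[x1 x2]|_]; last by rewrite mulr0 sqr_ge0.
  rewrite mulr1 lerXn2r ?nnegrE ?bump_base_ge0 ?divr_ge0 ?sqr_ge0 //.
  rewrite /bump_base le_max; apply/orP; right.
  have H (y : R) : `|y| <= e / 2 -> y ^+ 2 <= e ^+ 2 / 4.
    move=> ye; rewrite -(real_normK (num_real y)).
    have -> : e ^+ 2 / 4 = (e / 2) ^+ 2 by field.
    by rewrite lerXn2r ?nnegrE // divr_ge0 // ltW.
  by have := H _ x1; have := H _ x2; lra.
Qed.

Let mc e : R := (fine (mass e))^-1.

Let mc_gt0 e : 0 < e <= 1 -> 0 < mc e.
Proof.
by move=> e01; rewrite /mc invr_gt0 fine_gt0 // mass_gt0 //= -ge0_fin_numE ?mass_fin // ltW // mass_gt0.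
Qed.

Definition moll e : T -> R := bump_fun (mc e) e.
Definition moll1 e : T -> R := bump1 (mc e) e.
Definition moll2 e : T -> R := bump2 (mc e) e.

Lemma moll_kernel e : 0 < e <= 1 -> exists C : R,
  0 <= C /\ C11_kernel (moll e) (moll1 e) (moll2 e) C.
Proof.
move=> e01; exists (mc e * 40); split; first by rewrite mulr_ge0 // ltW // mc_gt0.
exact: (bump_kernel (mc_gt0 e01) e01).
Qed.

Lemma moll_ge0 e x : 0 < e <= 1 -> 0 <= moll e x.
Proof. by move=> e01; rewrite mulr_ge0 ?sqr_ge0 // ltW // mc_gt0. Qed.

Lemma measurable_moll e : measurable_fun setT (moll e).
Proof.
by apply: measurable_funM => //; apply: measurable_funX; exact: measurable_bump_base.
Qed.

Let bump_base_even e (x : R * R) : bump_base e (- x) = bump_base e x.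
Proof. by rewrite /bump_base /= !sqrrN. Qed.

Lemma moll_even e (x : R * R) : moll e (- x) = moll e x.
Proof. by rewrite /moll /bump_fun bump_base_even. Qed.

Lemma moll1_odd e (x : R * R) : moll1 e (- x) = - moll1 e x.
Proof. by rewrite /moll1 /bump1 bump_base_even /=; ring. Qed.

Lemma moll2_odd e (x : R * R) : moll2 e (- x) = - moll2 e x.
Proof. by rewrite /moll2 /bump2 bump_base_even /=; ring. Qed.

Lemma moll_support e (x : R * R) : 0 < e <= 1 -> moll e x != 0 -> box e x.
Proof.
move=> e01 nz; apply/boxP; apply: (bump_support_coord e01).
by apply: contra_neq nz => b0; rewrite /moll /bump_fun b0 expr0n mulr0.
Qed.

Lemma integral_moll e : 0 < e <= 1 -> (\int[pm]_x (moll e x)%:E = 1)%E.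
Proof.
move=> e01; rewrite /moll /bump_fun; under eq_integral do rewrite EFinM.
rewrite ge0_integralZl //; last 2 first.
- by move=> x _; rewrite lee_fin sqr_ge0.
- by rewrite lee_fin ltW // mc_gt0.
rewrite -/(mass e) -(fineK (mass_fin e01)) -EFinM mulVf // gt_eqF //.
by rewrite fine_gt0 // mass_gt0 //= -ge0_fin_numE ?mass_fin // ltW // mass_gt0.
Qed.

Lemma integral_moll_sub e (y : T) : 0 < e <= 1 ->
  (\int[pm]_x (moll e (x - y))%:E = 1)%E.
Proof.
move=> e01; rewrite -(integral_moll e01).
rewrite (ge0_integral_translation (- y) (f := fun x => (moll e x)%:E)) //.
- by apply/measurable_EFinP; exact: measurable_moll.
- by move=> x; rewrite lee_fin moll_ge0.
Qed.

End mollifier.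

(** * Exchange of integrals over two planes *)

Section plane_tonelli.
Context {R : realType}.
Local Notation mu := (@lebesgue_measure R).
Local Notation T := (measurableTypeR R * measurableTypeR R)%type.
Local Notation pm := (mu \x mu)%E.

Lemma plane_sigma_finite : sigma_finite [set: T] pm.
Proof.
exists (fun n => box n%:R).
  apply/esym; rewrite -subTset => x _.
  pose n := (Num.truncn (Num.max `|x.1| `|x.2|)).+1.
  exists n => //; apply/boxP; split; rewrite ltW // (le_lt_trans _ (truncnS_gt _)) //.
    by rewrite le_max lexx.
  by rewrite le_max lexx orbT.
move=> n; split; first exact: measurable_box.
have := box_measure (ler0n R n); rewrite /= => ->.
by rewrite ltry.
Qed.

(* The instance of sigma-finiteness found by inference on [m1 \x m2] is the one
   for subprobabilities, so the Lebesgue case is packed by hand. *)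
Definition plane_measure : {sigma_finite_measure set T -> \bar R} :=
  HB.pack_for {sigma_finite_measure set T -> \bar R} pm
    (Measure_isSigmaFinite.Build _ _ _ pm plane_sigma_finite).

Lemma plane_measurable_F (F : T * T -> \bar R) : measurable_fun setT F ->
  (forall p, 0 <= F p)%E ->
  measurable_fun setT (fun x => \int[pm]_y F (x, y))%E.
Proof. by move=> mF F0; exact: (measurable_fun_fubini_tonelli_F (m2 := plane_measure) F mF F0). Qed.

Lemma plane_measurable_G (F : T * T -> \bar R) : measurable_fun setT F ->
  (forall p, 0 <= F p)%E ->
  measurable_fun setT (fun y => \int[pm]_x F (x, y))%E.
Proof. by move=> mF F0; exact: (measurable_fun_fubini_tonelli_G (m1 := plane_measure) F mF F0). Qed.

Lemma plane_tonelli (F : T * T -> \bar R) : measurable_fun setT F ->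
  (forall p, 0 <= F p)%E ->
  (\int[pm]_x \int[pm]_y F (x, y) = \int[pm]_y \int[pm]_x F (x, y))%E.
Proof. by move=> mF F0; exact: (fubini_tonelli (m1 := plane_measure) (m2 := plane_measure) F mF F0). Qed.

Lemma plane_fubini (F : T * T -> \bar R) : measurable_fun setT F ->
  (\int[pm]_x \int[pm]_y `|F (x, y)| < +oo)%E ->
  (\int[pm]_x \int[pm]_y F (x, y) = \int[pm]_y \int[pm]_x F (x, y))%E.
Proof.
move=> mF Foo.
have iF := (integrable12ltyP plane_measure plane_measure mF).2 Foo.
exact: (Fubini iF).
Qed.

End plane_tonelli.

(** * Translations and mollification *)

Section mollification.
Context {R : realType}.
Local Notation mu := (@lebesgue_measure R).
Local Notation T := (measurableTypeR R * measurableTypeR R)%type.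
Local Notation pm := (mu \x mu)%E.
Implicit Types (e : R) (f : T -> R).

Definition translation_diff f (z : T) : \bar R := (\int[pm]_x (`|f (x + z) - f x|)%:E)%E.

Lemma translation_diff_ge0 f z : (0 <= translation_diff f z)%E.
Proof. by apply: integral_ge0 => x _; rewrite lee_fin. Qed.

Lemma measurable_translation_diff2 f : measurable_fun setT f ->
  measurable_fun setT (fun p : T * T => (`|f (p.1 + p.2) - f p.1|)%:E).
Proof.
move=> mf; apply/measurable_EFinP; apply: measurableT_comp => //.
apply: measurable_funB; first exact: (measurableT_comp mf measurable_addT).
exact: (measurableT_comp mf measurable_fst).
Qed.

Lemma measurable_translation_diff f : measurable_fun setT f ->
  measurable_fun setT (translation_diff f).
Proof.
move=> mf; apply: (plane_measurable_G (measurable_translation_diff2 mf)) => p.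
by rewrite lee_fin.
Qed.

Lemma integral_translation (z : T) (f : T -> \bar R) : measurable_fun setT f ->
  (\int[pm]_x f (x + z)%R = \int[pm]_x f x)%E.
Proof.
move=> mf; rewrite [LHS]integralE [RHS]integralE; congr (_ - _)%E.
- rewrite -(ge0_integral_translation z (measurable_funepos mf) (funepos_ge0 f)).
  by apply: eq_integral => x _; rewrite !funeposE.
- rewrite -(ge0_integral_translation z (measurable_funeneg mf) (funeneg_ge0 f)).
  by apply: eq_integral => x _; rewrite !funenegE.
Qed.

Lemma integrable_translation (z : T) f : pm.-integrable setT (EFin \o f) ->
  pm.-integrable setT (fun x => (f (x + z))%:E).
Proof.
move=> /integrableP[mf fi]; apply/integrableP; split.
  exact: (measurableT_comp mf (measurable_translation z)).
rewrite (ge0_integral_translation z (f := fun x => `|(f x)%:E|%E)) //.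
exact: measurableT_comp.
Qed.

(** [moll e] is even with integral one, so the difference at [x] is the average of [f (x + z) - f x]
    with weight [moll e z]; take absolute values inside and exchange the integrals. *)
Lemma conv_dist f e : 0 < e <= 1 -> pm.-integrable setT (EFin \o f) ->
  (\int[pm]_x (`|convol (moll e) f x - f x|)%:E <=
   \int[pm]_z ((moll e z)%:E * translation_diff f z))%E.
Proof.
move=> e01 fi; have [C [C0 kK]] := moll_kernel e01.
have mf : measurable_fun setT f by apply/measurable_EFinP; exact: measurable_int fi.
have mm := measurable_moll e.
have [cC _ _] := conv_C1 kK fi.
have mc : measurable_fun setT (convol (moll e) f).
  by apply: plane_continuous_measurable => x; apply: differentiable_continuous; case: cC => + _ _; apply.
have mo x : pm.-integrable setT (EFin \o (fun y => moll e (x - y))).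
  apply/integrableP; split.
    by apply/measurable_EFinP; exact: (measurableT_comp mm (measurable_reflection x)).
  under eq_integral do rewrite /= ger0_norm ?moll_ge0 // -moll_even opprB.
  by rewrite integral_moll_sub // ltry.
have fmi x := integrable_conv x (kernel_meas kK) (kernel_le kK) fi.
have pw (x : T) : ((`|convol (moll e) f x - f x|)%:E <=
    \int[pm]_z ((moll e z)%:E * (`|f (x + z) - f x|)%:E))%E.
  have -> : convol (moll e) f x - f x = (\int[pm]_y ((f y - f x) * moll e (x - y)))%R.
    rewrite /convol; transitivity ((\int[pm]_y (f y * moll e (x - y)))%R -
       (\int[pm]_y (f x * moll e (x - y)))%R).
      congr (_ - _); rewrite RintegralZl // /Rintegral.
      under eq_integral do rewrite -moll_even opprB.
      by rewrite integral_moll_sub //= mulr1.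
    rewrite -RintegralB //.
    - by apply: eq_Rintegral => y _; rewrite -mulrBl.
    - exact: fmi.
    - exact: (@integrableZl _ _ _ _ _ measurableT (f x) _ (mo x)).
  have I : pm.-integrable setT (EFin \o (fun y => (f y - f x) * moll e (x - y))).
    apply: (@eq_integrable _ _ _ _ _ measurableT (fun y => (f y * moll e (x - y))%:E -
       (f x)%:E * (moll e (x - y))%:E)%E).
      by move=> y _ /=; rewrite mulrBl.
    apply: integrableB => //; exact: (@integrableZl _ _ _ _ _ measurableT (f x) _ (mo x)).
  rewrite EFin_normr_Rintegral //.
  apply: (le_trans (le_abse_integral _ _ _)) => //; first exact: measurable_int I.
  rewrite -(ge0_integral_translation x (f := fun y => `|((f y - f x) * moll e (x - y))%:E|%E)) //; last first.
    by apply: measurableT_comp => //; exact: measurable_int I.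
  rewrite le_eqVlt; apply/orP; left; apply/eqP; apply: eq_integral => z _.
  rewrite abse_EFin normrM [`|moll _ _|]ger0_norm ?moll_ge0 // -EFinM; congr (_%:E).
  by rewrite mulrC [z + x]addrC opprD addrA subrr sub0r moll_even.
have mj : measurable_fun setT (fun p : T * T => ((moll e p.2)%:E * (`|f (p.1 + p.2) - f p.1|)%:E)%E).
  apply: emeasurable_funM; last exact: measurable_translation_diff2.
  by apply/measurable_EFinP; exact: (measurableT_comp mm measurable_snd).
have j0 (p : T * T) : (0 <= (moll e p.2)%:E * (`|f (p.1 + p.2) - f p.1|)%:E)%E.
  by rewrite mule_ge0 // lee_fin ?moll_ge0.
apply: (@le_trans _ _ (\int[pm]_x \int[pm]_z ((moll e z)%:E * (`|f (x + z) - f x|)%:E))%E).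
  apply: ge0_le_integral => //.
  - by apply/measurable_EFinP; apply: measurableT_comp => //; exact: measurable_funB.
  - exact: (plane_measurable_F mj j0).
rewrite (plane_tonelli mj j0) /=.
rewrite le_eqVlt; apply/orP; left; apply/eqP; apply: eq_integral => z _.
rewrite ge0_integralZl //.
- by apply/measurable_EFinP; apply: measurableT_comp => //; apply: measurable_funB => //;
    exact: (measurableT_comp mf (measurable_translation z)).
- by rewrite lee_fin moll_ge0.
Qed.

(** Convolution commutes with translations, and averaging against a probability density does not
    increase the [L^1] norm. *)
Lemma translation_diff_conv f e z : 0 < e <= 1 -> pm.-integrable setT (EFin \o f) ->
  (translation_diff (convol (moll e) f) z <= translation_diff f z)%E.
Proof.
move=> e01 fi; have [C [C0 kK]] := moll_kernel e01.
have mf : measurable_fun setT f by apply/measurable_EFinP; exact: measurable_int fi.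
have mm := measurable_moll e.
have [cC _ _] := conv_C1 kK fi.
have mc : measurable_fun setT (convol (moll e) f).
  by apply: plane_continuous_measurable => x; apply: differentiable_continuous; case: cC => + _ _; apply.
have fzi := integrable_translation z fi.
have mfz : measurable_fun setT (fun y : T => f (y + z)).
  exact: (measurableT_comp mf (measurable_translation z)).
have fmi x := integrable_conv x (kernel_meas kK) (kernel_le kK) fi.
have fzmi x := integrable_conv (f := fun y => f (y + z)) x (kernel_meas kK) (kernel_le kK) fzi.
have pw (x : T) : ((`|convol (moll e) f (x + z) - convol (moll e) f x|)%:E <=
    \int[pm]_y ((`|f (y + z) - f y|)%:E * (moll e (x - y))%:E))%E.
  have -> : convol (moll e) f (x + z) - convol (moll e) f x =
      (\int[pm]_y ((f (y + z) - f y) * moll e (x - y)))%R.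
    rewrite /convol; transitivity ((\int[pm]_y (f (y + z) * moll e (x - y)))%R -
       (\int[pm]_y (f y * moll e (x - y)))%R).
      congr (_ - _); rewrite /Rintegral.
      rewrite -(integral_translation z (f := fun y => (f y * moll e (x + z - y))%:E)).
        by congr fine; apply: eq_integral => y _; rewrite opprD addrACA subrr addr0.
      exact: measurable_int (integrable_conv (x + z) (kernel_meas kK) (kernel_le kK) fi).
    rewrite -RintegralB //; [|exact: fzmi|exact: fmi].
    by apply: eq_Rintegral => y _; rewrite -mulrBl.
  have I : pm.-integrable setT (EFin \o (fun y => (f (y + z) - f y) * moll e (x - y))).
    apply: (@eq_integrable _ _ _ _ _ measurableT (fun y : T => (f (y + z)%R * moll e (x - y))%:E -
       (f y * moll e (x - y))%:E)%E).
      by move=> y _ /=; rewrite mulrBl.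
    by apply: integrableB => //; do ?[exact: fzmi|exact: fmi].
  rewrite EFin_normr_Rintegral //.
  apply: (le_trans (le_abse_integral _ _ _)) => //; first exact: measurable_int I.
  rewrite le_eqVlt; apply/orP; left; apply/eqP; apply: eq_integral => y _.
  by rewrite abse_EFin normrM [`|moll _ _|]ger0_norm ?moll_ge0 // -EFinM.
have mj : measurable_fun setT (fun p : T * T => ((`|f (p.2 + z) - f p.2|)%:E * (moll e (p.1 - p.2))%:E)%E).
  apply: emeasurable_funM; apply/measurable_EFinP.
    apply: measurableT_comp => //.
    by apply: (@measurableT_comp _ _ _ _ _ _ (fun y : T => f (y + z) - f y)); [exact: measurable_funB|exact: measurable_snd].
  apply: (measurableT_comp mm).
  have m0 : measurable_fun setT (fun p : T * T => ((p.1, 0 - p.2) : T * T)).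
    apply: measurable_fun_pair; first exact: measurable_fst.
    exact: (measurableT_comp (measurable_reflection 0) measurable_snd).
  have := measurableT_comp measurable_addT m0.
  by apply: eq_measurable_fun => p _ /=; rewrite sub0r.
have j0 (p : T * T) : (0 <= (`|f (p.2 + z) - f p.2|)%:E * (moll e (p.1 - p.2))%:E)%E.
  by rewrite mule_ge0 // lee_fin ?moll_ge0.
apply: (@le_trans _ _ (\int[pm]_x \int[pm]_y ((`|f (y + z) - f y|)%:E * (moll e (x - y))%:E))%E).
  apply: ge0_le_integral => //.
  - apply/measurable_EFinP; apply: measurableT_comp => //; apply: measurable_funB => //.
    exact: (measurableT_comp mc (measurable_translation z)).
  - exact: (plane_measurable_F mj j0).
rewrite (plane_tonelli mj j0) /=.
rewrite le_eqVlt; apply/orP; left; apply/eqP; apply: eq_integral => y _.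
rewrite ge0_integralZl //.
- by rewrite integral_moll_sub // mule1.
- apply/measurable_EFinP; apply: (measurableT_comp mm); exact: (measurable_translation (- y)).
- by move=> x _; rewrite lee_fin moll_ge0.
Qed.

End mollification.

(** * Continuity of translations in [L^1] for indicators, by slicing into lines *)

Section translation_continuity.
Context {R : realType}.
Local Notation mu := (@lebesgue_measure R).
Local Notation T := (measurableTypeR R * measurableTypeR R)%type.
Local Notation pm := (mu \x mu)%E.

Let D1 (A : set R) (h : R) : \bar R :=
  (\int[mu]_x (`|\1_A (x + h) - \1_A x : R|)%:E)%E.

Let shift_measurable (h : R) : measurable_fun setT (fun x : R => x + h).
Proof. by apply: measurable_funD. Qed.

Let integral_shift (h : R) (f : R -> \bar R) : measurable_fun setT f ->
  (forall x, 0 <= f x)%E -> (\int[mu]_x f (x + h)%R = \int[mu]_x f x)%E.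
Proof.
move=> mf f0; rewrite [RHS](ge0_integral_affine h (oner_neq0 R)) //.
by rewrite normr1 mul1e; apply: eq_integral => x _; rewrite mul1r.
Qed.

Let measurable_indic_shift (A : set R) (h : R) : measurable A ->
  measurable_fun setT (fun x : R => \1_A (x + h) : R).
Proof.
move=> mA.
have m : measurable_fun setT (\1_A : R -> R) by exact: measurable_indic.
exact: (measurableT_comp m (shift_measurable h)).
Qed.

Let integral_indic_shift (A : set R) (h : R) : measurable A ->
  (\int[mu]_x (\1_A (x + h) : R)%:E = mu A)%E.
Proof.
move=> mA; rewrite (integral_shift h (f := fun x => (\1_A x)%:E)) //.
  by rewrite integral_indic // setIT.
by apply/measurable_EFinP; exact: measurable_indic.
Qed.

Let D1_measurable (A : set R) (h : R) : measurable A ->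
  measurable_fun setT (fun x : R => (`|\1_A (x + h) - \1_A x : R|)%:E).
Proof.
move=> mA; apply/measurable_EFinP; apply: measurableT_comp => //.
by apply: measurable_funB; [exact: measurable_indic_shift|exact: measurable_indic].
Qed.

Let indic01 (A : set R) x : (\1_A x : R) = 0 \/ (\1_A x : R) = 1.
Proof. by rewrite indicE; case: (x \in A); [right|left]. Qed.

Let D1_le (A : set R) (h : R) : measurable A -> (D1 A h <= 2%:E * mu A)%E.
Proof.
move=> mA.
apply: (@le_trans _ _ (\int[mu]_x ((\1_A (x + h) : R)%:E + (\1_A x)%:E))%E).
  apply: ge0_le_integral => //; first exact: D1_measurable.
    by apply: emeasurable_funD; apply/measurable_EFinP;
      [exact: measurable_indic_shift|exact: measurable_indic].
  move=> x _; rewrite -EFinD lee_fin.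
  by case: (indic01 A (x + h)) => ->; case: (indic01 A x) => ->;
    rewrite ?subrr ?subr0 ?sub0r ?normrN ?normr0 ?normr1 ?addr0 ?add0r // addr_ge0.
rewrite ge0_integralD //; last 2 first.
- by apply/measurable_EFinP; exact: measurable_indic_shift.
- by apply/measurable_EFinP; exact: measurable_indic.
rewrite integral_indic_shift // integral_indic // setIT.
by rewrite (_ : 2%:E = (1 : R)%:E + (1 : R)%:E)%E // ge0_muleDl ?lee_fin // mul1e.
Qed.

Let D1_ge0 A h : (0 <= D1 A h)%E.
Proof. by apply: integral_ge0 => x _; rewrite lee_fin. Qed.

(** Pointwise convergence of [\1_U (x + h n)] can fail at boundary points outside [U]. Hence [g]
    counts only the points leaving [U], where openness gives convergence to 0; as [U] and its
    translate have equal measure, this is half of the symmetric difference. *)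
Let D1_open (U : set R) (h : nat -> R) : open U -> (mu U < +oo)%E ->
  h n @[n --> \oo] --> 0 -> D1 U (h n) @[n --> \oo] --> 0%E.
Proof.
move=> oU Ufin h0.
have mU : measurable U by exact: open_measurable.
have Uf : mu U \is a fin_num by rewrite ge0_fin_numE.
pose g n x : \bar R := ((\1_U x : R) * (1 - \1_U (x + h n)))%:E.
have mg n : measurable_fun setT (g n).
  apply/measurable_EFinP; apply: measurable_funM; first exact: measurable_indic.
  by apply: measurable_funB => //; exact: measurable_indic_shift.
have g0 n x : (0 <= g n x)%E.
  rewrite lee_fin mulr_ge0 // ?subr_ge0 ?indic_le1 //.
have E n : D1 U (h n) = (2%:E * \int[mu]_x g n x)%E.
  have mI : measurable_fun setT (fun x : R => (\1_U x : R)%:E).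
    by apply/measurable_EFinP; exact: measurable_indic.
  have mS : measurable_fun setT (fun x : R => (\1_U (x + h n) : R)%:E).
    by apply/measurable_EFinP; exact: measurable_indic_shift.
  have mD := D1_measurable (h n) mU.
  have muE : (\int[mu]_x (\1_U x : R)%:E = mu U)%E by rewrite integral_indic // setIT.
  (* The finite quantity [mu U] is added to both sides so that no subtraction of integrals is
     needed. For 0-1 values, [|a - b| + b = 2 b (1 - a) + a]. *)
  have L : (D1 U (h n) + mu U = \int[mu]_x ((`|\1_U (x + h n) - \1_U x : R|)%:E + (\1_U x : R)%:E))%E.
    by rewrite ge0_integralD // muE.
  have L' : (2%:E * \int[mu]_x g n x + mu U = \int[mu]_x (2%:E * g n x + (\1_U (x + h n) : R)%:E))%E.
    have m2 : measurable_fun setT (fun x => 2%:E * g n x)%E by exact: measurable_funeM.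
    have g2 x : setT x -> (0 <= 2%:E * g n x)%E by rewrite mule_ge0.
    rewrite ge0_integralD //.
    rewrite integral_indic_shift // ge0_integralZl //; exact: mg.
  have : (D1 U (h n) + mu U = 2%:E * \int[mu]_x g n x + mu U)%E.
    rewrite L L'; apply: eq_integral => x _; rewrite /g -!EFinM -!EFinD; congr (_%:E).
    by case: (indic01 U (x + h n)) => ->; case: (indic01 U x) => ->;
      rewrite ?subrr ?subr0 ?sub0r ?normrN ?normr0 ?normr1 //; ring.
  by move=> /(congr1 (fun t => t - mu U)%E); rewrite !addeK.
have gcvg : {ae mu, forall x, setT x -> g ^~ x @ \oo --> (cst 0%E : R -> \bar R) x}.
  apply: aeW => x _.
  case: (pselect (U x)) => Ux; last first.
    rewrite (_ : (fun n => g n x) = cst 0%E); first exact: cvg_cst.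
    by apply/funext => n; rewrite /g [X in X * _]indicE memNset // mul0r.
  have cx : x + h n @[n --> \oo] --> x.
    by rewrite -[X in _ --> X]addr0; apply: cvgD => //; exact: cvg_cst.
  have HU : \forall n \near \oo, U (x + h n).
    by apply: (cx U); exact: open_nbhs_nbhs.
  apply: cvg_near_cst; apply: filterS HU => n Uxn.
  by rewrite /g [X in 1 - X]indicE mem_set // subrr mulr0.
have gi : mu.-integrable setT (fun x => (\1_U x : R)%:E).
  apply/integrableP; split.
    by apply/measurable_EFinP; exact: measurable_indic.
  under eq_integral do rewrite gee0_abs ?lee_fin //.
  by rewrite integral_indic // setIT.
have gdom : {ae mu, forall x n, setT x -> (`|g n x| <= (\1_U x : R)%:E)%E}.
  apply: aeW => x n _; rewrite gee0_abs // lee_fin.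
  by rewrite ler_piMr //; case: (indic01 U (x + h n)) => ->; lra.
have [_ _] := @dominated_convergence _ _ R mu setT measurableT g (cst 0%E)
  (fun x => (\1_U x : R)%:E) mg (measurable_cst _) gcvg gi gdom.
rewrite integral_cst // mul0e => H.
under eq_fun do rewrite E.
by rewrite -(mule0 2%:E); apply: cvgeZl.
Qed.

Let indic_shift_le (A U : set R) (h x : R) : A `<=` U ->
  `|\1_A (x + h) - \1_A x : R| <=
  `|\1_U (x + h) - \1_U x| + (\1_(U `\` A) (x + h) + \1_(U `\` A) x).
Proof.
move=> AU.
have H (y : R) : (\1_A y : R) = \1_U y - \1_(U `\` A) y.
  rewrite !indicE; case: (boolP (y \in A)) => [/set_mem Ay|/negP nA].
    by rewrite (mem_set (AU _ Ay)) memNset ?subr0 // => -[].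
  have nA' : ~ A y by move=> /mem_set.
  case: (boolP (y \in U)) => [/set_mem Uy|/negP nU].
    by rewrite mem_set ?subrr.
  by rewrite memNset ?subr0 // => -[Uy _]; apply: nU; exact: mem_set.
rewrite !H opprD addrACA (le_trans (ler_normD _ _)) // lerD2l.
rewrite (le_trans (ler_normD _ _)) // opprK !normrN.
by rewrite !ger0_norm.
Qed.

(** Outer regularity: replacing [A] by an open superset with excess below [e / 4] costs this excess
    twice, once at [x] and once at [x + h n]. *)
Let D1_cvg (A : set R) (h : nat -> R) : measurable A -> (mu A < +oo)%E ->
  h n @[n --> \oo] --> 0 -> D1 A (h n) @[n --> \oo] --> 0%E.
Proof.
move=> mA Afin h0.
apply/fine_cvgP; split.
  apply: nearW => n; rewrite ge0_fin_numE //.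
  apply: (le_lt_trans (D1_le _ mA)).
  by rewrite lte_mul_pinfty ?lee_fin.
apply/cvgrPdist_le => e e0.
have e4 : 0 < e / 4 by rewrite divr_gt0.
have [U [oU AU UA]] := lebesgue_regularity_outer mA Afin e4.
have mU : measurable U by exact: open_measurable.
have mUA : measurable (U `\` A) by exact: measurableD.
have Ufin : (mu U < +oo)%E.
  rewrite -(setDUK AU); apply: (le_lt_trans (measureU2 _ _ _)) => //.
  by rewrite lte_add_pinfty // (lt_trans UA) // ltry.
have := D1_open oU Ufin h0.
move=> /fine_cvgP[Ofin /cvgrPdist_le /(_ _ (divr_gt0 e0 (ltr0n R 2)))].
apply: filterS2 Ofin => n Ofin.
rewrite !sub0r !normrN !ger0_norm ?fine_ge0 // => On.
rewrite -lee_fin fineK; last first.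
  rewrite ge0_fin_numE //; apply: (le_lt_trans (D1_le _ mA)).
  by rewrite lte_mul_pinfty ?lee_fin.
have mIUA : measurable_fun setT (fun x : R => (\1_(U `\` A) x : R)%:E).
  by apply/measurable_EFinP; exact: measurable_indic.
have mSUA : measurable_fun setT (fun x : R => (\1_(U `\` A) (x + h n) : R)%:E).
  by apply/measurable_EFinP; exact: measurable_indic_shift.
apply: (@le_trans _ _ (\int[mu]_x ((`|\1_U (x + h n) - \1_U x : R|)%:E +
   ((\1_(U `\` A) (x + h n) : R)%:E + (\1_(U `\` A) x : R)%:E)))%E).
  apply: ge0_le_integral => //; first exact: D1_measurable.
    by apply: emeasurable_funD; [exact: D1_measurable|exact: emeasurable_funD].
  by move=> x _; rewrite -!EFinD lee_fin; exact: indic_shift_le.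
have mDU := D1_measurable (h n) mU.
have mS2 : measurable_fun setT (fun x : R => ((\1_(U `\` A) (x + h n) : R)%:E + (\1_(U `\` A) x : R)%:E)%E).
  exact: emeasurable_funD.
have S20 (x : R) : setT x -> (0 <= (\1_(U `\` A) (x + h n) : R)%:E + (\1_(U `\` A) x : R)%:E)%E.
  by move=> _; rewrite adde_ge0 ?lee_fin.
rewrite ge0_integralD // ge0_integralD // integral_indic_shift // integral_indic // setIT.
have -> : e%:E = ((e / 2)%:E + ((e / 4)%:E + (e / 4)%:E))%E.
  by rewrite -!EFinD; congr (_%:E); field.
by apply: leeD; [rewrite -[leLHS]fineK // lee_fin|apply: leeD; exact: ltW].
Qed.

(** Almost every slice has finite measure, so the statement on the line applies to it; [2 mu (S x)]
    is the dominating function. *)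
Let slice_cvg (S : R -> set R) (h : nat -> R) : (forall x, measurable (S x)) ->
  measurable_fun setT (fun x => mu (S x)) -> (\int[mu]_x mu (S x) < +oo)%E ->
  (forall k, measurable_fun setT (fun x => D1 (S x) k)) ->
  h n @[n --> \oo] --> 0 ->
  (\int[mu]_x D1 (S x) (h n))%E @[n --> \oo] --> 0%E.
Proof.
move=> mS mmu Soo mD h0.
have mi : mu.-integrable setT (fun x => mu (S x)).
  apply/integrableP; split => //.
  by under eq_integral do rewrite gee0_abs //.
have gi : mu.-integrable setT (fun x => 2%:E * mu (S x))%E by exact: integrableZl.
have gcvg : {ae mu, forall x, setT x -> (fun n => D1 (S x) (h n)) @ \oo --> (cst 0%E : R -> \bar R) x}.
  have := integrable_ae measurableT mi.
  apply: filterS => x /(_ I) Sx _; apply: D1_cvg => //.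
  by rewrite -ge0_fin_numE.
have gdom : {ae mu, forall x n, setT x -> (`|D1 (S x) (h n)| <= 2%:E * mu (S x))%E}.
  by apply: aeW => x n _; rewrite gee0_abs //; exact: D1_le.
have [_ _] := @dominated_convergence _ _ R mu setT measurableT
  (fun n x => D1 (S x) (h n)) (cst 0%E) (fun x => 2%:E * mu (S x))%E
  (fun n => mD (h n)) (measurable_cst _) gcvg gi gdom.
by rewrite integral_cst // mul0e.
Qed.

Let mF (B : set T) (z : T) : measurable B ->
  measurable_fun setT (fun x : T => (`|\1_B (x + z) - \1_B x : R|)%:E).
Proof.
move=> mB; have m : measurable_fun setT (\1_B : T -> R) by exact: measurable_indic.
apply/measurable_EFinP; apply: measurableT_comp => //; apply: measurable_funB => //.
exact: (measurableT_comp m (measurable_translation z)).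
Qed.

Let pairD (a b c d : R) : ((a, b) : T) + (c, d) = (a + c, b + d).
Proof. by []. Qed.

Let pair_split (x z : T) : x + (z.1, 0) + (0, z.2) = x + z.
Proof. by case: x z => [a b] [c d]; rewrite !pairD /= !addr0. Qed.

Let translation_diff_vertical (B : set T) (k : R) : measurable B ->
  (translation_diff (\1_B : T -> R) (0%R, k) = \int[mu]_x D1 (xsection B x) k)%E.
Proof.
move=> mB; rewrite /translation_diff.
have p0 (x : T) : (0 <= (`|\1_B (x + (0%R, k)) - \1_B x : R|)%:E)%E by rewrite lee_fin.
apply: (etrans (fubini_tonelli1 _ (mF (0%R, k) mB) p0)).
apply: eq_integral => x _; apply: eq_integral => y _ /=.
by rewrite pairD addr0 !indicE !mem_xsection.
Qed.

Let translation_diff_horizontal (B : set T) (h : R) : measurable B ->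
  (translation_diff (\1_B : T -> R) (h, 0%R) = \int[mu]_y D1 (ysection B y) h)%E.
Proof.
move=> mB; rewrite /translation_diff.
have p0 (x : T) : (0 <= (`|\1_B (x + (h, 0%R)) - \1_B x : R|)%:E)%E by rewrite lee_fin.
apply: (etrans (fubini_tonelli2 _ (mF (h, 0%R) mB) p0)).
apply: eq_integral => y _; apply: eq_integral => x _ /=.
by rewrite pairD addr0 !indicE !mem_ysection.
Qed.

Let vertical_cvg (B : set T) (h : nat -> R) : measurable B -> (pm B < +oo)%E ->
  h n @[n --> \oo] --> 0 ->
  translation_diff (\1_B : T -> R) (0%R, h n) @[n --> \oo] --> 0%E.
Proof.
move=> mB Bfin h0.
under eq_fun do rewrite translation_diff_vertical //.
apply: slice_cvg => //.
- by move=> x; exact: measurable_xsection.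
- exact: measurable_fun_xsection.
- move=> k.
  have := measurable_fun_fubini_tonelli_F (m2 := mu) _ (mF (0%R, k) mB) (fun x => _).
  move=> /(_ _)/wrap[|H]; first by move=> x; rewrite lee_fin.
  move: H; apply: eq_measurable_fun => x _; apply: eq_integral => y _ /=.
  by rewrite pairD addr0 !indicE !mem_xsection.
Qed.

Let horizontal_cvg (B : set T) (h : nat -> R) : measurable B -> (pm B < +oo)%E ->
  h n @[n --> \oo] --> 0 ->
  translation_diff (\1_B : T -> R) (h n, 0%R) @[n --> \oo] --> 0%E.
Proof.
move=> mB Bfin h0.
under eq_fun do rewrite translation_diff_horizontal //.
apply: slice_cvg => //.
- by move=> x; exact: measurable_ysection.
- exact: measurable_fun_ysection.
- move: Bfin; rewrite /product_measure1 => Bfin.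
  rewrite (_ : (\int[mu]_y mu (ysection B y) = \int[mu]_x (mu \o xsection B) x)%E) //.
  have := indic_fubini_tonelli mu mu mB.
  by rewrite indic_fubini_tonelli_FE // indic_fubini_tonelli_GE.
- move=> k.
  have H : measurable_fun setT (fubini_G mu (fun x : T => (`|\1_B (x + (k, 0%R)) - \1_B x : R|)%:E)).
    by apply: measurable_fun_fubini_tonelli_G => //; exact: mF.
  move: H; apply: eq_measurable_fun => y _; apply: eq_integral => x _ /=.
  by rewrite pairD addr0 !indicE !mem_ysection.
Qed.

Let translation_diff_split (B : set T) (z : T) : measurable B ->
  (translation_diff (\1_B : T -> R) z <=
   translation_diff (\1_B : T -> R) (z.1, 0%R) + translation_diff (\1_B : T -> R) (0%R, z.2))%E.
Proof.
move=> mB; have m : measurable_fun setT (\1_B : T -> R) by exact: measurable_indic.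
rewrite -[X in (_ <= _ + X)%E](ge0_integral_translation (z.1, 0%R)); last 2 first.
- exact: mF.
- by move=> x; rewrite lee_fin.
have mF' : measurable_fun setT (fun x : T =>
    (`|\1_B (x + (z.1, 0%R) + (0%R, z.2)) - \1_B (x + (z.1, 0%R)) : R|)%:E).
  exact: (measurableT_comp (mF (0%R, z.2) mB) (measurable_translation (z.1, 0%R))).
rewrite /translation_diff -ge0_integralD //; last exact: mF.
apply: ge0_le_integral => //.
- exact: mF.
- by apply: emeasurable_funD => //; exact: mF.
- move=> x _; rewrite -EFinD lee_fin.
  rewrite -pair_split.
  by rewrite [leRHS]addrC; exact: ler_distD.
Qed.

(** By contradiction, along bad translations chosen in shrinking boxes: dominated convergence
    provides only sequential limits. Each translation is a horizontal one followed by a vertical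
    one. *)
Lemma translation_diff_indic_small (B : set T) (eta : R) : measurable B ->
  (pm B < +oo)%E -> 0 < eta ->
  exists2 r, 0 < r <= 1 & forall z, box r z -> (translation_diff (\1_B : T -> R) z <= eta%:E)%E.
Proof.
move=> mB Bfin eta0; apply: contrapT => H.
have P n : exists z, box n.+1%:R^-1 z /\ (eta%:E < translation_diff (\1_B : T -> R) z)%E.
  apply: contrapT => Hn; apply: H; exists n.+1%:R^-1.
    by rewrite invr_gt0 ltr0Sn /= invf_le1 ?ltr0Sn // ler1n.
  move=> z bz; rewrite leNgt; apply/negP => lz; apply: Hn; by exists z.
have [z Hz] := choice P.
have cz (c : T -> R) : (forall n, `|c (z n)| <= n.+1%:R^-1) -> c (z n) @[n --> \oo] --> 0.
  move=> Hc; apply: norm_cvg0.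
  apply: (@squeeze_cvgr _ _ _ _ (cst 0) (fun n => n.+1%:R^-1)).
  - by apply: nearW => n; rewrite Hc normr_ge0.
  - exact: cvg_cst.
  - exact: cvg_harmonic.
have z1 := cz (fun x => x.1) (fun n => ((boxP _ _).1 (Hz n).1).1).
have z2 := cz (fun x => x.2) (fun n => ((boxP _ _).1 (Hz n).1).2).
have S : (translation_diff (\1_B : T -> R) ((z n).1, 0%R) +
    translation_diff (\1_B : T -> R) (0%R, (z n).2))%E @[n --> \oo] --> 0%E.
  rewrite -[X in _ --> X](adde0 0%E); apply: cvgeD => //.
    exact: (horizontal_cvg mB Bfin z1).
  exact: (vertical_cvg mB Bfin z2).
have : (eta%:E <= 0 :> \bar R)%E.
  apply: cvge_ge S; apply: nearW => n.
  exact: (le_trans (ltW (Hz n).2) (translation_diff_split _ mB)).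
by rewrite lee_fin leNgt eta0.
Qed.

End translation_continuity.

(** * The mollified gradient and the perimeter *)

Section gradient_bound.
Context {R : realType}.
Local Notation mu := (@lebesgue_measure R).
Local Notation T := (measurableTypeR R * measurableTypeR R)%type.
Local Notation pm := (mu \x mu)%E.
Implicit Types (e : R) (f g : T -> R).

(** The perimeter computed with the product measure before completion, for use on Borel sets. *)
Definition plane_perimeter (B : set T) : \bar R :=
  ereal_sup [set (\int[pm]_(x in B) (div phi x)%:E)%E |
    phi in [set phi : R * R -> R * R | C1c_field phi /\ forall x, enorm (phi x) <= 1]].

Lemma measurable_integrable f : pm.-integrable setT (EFin \o f) -> measurable_fun setT f.
Proof. by move=> fi; apply/measurable_EFinP; exact: measurable_int fi. Qed.

Lemma measurable_sub_T : measurable_fun setT (fun p : T * T => p.1 - p.2 : T).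
Proof.
have m0 : measurable_fun setT (fun p : T * T => ((p.1, 0 - p.2) : T * T)).
  apply: measurable_fun_pair; first exact: measurable_fst.
  exact: (measurableT_comp (measurable_reflection 0) measurable_snd).
have := measurableT_comp measurable_addT m0.
by apply: eq_measurable_fun => p _ /=; rewrite sub0r.
Qed.

(** Fubini's theorem, the sign coming from the oddness of [K]. Applied to the partial derivatives of
    the mollifier it acts as an integration by parts for merely integrable [f] and [g]. *)
Lemma convol_adjoint (K : T -> R) f g (C : R) : measurable_fun setT K ->
  (forall x, `|K x| <= C) -> (forall x, K (- x) = - K x) ->
  pm.-integrable setT (EFin \o f) -> pm.-integrable setT (EFin \o g) ->
  (\int[pm]_x (g x * convol K f x))%R = (\int[pm]_y (f y * - convol K g y))%R.
Proof.
move=> mK KC Kodd fi gi.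
have mf := measurable_integrable fi; have mg := measurable_integrable gi.
pose F (p : T * T) : \bar R := (g p.1 * (f p.2 * K (p.1 - p.2)))%:E.
have mF : measurable_fun setT F.
  apply/measurable_EFinP; apply: measurable_funM; first exact: (measurableT_comp mg measurable_fst).
  apply: measurable_funM; first exact: (measurableT_comp mf measurable_snd).
  exact: (measurableT_comp mK measurable_sub_T).
have /integrableP[_ ifi] := fi; have /integrableP[_ igi] := gi.
have C0 : 0 <= C by exact: le_trans (normr_ge0 _) (KC 0).
have Foo : (\int[pm]_x \int[pm]_y `|F (x, y)| < +oo)%E.
  apply: (@le_lt_trans _ _ (\int[pm]_x (`|g x|%:E * (C%:E * \int[pm]_y `|(f y)%:E|)))%E).
    apply: ge0_le_integral => //.
    - by move=> x _; apply: integral_ge0.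
    - by apply: (plane_measurable_F (F := fun p => `|F p|%E)) => //; exact: measurableT_comp.
    - apply: emeasurable_funM => //; apply/measurable_EFinP; exact: measurableT_comp.
    - move=> x _.
      have m1 : measurable_fun setT (fun y : T => `|(f y)%:E|%E).
        by apply/measurable_EFinP; exact: measurableT_comp.
      have m2 : measurable_fun setT (fun y : T => C%:E * `|(f y)%:E|)%E by exact: measurable_funeM.
      have p2 (y : T) : setT y -> (0 <= C%:E * `|(f y)%:E|)%E by move=> _; rewrite mule_ge0 ?lee_fin.
      rewrite -ge0_integralZl // -ge0_integralZl //.
      apply: ge0_le_integral => //.
      + apply: measurableT_comp => //; apply: (measurableT_comp mF).
        exact: measurable_fun_pair.
      + exact: measurable_funeM.
      + move=> y _; rewrite /F /= -!EFinM lee_fin !normrM ler_wpM2l //.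
        by rewrite mulrC ler_wpM2r.
  under eq_integral do rewrite muleC.
  have m3 : measurable_fun setT (fun x : T => `|g x|%:E) by apply/measurable_EFinP; exact: measurableT_comp.
  have p3 : (0 <= C%:E * \int[pm]_y `|(f y)%:E|)%E by rewrite mule_ge0 ?lee_fin // integral_ge0.
  rewrite ge0_integralZl //.
  apply: lte_mul_pinfty.
  - by rewrite mule_ge0 // ?lee_fin //; apply: integral_ge0.
  - rewrite ge0_fin_numE ?mule_ge0 ?lee_fin //; last by apply: integral_ge0.
    by apply: lte_mul_pinfty; rewrite ?lee_fin //; exact: ifi.
  - exact: igi.
have FE := plane_fubini mF Foo.
have kfi x := integrable_conv x mK KC fi.
have kgi x := integrable_conv x mK KC gi.
rewrite /Rintegral; congr fine.
transitivity (\int[pm]_x \int[pm]_y F (x, y))%E.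
  apply: eq_integral => x _; rewrite /F /=.
  under eq_integral do rewrite EFinM.
  rewrite integralZl //.
  by rewrite EFinM /convol /Rintegral fineK //; exact: integrable_fin_num.
rewrite FE; apply: eq_integral => y _; rewrite /F /=.
transitivity (\int[pm]_x ((- f y)%:E * (g x * K (y - x))%:E))%E.
  apply: eq_integral => x _; rewrite -EFinM; congr (_%:E).
  by rewrite -[x - y]opprB Kodd; ring.
rewrite integralZl //.
rewrite mulrN -mulNr EFinM /convol /Rintegral fineK //.
exact: integrable_fin_num.
Qed.

Lemma integrable_indic_plane (B : set T) : measurable B -> (pm B < +oo)%E ->
  pm.-integrable setT (EFin \o (\1_B : T -> R)).
Proof.
move=> mB Bfin; apply/integrableP; split.
  by apply/measurable_EFinP; exact: measurable_indic.
under eq_integral do rewrite /= ger0_norm //.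
by rewrite integral_indic // setIT.
Qed.

Lemma box_measure_lty (r : R) : (pm (box r) < +oo)%E.
Proof.
apply: (@le_lt_trans _ _ ((pm : {measure set T -> \bar R}) (box `|r|))).
  apply: le_measure; rewrite ?inE; [exact: measurable_box|exact: measurable_box|].
  by move=> x /boxP[x1 x2]; apply/boxP; rewrite !(le_trans _ (ler_norm r)).
by rewrite box_measure // ltry.
Qed.

Lemma integrable_bounded_box g (r : R) : measurable_fun setT g ->
  (forall x, `|g x| <= 1) -> (forall x, ~ box r x -> g x = 0) ->
  pm.-integrable setT (EFin \o g).
Proof.
move=> mg g1 gb.
have bi := integrable_indic_plane (measurable_box r) (box_measure_lty r).
apply: (le_integrable measurableT _ _ bi); first exact/measurable_EFinP.
move=> x _ /=; rewrite lee_fin indicE; case: (boolP (x \in box r)) => [_|/negP nx].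
  by rewrite normr1.
by rewrite gb ?normr0 // => /mem_set.
Qed.

Lemma box_compact (r : R) : compact (box r : set (R * R)).
Proof. by apply: compact_setX; exact: segment_compact. Qed.

Lemma C1c_field_of_box (phi : R * R -> R * R) (r : R) :
  C1 (fun x => (phi x).1) -> C1 (fun x => (phi x).2) ->
  (forall x, ~ box r x -> phi x = 0) -> C1c_field phi.
Proof.
move=> c1 c2 supp; split => //.
have cb := @box_compact r.
have clb : closed (box r : set (R * R)).
  by apply: compact_closed => //; exact: norm_hausdorff.
apply: (subclosed_compact (@closed_closure _ _) cb).
rewrite [X in _ `<=` X]((closure_id _).1 clb); apply: closure_subset.
by move=> x /= nz; apply: contrapT => /supp E; move: nz; rewrite E eqxx.
Qed.

Lemma convol_support (K : T -> R) g (r s : R) (x : T) :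
  (forall y, ~ box r y -> g y = 0) -> (forall y, ~ box s y -> K y = 0) ->
  ~ box (r + s) x -> convol K g x = 0.
Proof.
move=> gb Kb nx; rewrite /convol.
rewrite (_ : (fun y => _) = cst 0); first by rewrite Rintegral_cst // mul0r.
apply/funext => y /=.
have [by_|nby] := pselect (box r y); last by rewrite gb // mul0r.
have [bxy|nbxy] := pselect (box s (x - y)); last by rewrite Kb // mulr0.
exfalso; apply: nx; move/boxP : by_ => [y1 y2]; move/boxP : bxy => [xy1 xy2].
apply/boxP; split.
  by rewrite -(subrK y.1 x.1) (le_trans (ler_normD _ _)) // addrC lerD.
by rewrite -(subrK y.2 x.2) (le_trans (ler_normD _ _)) // addrC lerD.
Qed.

Lemma Rintegral_moll_sub e (x : T) : 0 < e <= 1 ->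
  pm.-integrable setT (EFin \o (fun y => moll e (x - y))) /\
  (\int[pm]_y moll e (x - y))%R = 1.
Proof.
move=> e01.
have E : (\int[pm]_y (moll e (x - y))%:E = 1)%E.
  by under eq_integral do rewrite -moll_even opprB; rewrite integral_moll_sub.
split; last by rewrite /Rintegral E.
apply/integrableP; split.
  by apply/measurable_EFinP; exact: (measurableT_comp (measurable_moll e) (measurable_reflection x)).
by under eq_integral do rewrite /= ger0_norm ?moll_ge0 //; rewrite E ltry.
Qed.

(** Averages stay in the unit disc: pairing the average with its own value [(a1, a2)],
    Cauchy-Schwarz under the integral gives [n^2 <= n]. *)
Lemma enorm_convol_le1 (g1 g2 : T -> R) e (x : T) : 0 < e <= 1 ->
  pm.-integrable setT (EFin \o g1) -> pm.-integrable setT (EFin \o g2) ->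
  (forall y, g1 y ^+ 2 + g2 y ^+ 2 <= 1) ->
  enorm (convol (moll e) g1 x, convol (moll e) g2 x) <= 1.
Proof.
move=> e01 i1 i2 g12; have [C [C0 kK]] := moll_kernel e01.
have [mi mE] := Rintegral_moll_sub x e01.
set a1 := convol _ g1 x; set a2 := convol _ g2 x; rewrite /enorm /=.
set n := Num.sqrt _.
have n0 : 0 <= n by exact: sqrtr_ge0.
have nE : n ^+ 2 = a1 ^+ 2 + a2 ^+ 2 by rewrite sqr_sqrtr // addr_ge0 ?sqr_ge0.
suff : n ^+ 2 <= n by move: n0; rewrite le_eqVlt => /orP[/eqP <-//|n0]; rewrite expr2 ger_pMr.
have k1 := integrable_conv x (kernel_meas kK) (kernel_le kK) i1.
have k2 := integrable_conv x (kernel_meas kK) (kernel_le kK) i2.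
have k1' := @integrableZl _ _ _ _ _ measurableT a1 _ k1.
have k2' := @integrableZl _ _ _ _ _ measurableT a2 _ k2.
have mn := @integrableZl _ _ _ _ _ measurableT n _ mi.
have -> : n ^+ 2 = (\int[pm]_y (a1 * (g1 y * moll e (x - y)) + a2 * (g2 y * moll e (x - y))))%R.
  by rewrite RintegralD // !RintegralZl // nE !expr2.
have -> : n = (\int[pm]_y (n * moll e (x - y)))%R by rewrite RintegralZl // mE mulr1.
apply: le_Rintegral => //; first exact: (integrableD measurableT k1' k2').
move=> y _; rewrite mulrA [a2 * _]mulrA -mulrDl ler_wpM2r ?moll_ge0 //.
have CS : (a1 * g1 y + a2 * g2 y) ^+ 2 <= n ^+ 2.
  rewrite nE; have := g12 y; have := sqr_ge0 (a1 * g2 y - a2 * g1 y).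
  have := sqr_ge0 a1; have := sqr_ge0 a2; nra.
by rewrite (le_trans (ler_norm _)) // -ler_sqr ?nnegrE // real_normK ?num_real.
Qed.

(** This is [|grad u|] for the mollification [u] of the indicator of [B]. *)
Definition grad_norm (B : set T) e (x : T) : R :=
  Num.sqrt (convol (moll1 e) \1_B x ^+ 2 + convol (moll2 e) \1_B x ^+ 2).

Lemma measurable_convol_partials f e : 0 < e <= 1 -> pm.-integrable setT (EFin \o f) ->
  [/\ measurable_fun setT (convol (moll e) f), measurable_fun setT (convol (moll1 e) f) &
    measurable_fun setT (convol (moll2 e) f)].
Proof.
move=> e01 fi; have [C [C0 kK]] := moll_kernel e01.
have [[d c1 c2] E1 E2] := conv_C1 kK fi.
split; apply: plane_continuous_measurable.
- by move=> x; apply: differentiable_continuous; apply: d.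
- rewrite E1 in c1; exact: c1.
- rewrite E2 in c2; exact: c2.
Qed.

Lemma measurable_grad_norm (B : set T) e : 0 < e <= 1 -> measurable B -> (pm B < +oo)%E ->
  measurable_fun setT (grad_norm B e).
Proof.
move=> e01 mB Bfin.
have [_ m1 m2] := measurable_convol_partials e01 (integrable_indic_plane mB Bfin).
apply: (measurableT_comp measurable_sqrt).
by apply: measurable_funD; apply: measurable_funX.
Qed.

(** The perimeter is tested with the mollification of [- grad u / |grad u|] cut off to the box. The
    field before mollification is only bounded and measurable, but afterwards it is an allowed test
    field, and by adjointness its divergence integrates over [B] to exactly the left-hand side. *)
Lemma grad_norm_box_le (B : set T) e (r : R) : measurable B -> (pm B < +oo)%E ->
  0 < e <= 1 -> (\int[pm]_(x in box r) (grad_norm B e x)%:E <= plane_perimeter B)%E.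
Proof.
move=> mB Bfin e01.
have ui := integrable_indic_plane mB Bfin.
have [C [C0 kK]] := moll_kernel e01.
set u : T -> R := \1_B in ui.
pose F1 := convol (moll1 e) u; pose F2 := convol (moll2 e) u.
pose N := grad_norm B e.
have [mc mF1 mF2] := measurable_convol_partials e01 ui.
have mN : measurable_fun setT N by exact: measurable_grad_norm.
have N0 x : 0 <= N x by exact: sqrtr_ge0.
have NE x : N x ^+ 2 = F1 x ^+ 2 + F2 x ^+ 2 by rewrite sqr_sqrtr // addr_ge0 ?sqr_ge0.
(* Where the gradient vanishes the inverse is 0, so the field is 0 there. *)
pose phi (F : T -> R) x : R := - F x * (N x)^-1 * \1_(box r) x.
have mphi F : measurable_fun setT F -> measurable_fun setT (phi F).
  move=> mF; apply: measurable_funM; last by apply: measurable_indic; exact: measurable_box.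
  apply: measurable_funM; first exact: measurable_funN.
  exact: (measurableT_comp measurable_inv mN).
have phi0 F x : ~ box r x -> phi F x = 0.
  by move=> nx; rewrite /phi indicE memNset // mulr0.
have phi12 x : phi F1 x ^+ 2 + phi F2 x ^+ 2 <= 1.
  rewrite /phi !exprMn !sqrrN -!mulrDl -NE exprVn.
  have [E|nz] := eqVneq (N x) 0; first by rewrite E expr0n !mul0r.
  by rewrite divff ?sqrf_eq0 // mul1r exprn_ile1.
have phiN x : phi F1 x ^+ 2 + phi F2 x ^+ 2 <= 1 -> `|phi F1 x| <= 1 /\ `|phi F2 x| <= 1.
  move=> H; have := sqr_ge0 (phi F1 x); have := sqr_ge0 (phi F2 x) => a b.
  by split; rewrite -(@ler_sqr _ _ 1) ?nnegrE // real_normK ?num_real // expr1n; lra.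
have i1 : pm.-integrable setT (EFin \o phi F1).
  by apply: (@integrable_bounded_box _ r) => [|x|x]; [exact: mphi|have [] := phiN x (phi12 x)|exact: phi0].
have i2 : pm.-integrable setT (EFin \o phi F2).
  by apply: (@integrable_bounded_box _ r) => [|x|x]; [exact: mphi|have [] := phiN x (phi12 x)|exact: phi0].
pose Phi (x : R * R) : R * R := (convol (moll e) (phi F1) x, convol (moll e) (phi F2) x).
have [cP1 D11 D12] := conv_C1 kK i1.
have [cP2 D21 D22] := conv_C1 kK i2.
have PhiC : C1c_field Phi.
  apply: (@C1c_field_of_box _ (r + e)) => [||x nx]; [exact: cP1|exact: cP2|].
  have Kb y : ~ box e y -> moll e y = 0.
    by move=> nb; apply/eqP; apply: contrapT => /negP /(moll_support e01).
  by rewrite /Phi !(convol_support _ Kb nx) // => y; exact: phi0.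
have PhiB x : enorm (Phi x) <= 1 by exact: enorm_convol_le1.
have divE x : div Phi x = convol (moll1 e) (phi F1) x + convol (moll2 e) (phi F2) x.
  by rewrite -D11 -D22.
apply: (@le_trans _ _ (\int[pm]_(x in B) (div Phi x)%:E)%E); last first.
  by apply: ereal_sup_ubound; exists Phi.
have b1 x := le_norm_conv x (kernel_meas1 kK) (kernel_le1 kK) i1.
have b2 x := le_norm_conv x (kernel_meas2 kK) (kernel_le2 kK) i2.
have [_ mD1 _] := measurable_convol_partials e01 i1.
have [_ _ mD2] := measurable_convol_partials e01 i2.
have iu1 := integrable_mul_bounded mD1 b1 ui.
have iu2 := integrable_mul_bounded mD2 b2 ui.
have bF1 x : `|- F1 x| <= C * (\int[pm]_y `|u y|)%R.
  by rewrite normrN; exact: (le_norm_conv x (kernel_meas1 kK) (kernel_le1 kK) ui).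
have bF2 x : `|- F2 x| <= C * (\int[pm]_y `|u y|)%R.
  by rewrite normrN; exact: (le_norm_conv x (kernel_meas2 kK) (kernel_le2 kK) ui).
have ip1 := integrable_mul_bounded (measurable_funN mF1) bF1 i1.
have ip2 := integrable_mul_bounded (measurable_funN mF2) bF2 i2.
have I : (\int[pm]_x (u x * convol (moll1 e) (phi F1) x + u x * convol (moll2 e) (phi F2) x))%R =
    (\int[pm]_x (\1_(box r) x * N x))%R.
  rewrite RintegralD // (convol_adjoint (kernel_meas1 kK) (kernel_le1 kK) (moll1_odd e) i1 ui).
  rewrite (convol_adjoint (kernel_meas2 kK) (kernel_le2 kK) (moll2_odd e) i2 ui).
  rewrite -RintegralD //; apply: eq_Rintegral => x _.
  change (phi F1 x * - F1 x + phi F2 x * - F2 x = \1_(box r) x * N x).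
  rewrite /phi; move: (F1 x) (F2 x) (N x) (NE x) => f1 f2 n nE.
  have [->|nz] := eqVneq n 0; first by rewrite invr0; ring.
  transitivity (\1_(box r) x * (f1 ^+ 2 + f2 ^+ 2) / n); first by ring.
  by rewrite -nE; field.
have iN : pm.-integrable setT (EFin \o (fun x => \1_(box r) x * N x)).
  have := integrableD measurableT ip1 ip2; apply: eq_integrable => // x _ /=.
  congr (_%:E).
  change (phi F1 x * - F1 x + phi F2 x * - F2 x = \1_(box r) x * N x).
  rewrite /phi; move: (F1 x) (F2 x) (N x) (NE x) => f1 f2 n nE.
  have [->|nz] := eqVneq n 0; first by rewrite invr0; ring.
  transitivity (\1_(box r) x * (f1 ^+ 2 + f2 ^+ 2) / n); first by ring.
  by rewrite -nE; field.
rewrite [leLHS]integral_mkcond [leRHS]integral_mkcond.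
rewrite (_ : (\int[pm]_x ((fun x => (div Phi x)%:E) \_ B) x =
  \int[pm]_x (u x * convol (moll1 e) (phi F1) x + u x * convol (moll2 e) (phi F2) x)%:E)%E); last first.
  apply: eq_integral => x _; rewrite patchE /u indicE.
  by case: ifP => _; rewrite ?mul1r ?mul0r ?addr0 // divE.
rewrite (_ : (\int[pm]_x ((fun x => (grad_norm B e x)%:E) \_ (box r)) x =
  \int[pm]_x (\1_(box r) x * N x)%:E)%E); last first.
  apply: eq_integral => x _; rewrite patchE indicE.
  by case: ifP => _; rewrite ?mul1r ?mul0r.
rewrite le_eqVlt; apply/orP; left; apply/eqP.
move: I; rewrite /Rintegral => I.
rewrite -[LHS]fineK; last exact: integrable_fin_num iN.
rewrite -I fineK //; apply: integrable_fin_num => //.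
exact: (integrableD measurableT iu1 iu2).
Qed.

End gradient_bound.

(** * Translation differences controlled by the mollified gradient *)

Section nonlocal_upper_bound.
Context {R : realType}.
Local Notation mu := (@lebesgue_measure R).
Local Notation T := (measurableTypeR R * measurableTypeR R)%type.
Local Notation pm := (mu \x mu)%E.
Implicit Types (e : R) (f g : T -> R) (B : set T).

Lemma ge0_integral_boxes_le (f : T -> \bar R) (M : \bar R) : measurable_fun setT f ->
  (forall x, 0 <= f x)%E -> (forall n : nat, \int[pm]_(x in box n%:R) f x <= M)%E ->
  (\int[pm]_x f x <= M)%E.
Proof.
move=> mf f0 H.
have U : \bigcup_n (box n%:R) = [set: T].
  rewrite -subTset => x _.
  exists (Num.truncn (Num.max `|x.1| `|x.2|)).+1 => //.
  apply/boxP; split; rewrite ltW // (le_lt_trans _ (truncnS_gt _)) //.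
    by rewrite le_max lexx.
  by rewrite le_max lexx orbT.
have mb (n : nat) : measurable (box n%:R : set T) by exact: measurable_box.
have nd : nondecreasing_seq (fun n : nat => box n%:R : set T).
  move=> m n mn; apply/subsetPset => x /boxP[x1 x2]; apply/boxP.
  by split; [apply: (le_trans x1)|apply: (le_trans x2)]; rewrite ler_nat.
have := ge0_nondecreasing_set_cvg_integral (mu := pm) nd mb _ _.
rewrite U => /(_ f) C.
apply: cvge_le (C _ _) => //; first exact: nearW.
by move=> i; exact: measurable_funTS.
Qed.

Lemma integral_grad_norm_le B e : measurable B -> (pm B < +oo)%E -> 0 < e <= 1 ->
  (\int[pm]_x (grad_norm B e x)%:E <= plane_perimeter B)%E.
Proof.
move=> mB Bfin e01; apply: ge0_integral_boxes_le => [|x|n].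
- by apply/measurable_EFinP; exact: measurable_grad_norm.
- by rewrite lee_fin sqrtr_ge0.
- exact: grad_norm_box_le.
Qed.

Lemma convol_moll_quadratic f e : 0 < e <= 1 -> pm.-integrable setT (EFin \o f) ->
  exists2 C : R, 0 <= C & forall x h : R * R,
    `|convol (moll e) f (x + h) - convol (moll e) f x -
      linear_form (convol (moll1 e) f x) (convol (moll2 e) f x) h| <= C * `|h| ^+ 2.
Proof.
move=> e01 fi; have [C [C0 kK]] := moll_kernel e01.
set I := (\int[pm]_y `|f y|)%R.
have I0 : 0 <= I by apply: Rintegral_ge0.
have b0 x := le_norm_conv x (kernel_meas kK) (kernel_le kK) fi.
have b1 x := le_norm_conv x (kernel_meas1 kK) (kernel_le1 kK) fi.
have b2 x := le_norm_conv x (kernel_meas2 kK) (kernel_le2 kK) fi.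
(* For [|h| > 1/2] the remainder is at most [C * I * (2 + 2 |h|)], and 12 is the least factor with
   [2 + 2 |h| <= 12 |h|^2] from 1/2 on. *)
exists (C * I * 12); first by rewrite !mulr_ge0.
move=> x h; have [hs|hl] := leP `|h| 2^-1.
  apply: (le_trans (conv_quadratic x kK fi hs)).
  by rewrite ler_wpM2r ?sqr_ge0 // ler_peMr ?mulr_ge0 // ler1n.
have CI : 0 <= C * I by exact: mulr_ge0.
have h1 := prod_norm_le1 h; have h2 := prod_norm_le2 h.
apply: (@le_trans _ _ (C * I + C * I + (C * I * `|h| + C * I * `|h|))).
  rewrite (le_trans (ler_normB _ _)) // lerD //.
    by rewrite (le_trans (ler_normB _ _)) //; apply: lerD; exact: b0.
  rewrite (le_trans (ler_normD _ _)) // !normrM; apply: lerD; apply: ler_pM => //.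
    exact: b1.
  exact: b2.
have H : 1 + 1 + (`|h| + `|h|) <= 12 * `|h| ^+ 2 by nra.
have := ler_wpM2l CI H; rewrite !mulrDr mulr1 mulrA; lra.
Qed.

Let lf B e (z x : T) : R := linear_form (convol (moll1 e) \1_B x) (convol (moll2 e) \1_B x) z.

Let measurable_lf B e z : measurable B -> (pm B < +oo)%E -> 0 < e <= 1 ->
  measurable_fun setT (lf B e z).
Proof.
move=> mB Bfin e01.
have [_ m1 m2] := measurable_convol_partials e01 (integrable_indic_plane mB Bfin).
by apply: measurable_funD; apply: measurable_funM.
Qed.

Let measurable_lf_abs B e z : measurable B -> (pm B < +oo)%E -> 0 < e <= 1 ->
  measurable_fun setT (fun x => (`|lf B e z x|)%:E).
Proof.
by move=> mB Bfin e01; apply/measurable_EFinP; apply: measurableT_comp => //; exact: measurable_lf.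
Qed.

(** Telescoping over [k] translations by [s]. The linear parts are integrated over the whole plane,
    where translation invariance makes all steps cost the same; the box keeps the integral of the
    constant remainder finite. *)
Let translation_steps B e (r : R) (s : T) (C : R) (k : nat) : measurable B ->
  (pm B < +oo)%E -> 0 < e <= 1 -> 0 <= C ->
  (forall x, `|convol (moll e) \1_B (x + s) - convol (moll e) \1_B x - lf B e s x| <= C) ->
  (\int[pm]_(x in box r) (`|convol (moll e) \1_B (x + s *+ k) - convol (moll e) \1_B x|)%:E <=
   k%:R%:E * (\int[pm]_x (`|lf B e s x|)%:E + C%:E * pm (box r)))%E.
Proof.
move=> mB Bfin e01 C0 Q; have ui := integrable_indic_plane mB Bfin.
have [mc _ _] := measurable_convol_partials e01 ui.
set U := convol (moll e) \1_B in Q mc *.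
have mb : measurable (box r : set T) by exact: measurable_box.
have mU (z : T) : measurable_fun setT (fun x : T => U (x + z)).
  exact: (measurableT_comp mc (measurable_translation z)).
have mdU (z w : T) : measurable_fun setT (fun x : T => (`|U (x + z) - U (x + w)|)%:E).
  by apply/measurable_EFinP; apply: measurableT_comp => //; exact: measurable_funB.
have mdU0 (z : T) : measurable_fun setT (fun x : T => (`|U (x + z) - U x|)%:E).
  by apply/measurable_EFinP; apply: measurableT_comp => //; exact: measurable_funB.
have ml := measurable_lf_abs s mB Bfin e01.
elim: k => [|k IH].
  rewrite mul0e; under eq_integral do rewrite mulr0n addr0 subrr normr0.
  by rewrite integral0.
have mlk : measurable_fun setT (fun x : T => (`|lf B e s (x + s *+ k)|)%:E).
  exact: (measurableT_comp ml (measurable_translation (s *+ k))).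
apply: (@le_trans _ _ (\int[pm]_(x in box r)
   (((`|lf B e s (x + s *+ k)|)%:E + C%:E) + (`|U (x + s *+ k) - U x|)%:E))%E).
  apply: ge0_le_integral => //.
  - exact: measurable_funTS.
  - apply: measurable_funTS; apply: emeasurable_funD => //.
    by apply: emeasurable_funD.
  - move=> x _; rewrite -!EFinD lee_fin.
    have -> : x + s *+ k.+1 = x + s *+ k + s by rewrite mulrSr addrA.
    have := Q (x + s *+ k).
    move: (U (x + s *+ k + s)) (U (x + s *+ k)) (U x) (lf B e s (x + s *+ k)) => a b c l ab.
    have -> : a - c = (a - b - l) + l + (b - c) by ring.
    rewrite (le_trans (ler_normD _ _)) // lerD2r (le_trans (ler_normD _ _)) //.
    by rewrite [leRHS]addrC lerD2r.
have p1 x : box r x -> (0 <= (`|lf B e s (x + s *+ k)|)%:E + C%:E)%E.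
  by move=> _; rewrite -EFinD lee_fin addr_ge0.
have m1 : measurable_fun (box r) (fun x : T => (`|lf B e s (x + s *+ k)|)%:E + C%:E)%E.
  by apply: measurable_funTS; apply: emeasurable_funD.
have m2 : measurable_fun (box r) (fun x : T => (`|U (x + s *+ k) - U x|)%:E).
  exact: measurable_funTS.
have m3 : measurable_fun (box r) (fun x : T => (`|lf B e s (x + s *+ k)|)%:E).
  exact: measurable_funTS.
rewrite ge0_integralD // ge0_integralD // integral_cst //.
have -> : (k.+1%:R%:E = 1%:E + k%:R%:E :> \bar R)%E by rewrite -EFinD -nat1r.
rewrite ge0_muleDl ?lee_fin ?ler01 ?ler0n //.
rewrite mul1e.
apply: leeD; last exact: IH.
apply: leeD; last by [].
apply: (@le_trans _ _ (\int[pm]_x (`|lf B e s (x + s *+ k)|)%:E)%E).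
  by apply: ge0_subset_integral => //; exact: measurable_funTS.
by rewrite (ge0_integral_translation (s *+ k) ml).
Qed.

(** In place of integrating the gradient along the segment, [z] is cut into [N] equal steps: the
    linear parts add up to the right-hand side, and the quadratic remainders to [N * C * |z / N|^2]
    times the area of the box, which tends to 0. *)
Lemma translation_diff_mollified_le B e z : measurable B -> (pm B < +oo)%E -> 0 < e <= 1 ->
  (translation_diff (convol (moll e) \1_B) z <=
   \int[pm]_x (`|linear_form (convol (moll1 e) \1_B x) (convol (moll2 e) \1_B x) z|)%:E)%E.
Proof.
move=> mB Bfin e01; have ui := integrable_indic_plane mB Bfin.
have [mc _ _] := measurable_convol_partials e01 ui.
have [C C0 Q] := convol_moll_quadratic e01 ui.
rewrite -/(translation_diff _ _).
apply: ge0_integral_boxes_le => [|x|n].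
- apply/measurable_EFinP; apply: measurableT_comp => //; apply: measurable_funB => //.
  exact: (measurableT_comp mc (measurable_translation z)).
- by rewrite lee_fin.
apply/lee_addgt0Pr => eta eta0.
have bfin : pm (box n%:R) \is a fin_num by rewrite ge0_fin_numE // box_measure_lty.
pose M := fine (pm (box n%:R)); have M0 : 0 <= M by exact: fine_ge0.
pose D := C * `|z : (R * R)%type| ^+ 2 * M.
have D0 : 0 <= D by rewrite !mulr_ge0 // sqr_ge0.
(* Chosen so that the accumulated remainder [D / N] is less than [eta]. *)
pose N := (Num.truncn (D / eta)).+1.
have N0 : (0 : R) < N%:R by rewrite ltr0n.
pose s : R * R := N%:R^-1 *: (z : (R * R)%type).
have sN : s *+ N = z.
  by rewrite -scaler_nat scalerA divff ?scale1r // gt_eqF.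
have Cs0 : 0 <= C * `|s| ^+ 2 by rewrite mulr_ge0 ?sqr_ge0.
have := translation_steps n%:R N mB Bfin e01 Cs0 (fun x => Q x s).
rewrite sN => /le_trans; apply.
rewrite muleDr; last 2 first.
- by [].
- apply: ge0_adde_def; rewrite inE; first by apply: integral_ge0 => x _; rewrite lee_fin.
  by rewrite mule_ge0 // lee_fin.
apply: leeD.
  have ml := measurable_lf_abs s mB Bfin e01.
  have NN : (0 <= N%:R%:E :> \bar R)%E by rewrite lee_fin.
  rewrite -ge0_integralZl //.
  rewrite le_eqVlt; apply/orP; left; apply/eqP; apply: eq_integral => x _.
  rewrite -EFinM; congr (_%:E); rewrite /lf -[X in X * _](ger0_norm (ltW N0)) -normrM.
  congr (`|_|); rewrite /linear_form /s /= /GRing.scale /=; field; by rewrite gt_eqF.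
rewrite -(fineK bfin) -/M -!EFinM lee_fin.
rewrite /s normrZ ger0_norm ?invr_ge0 ?(ltW N0) // exprMn.
have -> : N%:R * (C * (N%:R^-1 ^+ 2 * `|z : (R * R)%type| ^+ 2) * M) = D / N%:R.
  by rewrite /D; field; rewrite gt_eqF.
rewrite ler_pdivrMr // mulrC -ler_pdivrMr // ltW //; exact: truncnS_gt.
Qed.

End nonlocal_upper_bound.

(** * The logarithmic energy *)

Section nonlocal_energy.
Context {R : realType}.
Local Notation mu := (@lebesgue_measure R).
Local Notation T := (measurableTypeR R * measurableTypeR R)%type.
Local Notation pm := (mu \x mu)%E.
Implicit Types (e : R) (f g : T -> R) (B : set T).

Definition near_energy (delta : R) f : \bar R :=
  (\int[pm]_z ((near_weight delta (enorm z))%:E * translation_diff f z))%E.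

Lemma measurable_near_enorm (delta : R) :
  measurable_fun setT (fun z : T => near_weight delta (enorm z)).
Proof. exact: (measurableT_comp (measurable_near_weight delta) measurable_enorm). Qed.

Lemma measurable_near_energy (delta : R) f : measurable_fun setT f ->
  measurable_fun setT (fun z : T => (near_weight delta (enorm z))%:E * translation_diff f z)%E.
Proof.
move=> mf; apply: emeasurable_funM; last exact: measurable_translation_diff.
by apply/measurable_EFinP; exact: measurable_near_enorm.
Qed.

Lemma near_energy_mollified_le B e (delta : R) : measurable B -> (pm B < +oo)%E ->
  0 < e <= 1 -> 0 < delta < 1 ->
  (near_energy delta (convol (moll e) \1_B) <=
   (4 * ln delta^-1)%:E * plane_perimeter B)%E.
Proof.
move=> mB Bfin e01 d01; have /andP[d0 d1] := d01.
have ui := integrable_indic_plane mB Bfin.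
have [mc m1 m2] := measurable_convol_partials e01 ui.
set F1 := convol (moll1 e) \1_B in m1; set F2 := convol (moll2 e) \1_B in m2.
pose G (p : T * T) : \bar R :=
  (near_weight delta (enorm p.1) * `|F1 p.2 * p.1.1 + F2 p.2 * p.1.2|)%:E.
have mG : measurable_fun setT G.
  apply/measurable_EFinP; apply: measurable_funM.
    exact: (measurableT_comp (measurable_near_enorm delta) measurable_fst).
  apply: measurableT_comp => //; apply: measurable_funD; apply: measurable_funM.
  - exact: (measurableT_comp m1 measurable_snd).
  - exact: (measurableT_comp (@measurable_fst _ _ _ _) measurable_fst).
  - exact: (measurableT_comp m2 measurable_snd).
  - exact: (measurableT_comp (@measurable_snd _ _ _ _) measurable_fst).
have nw0 (z : T) : 0 <= near_weight delta (enorm z) by exact: near_weight_ge0.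
have G0 p : (0 <= G p)%E by rewrite lee_fin mulr_ge0.
have l0 : 0 <= 4 * ln delta^-1.
  by rewrite mulr_ge0 // ln_ge0 // invf_ge1 // ltW.
apply: (@le_trans _ _ (\int[pm]_z \int[pm]_x G (z, x))%E).
  apply: ge0_le_integral => //.
  - by move=> z _; rewrite mule_ge0 ?lee_fin // translation_diff_ge0.
  - exact: measurable_near_energy.
  - exact: (plane_measurable_F mG G0).
  - move=> z _; rewrite /G /=; under [leRHS]eq_integral do rewrite EFinM.
    have ml : measurable_fun setT (fun x : T => (`|F1 x * z.1 + F2 x * z.2|)%:E).
      apply/measurable_EFinP; apply: measurableT_comp => //.
      by apply: measurable_funD; apply: measurable_funM.
    have nwz : (0 <= (near_weight delta (enorm z))%:E)%E by rewrite lee_fin.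
    rewrite ge0_integralZl //; apply: lee_wpmul2l => //.
    exact: translation_diff_mollified_le.
rewrite (plane_tonelli mG G0).
apply: (@le_trans _ _ (\int[pm]_x ((4 * ln delta^-1)%:E * (grad_norm B e x)%:E))%E).
  rewrite le_eqVlt; apply/orP; left; apply/eqP; apply: eq_integral => x _.
  by rewrite /G /= integral_near_weight_dot // EFinM.
have mg : measurable_fun setT (fun x : T => (grad_norm B e x)%:E).
  by apply/measurable_EFinP; exact: measurable_grad_norm.
have g0 (x : T) : setT x -> (0 <= (grad_norm B e x)%:E)%E by rewrite lee_fin sqrtr_ge0.
have l0' : (0 <= (4 * ln delta^-1)%:E)%E by rewrite lee_fin.
rewrite ge0_integralZl //; apply: lee_wpmul2l => //.
exact: integral_grad_norm_le.
Qed.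

Lemma mollified_dist_le B e (eta : R) : measurable B -> (pm B < +oo)%E ->
  0 < e <= 1 -> 0 <= eta ->
  (forall z, box e z -> (translation_diff (\1_B : T -> R) z <= eta%:E)%E) ->
  (\int[pm]_x (`|convol (moll e) \1_B x - \1_B x : R|)%:E <= eta%:E)%E.
Proof.
move=> mB Bfin e01 eta0 H; have ui := integrable_indic_plane mB Bfin.
have mu1 := measurable_integrable ui.
apply: (le_trans (conv_dist e01 ui)).
apply: (@le_trans _ _ (\int[pm]_z (eta%:E * (moll e z)%:E))%E).
  apply: ge0_le_integral => //.
  - by move=> z _; rewrite mule_ge0 ?lee_fin ?moll_ge0 // translation_diff_ge0.
  - apply: emeasurable_funM; last exact: measurable_translation_diff.
    by apply/measurable_EFinP; exact: measurable_moll.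
  - by apply: measurable_funeM; apply/measurable_EFinP; exact: measurable_moll.
  - move=> z _; have [->|nz] := eqVneq (moll e z) 0; first by rewrite mul0e mule0.
    rewrite muleC; apply: lee_wpmul2r; first by rewrite lee_fin moll_ge0.
    by apply: H; exact: moll_support.
have mm : measurable_fun setT (fun z : T => (moll e z)%:E).
  by apply/measurable_EFinP; exact: measurable_moll.
have m0 (z : T) : setT z -> (0 <= (moll e z)%:E)%E by rewrite lee_fin moll_ge0.
have eta0' : (0 <= eta%:E)%E by rewrite lee_fin.
by rewrite ge0_integralZl // integral_moll // mule1.
Qed.

Lemma translation_diff_approx f g (z : T) (eta : R) : measurable_fun setT f ->
  measurable_fun setT g -> (\int[pm]_x (`|g x - f x|)%:E <= eta%:E)%E ->
  (translation_diff f z <= translation_diff g z + (eta + eta)%:E)%E.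
Proof.
move=> mf mg H.
have mfz : measurable_fun setT (fun x : T => f (x + z)).
  exact: (measurableT_comp mf (measurable_translation z)).
have mgz : measurable_fun setT (fun x : T => g (x + z)).
  exact: (measurableT_comp mg (measurable_translation z)).
have md : measurable_fun setT (fun x : T => (`|g x - f x|)%:E).
  by apply/measurable_EFinP; apply: measurableT_comp => //; exact: measurable_funB.
have mdz : measurable_fun setT (fun x : T => (`|g (x + z) - f (x + z)|)%:E).
  by apply/measurable_EFinP; apply: measurableT_comp => //; exact: measurable_funB.
have mtf : measurable_fun setT (fun x : T => (`|f (x + z) - f x|)%:E).
  by apply/measurable_EFinP; apply: measurableT_comp => //; exact: measurable_funB.
have mtg : measurable_fun setT (fun x : T => (`|g (x + z) - g x|)%:E).
  by apply/measurable_EFinP; apply: measurableT_comp => //; exact: measurable_funB.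
have ms : measurable_fun setT (fun x : T => (`|g (x + z) - f (x + z)|)%:E + (`|g x - f x|)%:E)%E.
  exact: emeasurable_funD.
have s0 (x : T) : setT x -> (0 <= (`|g (x + z) - f (x + z)|)%:E + (`|g x - f x|)%:E)%E.
  by move=> _; rewrite adde_ge0 ?lee_fin.
apply: (@le_trans _ _ (\int[pm]_x ((`|g (x + z) - g x|)%:E +
   ((`|g (x + z) - f (x + z)|)%:E + (`|g x - f x|)%:E)))%E).
  apply: ge0_le_integral => //; first exact: emeasurable_funD.
  move=> x _; rewrite -!EFinD lee_fin.
  have -> : f (x + z) - f x = (g (x + z) - g x) + (- (g (x + z) - f (x + z)) + (g x - f x)) by ring.
  rewrite (le_trans (ler_normD _ _)) // lerD2l (le_trans (ler_normD _ _)) //.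
  by rewrite normrN.
rewrite ge0_integralD // ge0_integralD //.
rewrite EFinD; apply: leeD; first by [].
apply: leeD; last exact: H.
by rewrite (ge0_integral_translation z md).
Qed.

(** The crude bound [delta^-3] on a box is enough: finiteness serves, at fixed [delta], to choose
    the mollification scale. *)
Lemma integral_near_weight_lty (delta : R) : 0 < delta ->
  (\int[pm]_z (near_weight delta (enorm z))%:E < +oo)%E.
Proof.
move=> d0.
have bfin : (pm : {measure set T -> \bar R}) (box 1) \is a fin_num by rewrite box_measure.
apply: (@le_lt_trans _ _ (\int[pm]_z ((delta ^- 3)%:E * (\1_(box 1) z)%:E))%E).
  have mi : measurable_fun setT (fun z : T => (\1_(box 1) z : R)%:E).
    by apply/measurable_EFinP; apply: measurable_indic; exact: measurable_box.
  apply: ge0_le_integral => //.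
  - by move=> z _; rewrite lee_fin near_weight_ge0.
  - by apply/measurable_EFinP; exact: measurable_near_enorm.
  - exact: measurable_funeM.
  - move=> z _; rewrite -EFinM lee_fin /near_weight indicE.
    case: (boolP (enorm z \in `]delta, 1]%classic)) => [/set_mem /=|_]; last first.
      by rewrite mul0r mulr_ge0 // invr_ge0 exprn_ge0 // ltW.
    rewrite in_itv /= => /andP[dz z1].
    have zb : box 1 z.
      have H (y w : R) : Num.sqrt (y ^+ 2 + w ^+ 2) <= 1 -> `|y| <= 1.
        by apply: le_trans; rewrite -sqrtr_sqr; apply: ler_wsqrtr; rewrite lerDl sqr_ge0.
      by apply/boxP; split; [exact: H z1|apply: (H _ z.1); rewrite addrC].
    rewrite indicE mem_set // mul1r mulr1 lef_pV2 ?posrE ?exprn_gt0 //; last exact: lt_trans dz.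
    by rewrite lerXn2r ?nnegrE ?sqrtr_ge0 // ltW.
have mi : measurable_fun setT (fun z : T => (\1_(box 1) z : R)%:E).
  by apply/measurable_EFinP; apply: measurable_indic; exact: measurable_box.
have d30 : (0 <= (delta ^- 3)%:E)%E by rewrite lee_fin invr_ge0 exprn_ge0 // ltW.
have i0 (z : T) : setT z -> (0 <= (\1_(box 1) z : R)%:E)%E by rewrite lee_fin.
rewrite ge0_integralZl // integral_indic //; last exact: measurable_box.
by rewrite setIT -(fineK bfin) -EFinM ltry.
Qed.

Lemma near_energy_le B (delta : R) : measurable B -> (pm B < +oo)%E -> 0 < delta < 1 ->
  (near_energy delta (\1_B : T -> R) <= (4 * ln delta^-1)%:E * plane_perimeter B)%E.
Proof.
move=> mB Bfin d01; have /andP[d0 d1] := d01.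
have ui := integrable_indic_plane mB Bfin.
have mu1 := measurable_integrable ui.
have nw0 (z : T) : 0 <= near_weight delta (enorm z) by exact: near_weight_ge0.
have mn : measurable_fun setT (fun z : T => (near_weight delta (enorm z))%:E).
  by apply/measurable_EFinP; exact: measurable_near_enorm.
have Wfin := integral_near_weight_lty d0.
set W := (\int[pm]_z (near_weight delta (enorm z))%:E)%E in Wfin.
have W0 : (0 <= W)%E by apply: integral_ge0 => z _; rewrite lee_fin.
have Wf : W \is a fin_num by rewrite ge0_fin_numE.
have w0 : 0 <= fine W by exact: fine_ge0.
apply/lee_addgt0Pr => t t0.
(* Mollifying costs [2 eta] in each translation difference, hence [2 eta W <= t] in total. The scale
   may depend on [delta], since the bound for the mollified function does not depend on the
   scale. *)
pose eta := t / (2 * (fine W + 1)).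
have eta0 : 0 < eta by rewrite divr_gt0 // mulr_gt0 // ltr_wpDl.
have [e e01 He] := translation_diff_indic_small mB Bfin eta0.
have [mc _ _] := measurable_convol_partials e01 ui.
have D := mollified_dist_le mB Bfin e01 (ltW eta0) He.
have V z := translation_diff_approx z mu1 mc D.
have mne := measurable_near_energy delta mc.
have E0 : (0 <= (eta + eta)%:E)%E by rewrite lee_fin addr_ge0 // ltW.
have mew : measurable_fun setT (fun z : T => (eta + eta)%:E * (near_weight delta (enorm z))%:E)%E.
  exact: measurable_funeM.
apply: (@le_trans _ _ (\int[pm]_z ((near_weight delta (enorm z))%:E *
   translation_diff (convol (moll e) \1_B) z + (eta + eta)%:E * (near_weight delta (enorm z))%:E))%E).
  apply: ge0_le_integral => //.
  - by move=> z _; rewrite mule_ge0 ?lee_fin // translation_diff_ge0.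
  - exact: measurable_near_energy.
  - exact: emeasurable_funD.
  - move=> z _; rewrite [X in (_ <= _ + X)%E]muleC -ge0_muleDr ?translation_diff_ge0 //.
    by apply: lee_wpmul2l; [rewrite lee_fin|exact: V].
have p1 (z : T) : setT z -> (0 <= (near_weight delta (enorm z))%:E *
   translation_diff (convol (moll e) \1_B) z)%E.
  by move=> _; rewrite mule_ge0 ?lee_fin // translation_diff_ge0.
have p2 (z : T) : setT z -> (0 <= (eta + eta)%:E * (near_weight delta (enorm z))%:E)%E.
  by move=> _; rewrite mule_ge0 ?lee_fin.
have p3 (z : T) : setT z -> (0 <= (near_weight delta (enorm z))%:E)%E.
  by move=> _; rewrite lee_fin.
rewrite ge0_integralD // ge0_integralZl //.
apply: leeD; first exact: near_energy_mollified_le.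
rewrite -/W -(fineK Wf) -EFinM lee_fin /eta.
have -> : (t / (2 * (fine W + 1)) + t / (2 * (fine W + 1))) * fine W = t * (fine W / (fine W + 1)).
  by field; rewrite gt_eqF // ltr_wpDl.
by rewrite ler_piMr ?(ltW t0) // ler_pdivrMr ?ltr_wpDl // mul1r lerDl.
Qed.

Lemma translation_diff_indic_le B z : measurable B ->
  (translation_diff (\1_B : T -> R) z <= 2%:E * pm B)%E.
Proof.
move=> mB.
have mi : measurable_fun setT (fun x : T => (\1_B x : R)%:E).
  by apply/measurable_EFinP; exact: measurable_indic.
have miz : measurable_fun setT (fun x : T => (\1_B (x + z) : R)%:E).
  exact: (measurableT_comp mi (measurable_translation z)).
apply: (@le_trans _ _ (\int[pm]_x ((\1_B (x + z) : R)%:E + (\1_B x : R)%:E))%E).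
  apply: ge0_le_integral => //.
  - apply/measurable_EFinP; apply: measurableT_comp => //.
    by apply: measurable_funB; apply/measurable_EFinP.
  - exact: emeasurable_funD.
  - move=> x _; rewrite -EFinD lee_fin (le_trans (ler_normB _ _)) //.
    by rewrite !ger0_norm.
rewrite ge0_integralD //.
rewrite (ge0_integral_translation z mi); last by move=> x; rewrite lee_fin.
rewrite integral_indic // setIT.
by rewrite (_ : 2%:E = (1 : R)%:E + (1 : R)%:E)%E // ge0_muleDl ?lee_fin // mul1e.
Qed.

(** The nonlocal term with the integral in [z] outermost and the square dropped, as differences of
    indicators have absolute value 0 or 1. *)
Definition plane_nonlocal (delta : R) B : \bar R :=
  (\int[pm]_z ((cutoff delta (enorm z) / enorm z ^+ 3)%:E *
    translation_diff (\1_B : T -> R) z))%E.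

Let tail (z : T) : R := \1_(`]1, +oo[%classic : set R) (enorm z) / enorm z ^+ 3.

Let tail_ge0 z : 0 <= tail z.
Proof. by rewrite mulr_ge0 // invr_ge0 exprn_ge0 // sqrtr_ge0. Qed.

Let measurable_tail : measurable_fun setT tail.
Proof.
have m1 : measurable_fun setT (\1_(`]1, +oo[%classic : set R) : R -> R).
  exact: measurable_indic.
apply: measurable_funM; first exact: (measurableT_comp m1 measurable_enorm).
exact: (measurableT_comp (measurable_exprnV 3) measurable_enorm).
Qed.

Let cutoff_split (delta : R) (z : T) : 0 < delta < 1 ->
  cutoff delta (enorm z) / enorm z ^+ 3 = near_weight delta (enorm z) + tail z.
Proof.
move=> /andP[d0 d1]; rewrite /cutoff /near_weight /tail -mulrDl; congr (_ * _).
rewrite !indicE; move: (enorm z) => r.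
have E1 : (r / delta \in `]1, +oo[%classic) = (delta < r).
  by apply/idP/idP => [/set_mem /=|H]; [|apply/mem_set => /=];
    rewrite in_itv /= andbT ltr_pdivlMr // mul1r.
have E2 : (r \in `]delta, 1]%classic) = (delta < r) && (r <= 1).
  by apply/idP/idP => [/set_mem /=|H]; [|apply/mem_set => /=]; rewrite in_itv.
have E3 : (r \in `]1, +oo[%classic) = (1 < r).
  by apply/idP/idP => [/set_mem /=|H]; [|apply/mem_set => /=]; rewrite in_itv /= andbT.
rewrite E1 E2 E3; case: (ltP delta r) => dr /=; case: (leP r 1) => r1 /=;
  rewrite ?addr0 ?add0r //.
by move: (lt_trans (le_lt_trans dr d1) r1); rewrite ltxx.
Qed.

Lemma plane_nonlocal_split (delta : R) B : measurable B -> 0 < delta < 1 ->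
  (plane_nonlocal delta B = near_energy delta (\1_B : T -> R) +
   \int[pm]_z ((tail z)%:E * translation_diff (\1_B : T -> R) z))%E.
Proof.
move=> mB d01; have /andP[d0 _] := d01.
have mu1 : measurable_fun setT (\1_B : T -> R) by exact: measurable_indic.
have nw0 (z : T) : 0 <= near_weight delta (enorm z) by exact: near_weight_ge0.
have V0 := translation_diff_ge0 (\1_B : T -> R).
have p1 (z : T) : setT z -> (0 <= (near_weight delta (enorm z))%:E * translation_diff (\1_B : T -> R) z)%E.
  by move=> _; rewrite mule_ge0 ?lee_fin.
have p2 (z : T) : setT z -> (0 <= (tail z)%:E * translation_diff (\1_B : T -> R) z)%E.
  by move=> _; rewrite mule_ge0 // lee_fin tail_ge0.
have m1 := measurable_near_energy delta mu1.
have m2 : measurable_fun setT (fun z : T => (tail z)%:E * translation_diff (\1_B : T -> R) z)%E.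
  apply: emeasurable_funM; last exact: measurable_translation_diff.
  by apply/measurable_EFinP; exact: measurable_tail.
rewrite /near_energy -ge0_integralD //; apply: eq_integral => z _.
by rewrite cutoff_split // EFinD ge0_muleDl // lee_fin ?tail_ge0.
Qed.

Lemma near_energy_le_nonlocal (delta : R) B : measurable B -> 0 < delta < 1 ->
  (near_energy delta (\1_B : T -> R) <= plane_nonlocal delta B)%E.
Proof.
move=> mB d01; rewrite plane_nonlocal_split // leeDl //.
apply: integral_ge0 => z _; rewrite mule_ge0 ?translation_diff_ge0 //.
by rewrite lee_fin tail_ge0.
Qed.

(** The constant 16 is 2, from the trivial bound on a translation difference, times 8, from the
    integral of the far kernel. *)
Lemma plane_nonlocal_le (delta : R) B : measurable B -> (pm B < +oo)%E -> 0 < delta < 1 ->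
  (plane_nonlocal delta B <= (4 * ln delta^-1)%:E * plane_perimeter B + 16%:E * pm B)%E.
Proof.
move=> mB Bfin d01; rewrite plane_nonlocal_split //; apply: leeD.
  exact: near_energy_le.
have mu1 : measurable_fun setT (\1_B : T -> R) by exact: measurable_indic.
have mt : measurable_fun setT (fun z : T => (tail z)%:E).
  by apply/measurable_EFinP; exact: measurable_tail.
have B0 : (0 <= 2%:E * pm B)%E by rewrite mule_ge0 // lee_fin.
have t0 (z : T) : setT z -> (0 <= (tail z)%:E)%E by rewrite lee_fin tail_ge0.
apply: (@le_trans _ _ (\int[pm]_z ((tail z)%:E * (2%:E * pm B)))%E).
  apply: ge0_le_integral => //.
  - by move=> z _; rewrite mule_ge0 ?translation_diff_ge0 // lee_fin tail_ge0.
  - by apply: emeasurable_funM => //; exact: measurable_translation_diff.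
  - by apply: emeasurable_funM => //; exact: measurable_cst.
  - move=> z _; apply: lee_wpmul2l; first by rewrite lee_fin tail_ge0.
    exact: translation_diff_indic_le.
rewrite ge0_integralZr // muleA [X in (X * _ <= _)%E]muleC.
have -> : (16%:E = 2%:E * 8%:E :> \bar R)%E by rewrite -EFinM; congr (_%:E); ring.
rewrite muleC [leRHS]muleC; apply: lee_wpmul2l; first by [].
apply: lee_wpmul2l; first by rewrite lee_fin.
exact: integral_tail_le.
Qed.

End nonlocal_energy.

(** * Integration by parts and the lower bound for the nonlocal term *)

Section divergence.
Context {R : realType}.
Local Notation mu := (@lebesgue_measure R).
Local Notation T := (measurableTypeR R * measurableTypeR R)%type.
Local Notation pm := (mu \x mu)%E.
Implicit Types (g : R * R -> R) (r s t : R) (v w : R * R).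

Lemma derivable_line g w v t : derivable g (w + t *: v) v ->
  derivable (fun s => g (w + s *: v)) t 1 /\
  (fun s => g (w + s *: v))^`()%classic t = 'D_v g (w + t *: v).
Proof.
move=> d.
have E : (fun h : R => h^-1 *: (((fun s => g (w + s *: v)) \o shift t) (h *: (1 : R)) - g (w + t *: v))) =
    (fun h : R => h^-1 *: ((g \o shift (w + t *: v)) (h *: v) - g (w + t *: v))).
  apply/funext => h /=; congr (_ *: (g _ - _)).
  have -> : h *: (1 : R) = h by exact: mulr1.
  by rewrite scalerDl addrCA.
split; first by rewrite /derivable E.
by rewrite derive1E /derive E.
Qed.

Lemma continuous_line g w v : continuous g -> continuous (fun s => g (w + s *: v)).
Proof.
move=> cg s.
have c : w + t *: v @[t --> s] --> w + s *: v.
  by apply: cvgD; [exact: cvg_cst|exact: scalel_continuous].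
by have := cvg_comp _ _ c (cg (w + s *: v)).
Qed.

Lemma integral_derive1_compact (F : R -> R) r : (forall t, derivable F t 1) ->
  continuous (F^`()%classic) -> (forall t, r < `|t| -> F t = 0) ->
  (\int[mu]_t (F^`()%classic t)%:E = 0)%E.
Proof.
move=> dF cF F0.
(* The radius [r] may be negative; enlarging it to 0 keeps the support condition. *)
wlog r0 : r F0 / 0 <= r.
  move=> H; apply: (H (Num.max r 0)); last by rewrite le_max lexx orbT.
  by move=> t; rewrite gt_max => /andP[rt _]; exact: F0.
have dF0 t : r < `|t| -> F^`()%classic t = 0.
  move=> rt; rewrite derive1E (@near_eq_derive _ _ _ F (cst 0)) ?derive_cst //.
  have o : open [set s : R | r < `|s|].
    rewrite (_ : [set _ | _] = (fun s : R => `|s|) @^-1` [set x | r < x]) //.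
    by apply: open_comp; [move=> x _; exact: norm_continuous|exact: open_gt].
  have := open_nbhs_nbhs (conj o rt : open_nbhs t _).
  by apply: filterS => s; exact: F0.
(* The margin 1 puts the endpoints strictly outside the support and keeps the interval nondegenerate
   when [r = 0]. *)
have ab : - (r + 1) < r + 1 by lra.
have C t : F @ t --> F t.
  by apply: differentiable_continuous; apply/derivable1_diffP; exact: dF.
have I := @continuous_FTC2 R (F^`()%classic) F _ _ ab _ _ _.
have Fe t : `|t| = r + 1 -> F t = 0 by move=> tE; apply: F0; rewrite tE; lra.
have {}I : (\int[mu]_(t in `[(- (r + 1))%R, (r + 1)%R]) (F^`()%classic t)%:E = 0)%E.
  rewrite I.
  - by rewrite !Fe ?subee // ?normrN ger0_norm //; lra.
  - exact: continuous_subspaceT.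
  - by split; [move=> t _; exact: dF|exact: cvg_at_right_filter|exact: cvg_at_left_filter].
  - by move=> t _.
rewrite -[RHS]I [RHS]integral_mkcond; apply: eq_integral => t _.
rewrite patchE; case: ifPn => // /negP nt; rewrite dF0 //.
rewrite ltNge; apply/negP => tr; apply: nt; rewrite inE /= in_itv /= -ler_norml.
by lra.
Qed.

Lemma derive_zero_box g r v x : (forall y, ~ box r y -> g y = 0) -> ~ box r x ->
  'D_v g x = 0.
Proof.
move=> g0 nx; rewrite (@near_eq_derive _ _ _ g (cst 0)) ?derive_cst //.
have cb : closed (box r : set (R * R)).
  by apply: compact_closed; [exact: norm_hausdorff|exact: box_compact].
have o : open (~` box r : set (R * R)) by exact: closed_openC.
have := open_nbhs_nbhs (conj o nx : open_nbhs x _).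
by apply: filterS => y; exact: g0.
Qed.

Lemma bounded_continuous_box g r : continuous g -> (forall y, ~ box r y -> g y = 0) ->
  exists2 M : R, 0 <= M & forall x, `|g x| <= M.
Proof.
move=> cg g0.
have : compact (g @` (box r : set (R * R))).
  by apply: continuous_compact; [exact: continuous_subspaceT|exact: box_compact].
move/compact_bounded => [M [_ /(_ (`|M| + 1))]].
have MM : M < `|M| + 1 by rewrite (le_lt_trans (ler_norm _)) // ltrDl.
move=> /(_ MM) H; exists (`|M| + 1); first exact: addr_ge0.
move=> x; have [bx|/g0 ->] := pselect (box r x); last by rewrite normr0 addr_ge0.
by apply: H; exists x.
Qed.

Lemma integrable_continuous_box g r : continuous g -> (forall y, ~ box r y -> g y = 0) ->
  pm.-integrable setT (EFin \o (g : T -> R)).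
Proof.
move=> cg g0; have [M M0 gM] := bounded_continuous_box cg g0.
have mg := plane_continuous_measurable cg.
have bi := integrable_indic_plane (measurable_box r) (box_measure_lty r).
have := integrable_mul_bounded mg gM bi.
apply: eq_integrable => // x _ /=; congr (_%:E); rewrite indicE.
case: (boolP (x \in box r)) => [_|/negP nx]; first by rewrite mul1r.
by rewrite mul0r g0 // => /mem_set.
Qed.

Lemma integral_derive_compact1 g r : (forall x, differentiable g x) ->
  continuous (fun x => 'D_(1, 0) g x) -> (forall y, ~ box r y -> g y = 0) ->
  (\int[pm]_x ('D_(1, 0) g x)%:E = 0)%E.
Proof.
move=> dg cD g0.
have di := integrable_continuous_box cD (fun x => @derive_zero_box g r (1, 0) x g0).
rewrite -(integral21_prod_meas1 di) integral0_eq // => y _; rewrite /fubini_G /=.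
have H t := @derivable_line g (0, y) (1, 0) t (diff_derivable (dg _)).
have E t : (t, y) = ((0, y) : R * R) + t *: ((1, 0) : R * R).
  by change ((t, y) = (0 + t * 1, y + t * 0)); rewrite mulr1 mulr0 add0r addr0.
under eq_integral => t _ do rewrite E -(H t).2.
apply: (@integral_derive1_compact _ r) => [t|t|t rt].
- exact: (H t).1.
- rewrite (_ : _^`()%classic = (fun t => 'D_(1, 0) g ((0, y) + t *: (1, 0)))); last first.
    by apply/funext => s; exact: (H s).2.
  exact: (@continuous_line (fun x => 'D_(1, 0) g x)).
- by rewrite -E g0 // => /boxP[/= /(lt_le_trans rt)]; rewrite ltxx.
Qed.

Lemma integral_derive_compact2 g r : (forall x, differentiable g x) ->
  continuous (fun x => 'D_(0, 1) g x) -> (forall y, ~ box r y -> g y = 0) ->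
  (\int[pm]_x ('D_(0, 1) g x)%:E = 0)%E.
Proof.
move=> dg cD g0.
have di := integrable_continuous_box cD (fun x => @derive_zero_box g r (0, 1) x g0).
rewrite -(integral12_prod_meas1 di) integral0_eq // => y _; rewrite /fubini_F /=.
have H t := @derivable_line g (y, 0) (0, 1) t (diff_derivable (dg _)).
have E t : (y, t) = ((y, 0) : R * R) + t *: ((0, 1) : R * R).
  by change ((y, t) = (y + t * 0, 0 + t * 1)); rewrite mulr1 mulr0 add0r addr0.
under eq_integral => t _ do rewrite E -(H t).2.
apply: (@integral_derive1_compact _ r) => [t|t|t rt].
- exact: (H t).1.
- rewrite (_ : _^`()%classic = (fun t => 'D_(0, 1) g ((y, 0) + t *: (0, 1)))); last first.
    by apply/funext => s; exact: (H s).2.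
  exact: (@continuous_line (fun x => 'D_(0, 1) g x)).
- by rewrite -E g0 // => /boxP[_ /= /(lt_le_trans rt)]; rewrite ltxx.
Qed.

End divergence.

(** * The gradient on a box bounded by the near energy *)

Section nonlocal_lower_bound.
Context {R : realType}.
Local Notation mu := (@lebesgue_measure R).
Local Notation T := (measurableTypeR R * measurableTypeR R)%type.
Local Notation pm := (mu \x mu)%E.
Implicit Types (e r delta : R) (B : set T).

Lemma prod_norm_sqr_le (z : R * R) : `|z| ^+ 2 <= enorm z ^+ 2.
Proof.
rewrite /enorm sqr_sqrtr ?addr_ge0 ?sqr_ge0 // prod_normE.
by rewrite /Num.max; case: ifP => _; rewrite real_normK ?num_real // (lerDl, lerDr) sqr_ge0.
Qed.

(** On the box, [|grad u . z| <= |u (x + z) - u x| + C |z|^2]; integrate this against the near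
    kernel. The remainder is uniform in [x], so it is integrable only after restriction to a box.
    [C] may depend on [e] and [r] but not on [delta]. *)
Lemma grad_norm_le_near_energy B e r : measurable B -> (pm B < +oo)%E -> 0 < e <= 1 ->
  exists C : R, forall delta, 0 < delta < 1 ->
    ((4 * ln delta^-1)%:E * \int[pm]_(x in box r) (grad_norm B e x)%:E <=
     near_energy delta (\1_B : T -> R) + C%:E)%E.
Proof.
move=> mB Bfin e01; have ui := integrable_indic_plane mB Bfin.
have [C C0 Q] := convol_moll_quadratic e01 ui.
have bfin : pm (box r) \is a fin_num by rewrite ge0_fin_numE // box_measure_lty.
pose K := C * fine (pm (box r)).
have K0 : 0 <= K by rewrite mulr_ge0 // fine_ge0.
exists (K * 8) => delta d01; have /andP[d0 d1] := d01.
have [mc m1 m2] := measurable_convol_partials e01 ui.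
set U := convol (moll e) \1_B in mc Q.
set F1 := convol (moll1 e) \1_B in m1 Q; set F2 := convol (moll2 e) \1_B in m2 Q.
have mb : measurable (box r : set T) by exact: measurable_box.
have mib : measurable_fun setT (\1_(box r) : T -> R) by exact: measurable_indic.
pose G (p : T * T) : \bar R :=
  (\1_(box r) p.2 * (near_weight delta (enorm p.1) * `|F1 p.2 * p.1.1 + F2 p.2 * p.1.2|))%:E.
have mG : measurable_fun setT G.
  apply/measurable_EFinP; apply: measurable_funM.
    exact: (measurableT_comp mib measurable_snd).
  apply: measurable_funM.
    exact: (measurableT_comp (measurable_near_enorm delta) measurable_fst).
  apply: measurableT_comp => //; apply: measurable_funD; apply: measurable_funM.
  - exact: (measurableT_comp m1 measurable_snd).
  - exact: (measurableT_comp (@measurable_fst _ _ _ _) measurable_fst).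
  - exact: (measurableT_comp m2 measurable_snd).
  - exact: (measurableT_comp (@measurable_snd _ _ _ _) measurable_fst).
have nw0 (z : T) : 0 <= near_weight delta (enorm z) by exact: near_weight_ge0.
have i0 (x : T) : 0 <= \1_(box r) x :> R by rewrite indicE.
have G0 p : (0 <= G p)%E by rewrite lee_fin; apply: mulr_ge0; [exact: i0|exact: mulr_ge0].
have l0 : 0 <= 4 * ln delta^-1.
  by rewrite mulr_ge0 // ln_ge0 // invf_ge1 // ltW.
have l0' : (0 <= (4 * ln delta^-1)%:E)%E by rewrite lee_fin.
have mg : measurable_fun setT (fun x : T => (grad_norm B e x)%:E).
  by apply/measurable_EFinP; exact: measurable_grad_norm.
have mgb : measurable_fun (box r) (fun x : T => (grad_norm B e x)%:E) by exact: measurable_funTS.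
have g0 (x : T) : box r x -> (0 <= (grad_norm B e x)%:E)%E by rewrite lee_fin sqrtr_ge0.
have mU1 := @measurable_near_energy R delta U mc.
have V0 := translation_diff_ge0 U.
have mn2 : measurable_fun setT (fun z : T => (near_weight delta (enorm z) * enorm z ^+ 2)%:E).
  apply/measurable_EFinP; apply: measurable_funM; first exact: measurable_near_enorm.
  by apply: measurable_funX; exact: measurable_enorm.
have n20 (z : T) : setT z -> (0 <= (near_weight delta (enorm z) * enorm z ^+ 2)%:E)%E.
  by move=> _; rewrite lee_fin mulr_ge0 // sqr_ge0.
have mn2K : measurable_fun setT (fun z : T => K%:E * (near_weight delta (enorm z) * enorm z ^+ 2)%:E)%E.
  exact: measurable_funeM.
have n20K (z : T) : setT z -> (0 <= K%:E * (near_weight delta (enorm z) * enorm z ^+ 2)%:E)%E.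
  by move=> _; rewrite mule_ge0 ?lee_fin // mulr_ge0 // sqr_ge0.
have pU (z : T) : setT z -> (0 <= (near_weight delta (enorm z))%:E * translation_diff U z)%E.
  by move=> _; rewrite mule_ge0 ?lee_fin.
apply: (@le_trans _ _ (\int[pm]_z ((near_weight delta (enorm z))%:E * translation_diff U z +
    K%:E * (near_weight delta (enorm z) * enorm z ^+ 2)%:E))%E); last first.
  have K0' : (0 <= K%:E)%E by rewrite lee_fin.
  rewrite ge0_integralD // ge0_integralZl // (EFinM K 8).
  apply: leeD; last by apply: lee_wpmul2l; [exact: K0'|exact: integral_near_weight_sqr_le].
  have mB1 : measurable_fun setT (\1_B : T -> R) by exact: measurable_indic.
  apply: ge0_le_integral => //.
  - exact: measurable_near_energy.
  - move=> z _; apply: lee_wpmul2l; first by rewrite lee_fin.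
    exact: translation_diff_conv.
rewrite -ge0_integralZl // [leLHS]integral_mkcond.
apply: (@le_trans _ _ (\int[pm]_x \int[pm]_z G (z, x))%E).
  rewrite le_eqVlt; apply/orP; left; apply/eqP; apply: eq_integral => x _.
  have ml : measurable_fun setT (fun z : T => (near_weight delta (enorm z) * `|F1 x * z.1 + F2 x * z.2|)%:E).
    apply/measurable_EFinP; apply: measurable_funM; first exact: measurable_near_enorm.
    exact: (measurableT_comp _ (measurable_dot _ _)).
  have ml0 (z : T) : setT z -> (0 <= (near_weight delta (enorm z) * `|F1 x * z.1 + F2 x * z.2|)%:E)%E.
    by move=> _; rewrite lee_fin mulr_ge0.
  have ix : (0 <= (\1_(box r) x)%:E :> \bar R)%E by rewrite lee_fin.
  rewrite /G /=; under [RHS]eq_integral do rewrite EFinM.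
  rewrite ge0_integralZl // integral_near_weight_dot // patchE indicE -!EFinM.
  by case: ifP => _; rewrite ?mul1r ?mul0r.
rewrite -(plane_tonelli mG G0).
apply: ge0_le_integral => //.
- by move=> z _; apply: integral_ge0.
- exact: (plane_measurable_F mG G0).
- exact: emeasurable_funD.
move=> z _.
have mlf : measurable_fun setT (fun x : T => `|F1 x * z.1 + F2 x * z.2|).
  by apply: measurableT_comp => //; apply: measurable_funD; apply: measurable_funM.
have mil : measurable_fun setT (fun x : T => (\1_(box r) x * `|F1 x * z.1 + F2 x * z.2|)%:E).
  by apply/measurable_EFinP; exact: measurable_funM.
have il0 (x : T) : setT x -> (0 <= (\1_(box r) x * `|F1 x * z.1 + F2 x * z.2|)%:E)%E.
  by move=> _; rewrite lee_fin mulr_ge0.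
have nwz : (0 <= (near_weight delta (enorm z))%:E)%E by rewrite lee_fin.
apply: (@le_trans _ _ ((near_weight delta (enorm z))%:E *
   \int[pm]_x (\1_(box r) x * `|F1 x * z.1 + F2 x * z.2|)%:E)%E).
  rewrite -ge0_integralZl // le_eqVlt; apply/orP; left; apply/eqP; apply: eq_integral => x _.
  by rewrite /G /= -EFinM mulrCA.
have -> : (K%:E * (near_weight delta (enorm z) * enorm z ^+ 2)%:E =
    (near_weight delta (enorm z))%:E * (K * enorm z ^+ 2)%:E :> \bar R)%E.
  by rewrite -!EFinM mulrCA.
have Kz : (0 <= (K * enorm z ^+ 2)%:E)%E by rewrite lee_fin mulr_ge0 // sqr_ge0.
rewrite -ge0_muleDr //; apply: lee_wpmul2l => //.
have mUz : measurable_fun setT (fun x : T => (`|U (x + z) - U x|)%:E).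
  apply/measurable_EFinP; apply: measurableT_comp => //; apply: measurable_funB => //.
  exact: (measurableT_comp mc (measurable_translation z)).
have Uz0 (x : T) : setT x -> (0 <= (`|U (x + z) - U x|)%:E)%E by rewrite lee_fin.
pose c : R := C * enorm z ^+ 2.
have c0 : 0 <= c by rewrite mulr_ge0 // sqr_ge0.
have mcb : measurable_fun setT (fun x : T => (c * \1_(box r) x)%:E).
  by apply/measurable_EFinP; exact: measurable_funM.
have cb0 (x : T) : setT x -> (0 <= (c * \1_(box r) x)%:E)%E.
  by move=> _; rewrite lee_fin mulr_ge0.
apply: (@le_trans _ _ (\int[pm]_x ((`|U (x + z) - U x|)%:E + (c * \1_(box r) x)%:E))%E).
  apply: ge0_le_integral => //; first exact: emeasurable_funD.
  move=> x _; rewrite -EFinD lee_fin indicE; case: (x \in box r); last first.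
    by rewrite mul0r mulr0 addr0.
  rewrite mul1r mulr1; have := Q x z; rewrite -/(linear_form _ _ _).
  have Cz : C * `|z : (R * R)%type| ^+ 2 <= c.
    by apply: ler_wpM2l => //; exact: prod_norm_sqr_le.
  rewrite /linear_form; move: (U (x + z)) (U x) (F1 x * z.1 + F2 x * z.2) => a b l H.
  have -> : l = (a - b) - (a - b - l) by ring.
  by rewrite (le_trans (ler_normB _ _)) // lerD2l (le_trans H).
rewrite ge0_integralD //; apply: leeD; first exact: lexx.
under eq_integral do rewrite EFinM.
have mibE : measurable_fun setT (fun x : T => (\1_(box r) x : R)%:E) by exact/measurable_EFinP.
have ib0 (x : T) : setT x -> (0 <= (\1_(box r) x : R)%:E)%E by rewrite lee_fin.
have c0' : (0 <= c%:E)%E by rewrite lee_fin.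
rewrite ge0_integralZl //.
rewrite integral_indic // setIT [X in (_ * X <= _)%E](esym (fineK bfin)) -EFinM lee_fin /c /K.
by rewrite mulrAC.
Qed.

End nonlocal_lower_bound.

(** * From a test field to the nonlocal term *)

Section field_lower_bound.
Context {R : realType}.
Local Notation mu := (@lebesgue_measure R).
Local Notation T := (measurableTypeR R * measurableTypeR R)%type.
Local Notation pm := (mu \x mu)%E.
Implicit Types (e r delta : R) (B : set T) (phi : R * R -> R * R) (U p : R * R -> R).

Lemma C1c_field_box phi : C1c_field phi -> exists r, forall y, ~ box r y -> phi y = 0.
Proof.
case=> _ _ /compact_bounded[M [_ /(_ (M + 1))]]; rewrite ltrDl ltr01 => /(_ isT) H.
exists (M + 1) => y ny; apply/eqP; apply: contrapT => /negP nz; apply: ny.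
have yM : `|y| <= M + 1 by apply: H; exact: subset_closure.
apply/boxP; split; first exact: le_trans (prod_norm_le1 y) yM.
exact: le_trans (prod_norm_le2 y) yM.
Qed.

Lemma continuous_div phi : C1c_field phi -> continuous (div phi).
Proof.
move=> [[_ c1 _] [_ _ c2] _] x; rewrite /div.
by apply: cvgD; [exact: c1|exact: c2].
Qed.

Lemma div_zero_box phi r x : (forall y, ~ box r y -> phi y = 0) -> ~ box r x ->
  div phi x = 0.
Proof.
move=> phi0 nx; rewrite /div.
rewrite (@derive_zero_box _ (fun y => (phi y).1) r) //; last by move=> y /phi0 ->.
by rewrite (@derive_zero_box _ (fun y => (phi y).2) r) ?addr0 // => y /phi0 ->.
Qed.

Lemma bounded_div phi : C1c_field phi -> exists2 M : R, 0 <= M & forall x, `|div phi x| <= M.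
Proof.
move=> Hphi; have [r phi0] := C1c_field_box Hphi.
apply: (@bounded_continuous_box _ _ r); first exact: continuous_div.
by move=> y; exact: div_zero_box.
Qed.

(** The first hypothesis is the divergence theorem in direction [v]; keeping it abstract lets both
    coordinate directions share one proof. Only [p] has compact support, which suffices for the
    product [U * p]. *)
Let parts v U p r :
  (forall g, (forall x, differentiable g x) -> continuous (fun x => 'D_v g x) ->
     (forall y, ~ box r y -> g y = 0) -> (\int[pm]_x ('D_v g x)%:E = 0)%E) ->
  (forall x, differentiable U x) -> continuous (fun x => 'D_v U x) ->
  (forall x, differentiable p x) -> continuous (fun x => 'D_v p x) ->
  (forall y, ~ box r y -> p y = 0) ->
  [/\ pm.-integrable setT (EFin \o ((fun x => U x * 'D_v p x) : T -> R)),
    pm.-integrable setT (EFin \o ((fun x => p x * 'D_v U x) : T -> R)) &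
    (\int[pm]_x (U x * 'D_v p x))%R = - (\int[pm]_x (p x * 'D_v U x))%R].
Proof.
move=> H dU cU dp cp p0.
have contU : continuous U by move=> x; exact: differentiable_continuous.
have contp : continuous p by move=> x; exact: differentiable_continuous.
have c1 : continuous (fun x => U x * 'D_v p x).
  by move=> x; apply: cvgM; [exact: contU|exact: cp].
have c2 : continuous (fun x => p x * 'D_v U x).
  by move=> x; apply: cvgM; [exact: contp|exact: cU].
have i1 : pm.-integrable setT (EFin \o ((fun x => U x * 'D_v p x) : T -> R)).
  apply: (@integrable_continuous_box _ _ r) => // y ny.
  by rewrite (@derive_zero_box _ p r) // mulr0.
have i2 : pm.-integrable setT (EFin \o ((fun x => p x * 'D_v U x) : T -> R)).
  by apply: (@integrable_continuous_box _ _ r) => // y ny; rewrite p0 // mul0r.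
split=> //.
have DE x : 'D_v (U * p) x = U x * 'D_v p x + p x * 'D_v U x.
  by rewrite deriveM //; exact: diff_derivable.
have I0 : (\int[pm]_x ('D_v (U * p) x)%:E = 0)%E.
  apply: H => [x||y ny].
  - exact: differentiableM.
  - rewrite (_ : (fun x => 'D_v (U * p) x) = (fun x => U x * 'D_v p x + p x * 'D_v U x)); last exact/funext.
    by move=> x; apply: cvgD; [exact: c1|exact: c2].
  - by change (U y * p y = 0); rewrite p0 // mulr0.
apply/eqP; rewrite -subr_eq0 opprK -RintegralD //; apply/eqP.
transitivity (fine (\int[pm]_x ('D_v (U * p) x)%:E)%E); last by rewrite I0.
by congr fine; apply: eq_integral => x _; rewrite DE.
Qed.

(* Mollifying the indicator at a small scale costs at most eta; integration by
   parts then leaves the mollified gradient on the support of the field. *)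
Lemma div_le_grad_norm B phi (eta : R) : measurable B -> (pm B < +oo)%E ->
  C1c_field phi -> (forall x, enorm (phi x) <= 1) -> 0 < eta ->
  exists e r, 0 < e <= 1 /\
    ((\int[pm]_(x in B) div phi x - eta)%R%:E <= \int[pm]_(x in box r) (grad_norm B e x)%:E)%E.
Proof.
move=> mB Bfin Hphi phi1 eta0; have ui := integrable_indic_plane mB Bfin.
have [M M0 dM] := bounded_div Hphi; have [r phi0] := C1c_field_box Hphi.
have M10 : 0 < M + 1 by rewrite ltr_wpDl.
(* As [|div phi| <= M], an [L^1] error of [eta / (M + 1)] changes the flux by at most [eta]; the
   added 1 covers [M = 0]. *)
have [e e01 small] := translation_diff_indic_small mB Bfin (divr_gt0 eta0 M10).
exists e, r; split=> //.
have dist := mollified_dist_le mB Bfin e01 (ltW (divr_gt0 eta0 M10)) small.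
have [C [C0 kK]] := moll_kernel e01.
have [[dU cU1 cU2] E1 E2] := conv_C1 kK ui.
have [mc m1 m2] := measurable_convol_partials e01 ui.
have [[d1 c1 _] [d2 _ c2] _] := Hphi.
have p10 y : ~ box r y -> (phi y).1 = 0 by move=> /phi0 ->.
have p20 y : ~ box r y -> (phi y).2 = 0 by move=> /phi0 ->.
have [i1 j1 P1] := parts (fun g a b c => @integral_derive_compact1 R g r a b c) dU cU1 d1 c1 p10.
have [i2 j2 P2] := parts (fun g a b c => @integral_derive_compact2 R g r a b c) dU cU2 d2 c2 p20.
have cq := continuous_div Hphi.
have iq : pm.-integrable setT (EFin \o (div phi : T -> R)).
  by apply: (@integrable_continuous_box _ _ r) => // y; exact: div_zero_box.
have mq := plane_continuous_measurable cq.
set u : T -> R := \1_B in ui dist *; set U := convol (moll e) u in dist mc *.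
have iuq := integrable_mul_bounded mq dM ui.
have iUq : pm.-integrable setT (EFin \o ((fun x => U x * div phi x) : T -> R)).
  have := integrableD measurableT i1 i2; apply: eq_integrable => // x _ /=.
  by rewrite -EFinD -mulrDr.
have IB : (\int[pm]_(x in B) div phi x)%R = (\int[pm]_x (u x * div phi x))%R.
  rewrite /Rintegral; congr fine; rewrite integral_mkcond; apply: eq_integral => x _.
  by rewrite patchE /u indicE; case: ifP => _; rewrite ?mul1r ?mul0r.
have A : (\int[pm]_x (u x * div phi x))%R - eta <= (\int[pm]_x (U x * div phi x))%R.
  rewrite lerBlDr -lerBlDl -RintegralB //.
  have mdist : measurable_fun setT (fun x : T => (`|U x - u x|)%:E).
    apply/measurable_EFinP; apply: measurableT_comp => //; apply: measurable_funB => //.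
    exact: measurable_integrable ui.
  have idist : pm.-integrable setT (EFin \o (fun x : T => `|U x - u x|)).
    apply/integrableP; split; first exact: mdist.
    under eq_integral do rewrite /= normr_id.
    by rewrite (le_lt_trans dist) // ltry.
  apply: (@le_trans _ _ (\int[pm]_x (M * `|U x - u x|))%R).
    apply: le_Rintegral => //.
    - exact: (integrableB measurableT iuq iUq).
    - exact: (integrableZl measurableT M idist).
    - move=> x _; rewrite -mulrBl (le_trans (ler_norm _)) // normrM mulrC distrC.
      exact: ler_wpM2r.
  rewrite RintegralZl // (@le_trans _ _ (M * (eta / (M + 1)))) //.
    apply: ler_wpM2l => //; rewrite -lee_fin /Rintegral fineK //.
    exact: integrable_fin_num idist.
  by rewrite mulrCA ler_piMr ?(ltW eta0) // ler_pdivrMr // mul1r lerDl.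
have B2 : (\int[pm]_x (U x * div phi x))%R =
    (\int[pm]_x (- ((phi x).1 * convol (moll1 e) u x + (phi x).2 * convol (moll2 e) u x)))%R.
  have k1 : pm.-integrable setT (EFin \o (fun x : T => (phi x).1 * convol (moll1 e) u x)).
    by move: j1; rewrite -E1.
  have k2 : pm.-integrable setT (EFin \o (fun x : T => (phi x).2 * convol (moll2 e) u x)).
    by move: j2; rewrite -E2.
  transitivity ((\int[pm]_x (U x * 'D_(1, 0) (fun y => (phi y).1) x))%R +
      (\int[pm]_x (U x * 'D_(0, 1) (fun y => (phi y).2) x))%R).
    by rewrite -RintegralD //; apply: eq_Rintegral => x _; rewrite -mulrDr.
  rewrite P1 P2 -opprD.
  under [RHS]eq_Rintegral do rewrite -mulN1r.
  rewrite RintegralZl ?RintegralD // ?mulN1r; last exact: (integrableD measurableT k1 k2).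
  by rewrite -E1 -E2.
have jn : pm.-integrable setT (EFin \o (fun x : T =>
    - ((phi x).1 * convol (moll1 e) u x + (phi x).2 * convol (moll2 e) u x))).
  have := integrableN (integrableD measurableT j1 j2); apply: eq_integrable => // x _ /=.
  by rewrite -E1 -E2.
have mN : measurable_fun setT (fun x : T => (grad_norm B e x)%:E).
  by apply/measurable_EFinP; exact: measurable_grad_norm.
apply: (@le_trans _ _ (\int[pm]_x (- ((phi x).1 * convol (moll1 e) u x +
    (phi x).2 * convol (moll2 e) u x))%:E)%E).
  rewrite -[leRHS]fineK; last exact: integrable_fin_num jn.
  by rewrite lee_fin IB (le_trans A) // B2.
apply: (le_trans (lee_abs _)); apply: (le_trans (le_abse_integral _ _ _)) => //.
  exact: measurable_int jn.
rewrite [leRHS]integral_mkcond; apply: ge0_le_integral => //.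
- by apply: measurableT_comp => //; exact: measurable_int jn.
- by apply/(measurable_restrictT _ _).1 => //; [exact: measurable_box|exact: measurable_funTS].
move=> x _; rewrite patchE; case: ifPn => [_|/negP nx]; last first.
  rewrite phi0; last by move/mem_set.
  by rewrite !mul0r addr0 oppr0 abse0; exact: lexx.
rewrite lee_fin normrN -[leRHS]ger0_norm ?sqrtr_ge0 // -ler_sqr ?nnegrE //.
rewrite !real_normK ?num_real // /grad_norm sqr_sqrtr ?addr_ge0 ?sqr_ge0 //.
have := phi1 x; rewrite /enorm -(@ler_sqr _ _ 1) ?nnegrE ?sqrtr_ge0 // expr1n.
rewrite sqr_sqrtr ?addr_ge0 ?sqr_ge0 //.
move: (phi x).1 (phi x).2 (convol _ _ _) (convol _ _ _) => a b d c H.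
have cd0 : 0 <= c ^+ 2 + d ^+ 2 by rewrite addr_ge0 ?sqr_ge0.
apply: (@le_trans _ _ ((a ^+ 2 + b ^+ 2) * (c ^+ 2 + d ^+ 2))); last by rewrite -[leRHS]mul1r ler_wpM2r.
rewrite -subr_ge0 (_ : _ - _ = (a * d - b * c) ^+ 2) ?sqr_ge0 //; ring.
Qed.

Lemma plane_nonlocal_ge B phi (eta : R) : measurable B -> (pm B < +oo)%E ->
  C1c_field phi -> (forall x, enorm (phi x) <= 1) -> 0 < eta ->
  exists C : R, forall delta, 0 < delta < 1 ->
    ((4 * ln delta^-1 * (\int[pm]_(x in B) div phi x - eta)%R)%:E <=
     plane_nonlocal delta B + C%:E)%E.
Proof.
move=> mB Bfin Hphi phi1 eta0.
have [e [r [e01 H]]] := div_le_grad_norm mB Bfin Hphi phi1 eta0.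
have [C HC] := grad_norm_le_near_energy r mB Bfin e01.
exists C => delta d01; have /andP[d0 d1] := d01.
have l0 : 0 <= 4 * ln delta^-1.
  by rewrite mulr_ge0 // ln_ge0 // invf_ge1 // ltW.
rewrite EFinM; apply: (le_trans (lee_wpmul2l _ H)); first by rewrite lee_fin.
apply: (le_trans (HC _ d01)); apply: leeD; last exact: lexx.
exact: near_energy_le_nonlocal.
Qed.

End field_lower_bound.

(** * Transfer to Lebesgue measurable sets *)

Section lebesgue_transfer.
Context {R : realType}.
Local Notation mu := (@lebesgue_measure R).
Local Notation T := (measurableTypeR R * measurableTypeR R)%type.
Local Notation pm := (mu \x mu)%E.
Implicit Types (delta : R) (B N X : set (R * R)).

Definition borel_version X B N := [/\ measurable (B : set T), measurable (N : set T),
  pm N = 0%E & forall x, ~ N x -> (X x <-> B x)].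

Lemma borel_versionP X : lebesgue_measurable X -> (leb2 R X < +oo)%E ->
  exists B N, borel_version X B N.
Proof.
move=> mX Xoo.
by have [B [N [? ? ? ?]]] := completed_measurable_version mX Xoo; exists B, N.
Qed.

(** The measure [leb2] is complete, so [f], which agrees with a Borel function off a null set, is
    measurable and has the same integral. *)
Lemma ge0_integral_leb2_ae (f g : T -> \bar R) N : measurable (N : set T) -> pm N = 0%E ->
  measurable_fun setT g -> (forall x, 0 <= f x)%E -> (forall x, 0 <= g x)%E ->
  (forall x, ~ N x -> f x = g x) -> (\int[leb2 R]_x f x = \int[pm]_x g x)%E.
Proof.
move=> mN N0 mg f0 g0 fg.
have mgI := @measurable_fun_completed _ _ _ (borel_plane_measure R) _ mg.
have ae : ae_eq (leb2 R) setT (g : lplane R -> \bar R) f.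
  exists N; split.
  - exact: caratheodory_of_measurable.
  - exact: etrans (@completed_measureE _ _ _ (borel_plane_measure R) _ mN) N0.
  - by move=> x /= H; apply: contrapT => nx; apply: H => _; rewrite fg.
have cmp : measure_is_complete (leb2 R) by exact: measure_is_complete_caratheodory.
have mf := ae_measurable_fun cmp ae mgI.
rewrite -(@ge0_ae_eq_integral _ _ _ (leb2 R) setT _ _ measurableT mgI mf) //.
exact: (@ge0_integral_completed _ _ _ (borel_plane_measure R)).
Qed.

Lemma leb2_version X B N : lebesgue_measurable X -> borel_version X B N -> leb2 R X = pm B.
Proof.
move=> mX [mB mN N0 XB].
have := @ge0_integral_version _ _ _ (borel_plane_measure R) X B N (cst 1%E) mX mB mN N0 XB.
by rewrite !integral_cst // !mul1e; apply.
Qed.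

Lemma integral_div_version X B N phi : lebesgue_measurable X -> borel_version X B N ->
  C1c_field phi -> (\int[leb2 R]_(x in X) (div phi x)%:E = \int[pm]_(x in B) (div phi x)%:E)%E.
Proof.
move=> mX [mB mN N0 XB] Hphi.
apply: (@integral_version _ _ _ (borel_plane_measure R) X B N _ mX mB mN N0 XB).
apply/measurable_EFinP; apply: plane_continuous_measurable; exact: continuous_div.
Qed.

Lemma perimeter_version X B N : lebesgue_measurable X -> borel_version X B N ->
  perimeter X = plane_perimeter B.
Proof.
move=> mX XB; congr ereal_sup; apply: eq_imagel => phi [Hphi _].
exact: integral_div_version mX XB Hphi.
Qed.

Lemma measurable_cutoff delta :
  measurable_fun setT (fun z : T => cutoff delta (enorm z) / enorm z ^+ 3).
Proof.
have m1 : measurable_fun setT (\1_(`]1, +oo[%classic : set R) : R -> R).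
  exact: measurable_indic.
apply: measurable_funM; last exact: (measurableT_comp (measurable_exprnV 3) measurable_enorm).
apply: (measurableT_comp m1); apply: measurable_funM => //; exact: measurable_enorm.
Qed.

Lemma indic_dist_sqr B (x y : R * R) :
  `|\1_B x - \1_B y : R| ^+ 2 = `|\1_B x - \1_B y : R|.
Proof.
by rewrite !indicE; case: (x \in B); case: (y \in B);
  rewrite ?subrr ?subr0 ?sub0r ?normrN ?normr0 ?normr1 ?expr1n ?expr0n.
Qed.

(** For [x] outside [N] the inner integrands agree unless [x + z] lies in [N], that is, off a
    translate of [N], which is again null. Thus the inner integrals agree for almost every [x], and
    Tonelli's theorem is used only for the Borel set [B]. *)
Lemma nonlocal_version delta X B N : lebesgue_measurable X -> borel_version X B N ->
  nonlocal_term delta X = plane_nonlocal delta B.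
Proof.
move=> mX [mB mN N0 XB].
pose w (z : T) : R := cutoff delta (enorm z) / enorm z ^+ 3.
have w0 z : 0 <= w z.
  by rewrite mulr_ge0 ?invr_ge0 ?exprn_ge0 ?sqrtr_ge0 // /cutoff indicE.
have mw : measurable_fun setT w by exact: measurable_cutoff.
have mu1 : measurable_fun setT (\1_B : T -> R) by exact: measurable_indic.
pose G (p : T * T) : \bar R := (`|\1_B (p.1 + p.2) - \1_B p.1 : R| * w p.2)%:E.
have mG : measurable_fun setT G.
  apply/measurable_EFinP; apply: measurable_funM.
    apply: measurableT_comp => //; apply: measurable_funB.
      exact: (measurableT_comp mu1 measurable_addT).
    exact: (measurableT_comp mu1 measurable_fst).
  exact: (measurableT_comp mw measurable_snd).
have G0 p : (0 <= G p)%E by rewrite lee_fin mulr_ge0.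
have XBE x : ~ N x -> \1_X x = \1_B x :> R.
  move=> /XB [XB1 XB2]; rewrite !indicE; congr (_%:R : R); congr nat_of_bool.
  by apply/idP/idP => /set_mem H; apply/mem_set; [exact: XB1|exact: XB2].
have inner x : ~ N x ->
    (\int[leb2 R]_z (`|\1_X (x + z) - \1_X x| ^+ 2 * (cutoff delta (enorm z) / enorm z ^+ 3))%:E =
     \int[pm]_z G (x, z))%E.
  move=> nx.
  pose Nx : set T := (fun z : T => z + x) @^-1` N.
  have mNx : measurable Nx.
    by rewrite -[X in measurable X]setTI; exact: (measurable_translation x).
  have Nx0 : pm Nx = 0%E by rewrite /Nx -plane_measure_translation.
  apply: (@ge0_integral_leb2_ae _ _ Nx) => //.
  - have mp : measurable_fun setT (fun z : T => (x : T, z)) by exact: measurable_fun_pair.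
    exact: (measurableT_comp mG mp).
  - by move=> z; rewrite lee_fin mulr_ge0 ?exprn_ge0 ?w0.
  - move=> z nz; have nxz : ~ N (x + z) by rewrite addrC.
    by rewrite /G /= (XBE _ nx) (XBE _ nxz) indic_dist_sqr.
rewrite /nonlocal_term (@ge0_integral_leb2_ae _ (fun x => \int[pm]_z G (x, z))%E N) //.
- rewrite (plane_tonelli mG G0); apply: eq_integral => z _.
  have md : measurable_fun setT (fun x : T => (`|\1_B (x + z) - \1_B x : R|)%:E).
    apply/measurable_EFinP; apply: measurableT_comp => //; apply: measurable_funB => //.
    exact: (measurableT_comp mu1 (measurable_translation z)).
  have d0 (x : T) : setT x -> (0 <= (`|\1_B (x + z) - \1_B x : R|)%:E)%E by rewrite lee_fin.
  have wz : (0 <= (w z)%:E)%E by rewrite lee_fin.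
  rewrite /translation_diff -ge0_integralZl //; apply: eq_integral => x _.
  by rewrite /G /= -EFinM mulrC.
- exact: (plane_measurable_F mG G0).
- by move=> x; apply: integral_ge0 => z _; rewrite lee_fin mulr_ge0 ?exprn_ge0 ?w0.
- by move=> x; apply: integral_ge0.
Qed.

End lebesgue_transfer.

(** * Limits inferior and superior, and the decay of [1 / |log delta|] *)

Section extended_limits.
Context {R : realType}.
Implicit Types (u v : nat -> \bar R) (l : \bar R).

Lemma le_limn_einf u v l : (forall n, v n <= u n)%E -> v n @[n --> \oo] --> l ->
  (l <= limn_einf u)%E.
Proof.
move=> vu /cvg_limn_einf_sup[<- _]; rewrite !limn_einf_lim.
apply: lee_lim; [exact/is_cvg_einfs|exact/is_cvg_einfs|apply: nearW => n].
apply: le_ereal_inf_tmp => _ [k /= nk <-]; apply: le_trans (vu k).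
by apply: ereal_inf_lbound; exists k.
Qed.

Lemma limn_esup_le u v l : (forall n, u n <= v n)%E -> v n @[n --> \oo] --> l ->
  (limn_esup u <= l)%E.
Proof.
move=> uv vl; rewrite -leeN2 -limn_einfN.
apply: (@le_limn_einf _ (fun n => - v n)%E); first by move=> n; rewrite leeN2.
exact: cvgeN.
Qed.

Lemma ln_inv_cvg0 (delta : nat -> R) : vanishing delta ->
  (ln (delta n)^-1)^-1 @[n --> \oo] --> 0.
Proof.
move=> [d01 d0]; apply/cvgrPdist_lt => /= e e0.
(* The condition [delta < exp (- 1/e)] is equivalent to [1 / ln (1 / delta) < e] when
   [delta < 1]. *)
have := (cvgrPdist_lt _ _).1 d0 (expR (- e^-1)) (expR_gt0 _).
move=> H0; near=> n; have : `|0 - delta n| < expR (- e^-1) by near: n; exact: H0.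
rewrite !sub0r !normrN; have /andP[dn0 dn1] := d01 n.
have dlt1 : delta n < 1 by lra.
have L0 : 0 < ln (delta n)^-1 by rewrite ln_gt0 // invf_gt1.
rewrite !gtr0_norm ?invr_gt0 // => H.
rewrite invf_plt ?posrE // lnV ?posrE // ltrNr -ltr_expR lnK ?posrE //.
Unshelve. all: by end_near. Qed.

End extended_limits.

(** * Stability of integrals under small changes of the domain *)

Section set_integrals.
Context d (T : measurableType d) (R : realType) (nu : {measure set T -> \bar R}).

Lemma Rintegral_set_dist_le (A B : set T) (q : T -> R) (M : R) : measurable A ->
  measurable B -> (nu A < +oo)%E -> (nu B < +oo)%E -> measurable_fun setT q ->
  (forall x, `|q x| <= M) ->
  `|(\int[nu]_(x in A) q x)%R - (\int[nu]_(x in B) q x)%R| <= M * fine (nu (A `+` B)).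
Proof.
move=> mA mB Afin Bfin mq qM.
have H D : measurable D -> (nu D < +oo)%E -> nu.-integrable setT (EFin \o (q \_ D)).
  move=> mD Dfin; have iD : nu.-integrable setT (EFin \o (\1_D : T -> R)).
    apply/integrableP; split; first by apply/measurable_EFinP; exact: measurable_indic.
    under eq_integral do rewrite /= ger0_norm //.
    by rewrite integral_indic // setIT.
  have iMD := @integrableZl _ _ _ _ _ measurableT M _ iD.
  apply: (le_integrable measurableT _ _ iMD).
    by apply/measurable_EFinP; apply/(measurable_restrictT _ _).1 => //; exact: measurable_funTS.
  move=> x _ /=; rewrite lee_fin patchE indicE; case: ifP => _; last first.
    by rewrite mulr0; exact: lexx.
  by rewrite mulr1 (le_trans (qM x)) // ler_norm.
have mY : measurable (A `+` B) by rewrite setY_def; apply: measurableU; exact: measurableD.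
have Yfin : (nu (A `+` B) < +oo)%E.
  apply: (@le_lt_trans _ _ (nu (A `|` B))).
    by apply: le_measure; rewrite ?inE //; [exact: measurableU|move=> x [[? _]|[? _]]; [left|right]].
  by rewrite (le_lt_trans (measureU2 _ mA mB)) // lte_add_pinfty.
have iY : nu.-integrable setT (EFin \o (\1_(A `+` B) : T -> R)).
  apply/integrableP; split; first by apply/measurable_EFinP; exact: measurable_indic.
  under eq_integral do rewrite /= ger0_norm //.
  by rewrite integral_indic // setIT.
have iA := H A mA Afin; have iB := H B mB Bfin.
rewrite Rintegral_mkcond [X in _ - X]Rintegral_mkcond -RintegralB //.
apply: (le_trans (le_normr_Rintegral measurableT (integrableB measurableT iA iB))).
apply: (@le_trans _ _ (\int[nu]_x (M * \1_(A `+` B) x))%R); last first.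
  by rewrite RintegralZl // /Rintegral integral_indic // setIT.
apply: le_Rintegral => //.
- exact: (integrable_abse (integrableB measurableT iA iB)).
- exact: (integrableZl measurableT M iY).
move=> x _ /=; rewrite !patchE indicE setY_def in_setU !in_setD.
by case: (x \in A); case: (x \in B); rewrite /= ?subrr ?normr0 ?mulr0 ?mulr1 ?subr0 ?sub0r ?normrN ?qM.
Qed.

End set_integrals.

(** * Bounds for the energy on admissible sets *)

Section energy_bounds.
Context {R : realType}.
Local Notation mu := (@lebesgue_measure R).
Local Notation T := (measurableTypeR R * measurableTypeR R)%type.
Local Notation pm := (mu \x mu)%E.
Implicit Types (lambda delta m eta : R) (Omega : set (R * R)) (phi : R * R -> R * R).

Let flux Omega phi : R := (\int[leb2 R]_(x in Omega) div phi x)%R.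

Let field_ball phi := C1c_field phi /\ forall x, enorm (phi x) <= 1.

Lemma admissible_borel m Omega : admissible m Omega ->
  exists2 B, pm B = m%:E & exists N, borel_version Omega B N.
Proof.
move=> [mO _ Om]; have [|B [N BN]] := borel_versionP mO; first by rewrite Om ltry.
by exists B; [rewrite -(leb2_version mO BN)|exists N].
Qed.

Lemma perimeter_ge0 Omega : (0 <= perimeter Omega)%E.
Proof.
apply: ereal_sup_ubound; exists (cst 0); last first.
  apply: integral0_eq => x _; rewrite /div.
  by rewrite (derive_cst (0 : R)) (derive_cst (0 : R)) addr0.
have C10 : C1 (fun _ : R * R => 0 : R).
  have D0 v : (fun x => 'D_v (fun _ : R * R => 0 : R) x) = cst 0.
    by apply/funext => x; rewrite (derive_cst (0 : R)).
  split; first by move=> x; exact: differentiable_cst.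
    by rewrite D0; exact: cst_continuous.
  by rewrite D0; exact: cst_continuous.
split; first exact: (@C1c_field_of_box _ _ 0).
by move=> x; rewrite /enorm /= expr0n addr0 sqrtr0.
Qed.

Lemma admissible_perimeter_fin m Omega : admissible m Omega -> perimeter Omega \is a fin_num.
Proof. by move=> [_ Pfin _]; rewrite ge0_fin_numE // perimeter_ge0. Qed.

Lemma admissible_integral_div m Omega phi : admissible m Omega -> C1c_field phi ->
  (\int[leb2 R]_(x in Omega) (div phi x)%:E = (flux Omega phi)%:E)%E.
Proof.
move=> HO Hphi; have [mO _ _] := HO; have [B Bm [N BN]] := admissible_borel HO.
rewrite /flux /Rintegral fineK // (integral_div_version mO BN Hphi).
have [mB _ _ _] := BN.
have Bfin : (pm B < +oo)%E by rewrite Bm ltry.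
have [M M0 dM] := bounded_div Hphi.
have mq := plane_continuous_measurable (continuous_div Hphi).
rewrite integral_mkcond; apply: integrable_fin_num; first exact: measurableT.
have := integrable_mul_bounded mq dM (integrable_indic_plane mB Bfin).
apply: eq_integrable => // x _; rewrite patchE indicE.
by case: ifP => _; rewrite ?mul1r ?mul0r.
Qed.

Lemma admissible_flux_le m Omega phi : admissible m Omega -> field_ball phi ->
  ((flux Omega phi)%:E <= perimeter Omega)%E.
Proof.
move=> HO [Hphi phi1]; rewrite -(admissible_integral_div HO Hphi).
by apply: ereal_sup_ubound; exists phi.
Qed.

Lemma admissible_flux_adherent m Omega eta : admissible m Omega -> 0 < eta ->
  exists2 phi, field_ball phi & fine (perimeter Omega) - eta < flux Omega phi.
Proof.
move=> HO eta0; have Pfin := admissible_perimeter_fin HO.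
have [_ [phi Hphi <-]] := ub_ereal_sup_adherent eta0 Pfin.
rewrite (admissible_integral_div HO Hphi.1) -/(perimeter Omega) -{1}(fineK Pfin) -EFinB lte_fin.
by exists phi.
Qed.

Lemma abs_ln_lt1 delta : 0 < delta < 1 -> `|ln delta| = ln delta^-1 /\ 0 < ln delta^-1.
Proof.
move=> d01; have /andP[d0 d1] := d01.
by rewrite lnV ?posrE // ltr0_norm ?ln_lt0 // oppr_gt0 ln_lt0.
Qed.

Lemma admissible_nonlocal_le m Omega delta : admissible m Omega -> 0 < delta < 1 ->
  (nonlocal_term delta Omega <=
   (4 * ln delta^-1 * fine (perimeter Omega) + 16 * m)%:E)%E.
Proof.
move=> HO d01; have [mO _ _] := HO; have [B Bm [N BN]] := admissible_borel HO.
rewrite (nonlocal_version _ mO BN) (perimeter_version mO BN).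
have [mB _ _ _] := BN.
have Bfin : (pm B < +oo)%E by rewrite Bm ltry.
have Pfin := admissible_perimeter_fin HO; rewrite (perimeter_version mO BN) in Pfin.
apply: (le_trans (plane_nonlocal_le mB Bfin d01)).
by rewrite [X in (_ + _ * X)%E]Bm [leRHS]EFinD (EFinM (4 * _)) (EFinM 16) (fineK Pfin).
Qed.

Lemma admissible_nonlocal_fin m Omega delta : admissible m Omega -> 0 < delta < 1 ->
  nonlocal_term delta Omega \is a fin_num.
Proof.
move=> HO d01; rewrite ge0_fin_numE; first exact: le_lt_trans (admissible_nonlocal_le HO d01) (ltry _).
apply: integral_ge0 => x _; apply: integral_ge0 => z _; rewrite lee_fin.
by rewrite !mulr_ge0 ?exprn_ge0 ?invr_ge0 ?exprn_ge0 ?sqrtr_ge0 // /cutoff indicE.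
Qed.

Lemma admissible_energyE lambda m Omega delta : admissible m Omega -> 0 < delta < 1 ->
  energy lambda delta Omega = (fine (perimeter Omega) -
    lambda / (4 * ln delta^-1) * fine (nonlocal_term delta Omega))%:E.
Proof.
move=> HO d01; rewrite /energy (abs_ln_lt1 d01).1 [RHS]EFinB (EFinM _ (fine _)).
by rewrite !fineK ?(admissible_perimeter_fin HO) ?(admissible_nonlocal_fin HO).
Qed.

(** The flux stands in for the perimeter because it is continuous under [L^1] convergence; this
    replacement uses [1 - lambda >= 0]. The error is [lambda / (4 L) * 16 m] with
    [L = ln (1 / delta)]. *)
Lemma energy_ge lambda m Omega delta phi : 0 < lambda < 1 -> 0 < delta < 1 ->
  admissible m Omega -> field_ball phi ->
  (((1 - lambda) * flux Omega phi - 4 * lambda * m * (ln delta^-1)^-1)%:E <=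
   energy lambda delta Omega)%E.
Proof.
move=> /andP[l0 l1] d01 HO Hphi; rewrite (admissible_energyE _ HO d01) lee_fin.
have := admissible_flux_le HO Hphi; rewrite -(fineK (admissible_perimeter_fin HO)) lee_fin.
have := admissible_nonlocal_le HO d01; rewrite -(fineK (admissible_nonlocal_fin HO d01)) lee_fin.
have [_ L0] := abs_ln_lt1 d01.
move: (ln _) L0 (fine (perimeter _)) (fine (nonlocal_term _ _)) (flux _ _) => L L0 p n D nle Dp.
have c0 : 0 <= lambda / (4 * L) by rewrite divr_ge0 ?(ltW l0) // mulr_ge0 // ltW.
have H1 := ler_wpM2l c0 nle.
have E : lambda / (4 * L) * (4 * L * p + 16 * m) = lambda * p + 4 * lambda * m * L^-1.
  by field; rewrite gt_eqF.
have H2 : (1 - lambda) * D <= (1 - lambda) * p by apply: ler_wpM2l => //; lra.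
apply: (le_trans (lerB H2 (lexx _))); rewrite mulrBl mul1r -addrA lerD2l -opprD lerN2.
by rewrite -E.
Qed.

(** Half of [eta] is spent on choosing a nearly optimal field, half on mollifying the indicator. The
    constant [C] depends on both choices, which precede [delta]. *)
Lemma energy_le lambda m Omega eta : 0 < lambda < 1 -> admissible m Omega -> 0 < eta ->
  exists C : R, forall delta, 0 < delta < 1 ->
    (energy lambda delta Omega <=
     ((1 - lambda) * fine (perimeter Omega) + eta + C * (ln delta^-1)^-1)%:E)%E.
Proof.
move=> /andP[l0 l1] HO eta0.
have [mO _ _] := HO; have [B Bm [N BN]] := admissible_borel HO; have [mB _ _ _] := BN.
have Bfin : (pm B < +oo)%E by rewrite Bm ltry.
have e20 : 0 < eta / 2 by rewrite divr_gt0.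
have [phi [Hphi phi1] Dp] := admissible_flux_adherent HO e20.
have [C HC] := plane_nonlocal_ge mB Bfin Hphi phi1 e20.
exists (lambda * C / 4) => delta d01; rewrite (admissible_energyE _ HO d01) lee_fin.
have FE : (\int[pm]_(x in B) div phi x)%R = flux Omega phi.
  by rewrite /flux /Rintegral (integral_div_version mO BN Hphi).
have nge : 4 * ln delta^-1 * (flux Omega phi - eta / 2) <= fine (nonlocal_term delta Omega) + C.
  rewrite -lee_fin EFinD (fineK (admissible_nonlocal_fin HO d01)) (nonlocal_version _ mO BN) -FE.
  exact: HC.
have [_ L0] := abs_ln_lt1 d01.
move: (ln _) (fine (perimeter _)) (fine (nonlocal_term _ _)) (flux _ _) L0 Dp nge => L p n D L0 Dp nge.
have c0 : 0 <= lambda / (4 * L) by rewrite divr_ge0 ?(ltW l0) // mulr_ge0 // ltW.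
have H1 := ler_wpM2l c0 nge.
have E1 : lambda / (4 * L) * (4 * L * (D - eta / 2)) = lambda * (D - eta / 2).
  by field; rewrite gt_eqF.
have E2 : lambda / (4 * L) * (n + C) = lambda / (4 * L) * n + lambda * C / 4 * L^-1.
  by field; rewrite gt_eqF.
have H2 : lambda * (p - eta) <= lambda * (D - eta / 2) by apply: ler_wpM2l; [exact: ltW|lra].
have H3 : lambda * eta <= eta by rewrite ler_piMl // ltW.
rewrite E1 E2 in H1; rewrite !mulrBr in H1 H2.
rewrite mulrBl mul1r; move: (lambda / _ * n) (lambda * C / _ * _) (lambda * p) (lambda * D) H1 H2.
move=> a b x y H1 H2; lra.
Qed.

(** The divergence of a test field is bounded, so the flux is Lipschitz with respect to the measure
    of the symmetric difference. *)
Lemma flux_cvg m (Omegas : nat -> set (R * R)) Omega phi :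
  (forall n, admissible m (Omegas n)) -> admissible m Omega ->
  L1_cvg Omegas Omega -> C1c_field phi ->
  flux (Omegas n) phi @[n --> \oo] --> flux Omega phi.
Proof.
move=> HOs HO cvgO Hphi; have [M M0 dM] := bounded_div Hphi.
have mq : measurable_fun setT (div phi : lplane R -> R).
  have m1 := plane_continuous_measurable (continuous_div Hphi).
  exact: (measurableT_comp m1 (@measurable_id_completed _ _ _ (borel_plane_measure R))).
have [mO _ Om] := HO.
have dist n : `|flux (Omegas n) phi - flux Omega phi| <= M * fine (leb2 R (Omegas n `+` Omega)).
  have [mOn _ Omn] := HOs n.
  apply: (Rintegral_set_dist_le (nu := leb2 R) mOn mO) => //.
    by rewrite [ltLHS]Omn ltry.
  by rewrite [ltLHS]Om ltry.
have fcv : M * fine (leb2 R (Omegas n `+` Omega)) @[n --> \oo] --> 0.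
  rewrite -[X in _ --> X](mulr0 M); apply: cvgMr; exact: (fine_cvg cvgO).
apply/cvgrPdist_le => /= e e0; near=> n; rewrite distrC (le_trans (dist n)) //.
rewrite (le_trans (ler_norm _)) // -[X in `|X|]subr0 distrC.
by near: n; exact: ((cvgrPdist_le _ _).1 fcv e e0).
Unshelve. all: by end_near. Qed.

End energy_bounds.

(** * The two inequalities of Gamma-convergence *)

Theorem proposition5p3 (R : realType) (lambda m : R)
    (lambda_bounds : 0 < lambda < 1) (m_gt0 : 0 < m) :
  L1_Gamma_limit (admissible m) (fun delta => energy lambda delta)
    (energy0 lambda).
Proof.
have /andP[l0 l1] := lambda_bounds.
have delta1 (delta : nat -> R) n : vanishing delta -> 0 < delta n < 1.
  by move=> [/(_ n)/andP[d0 d2] _]; rewrite d0 /=; lra.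
have invL (C : R) (delta : nat -> R) : vanishing delta ->
    C * (ln (delta n)^-1)^-1 @[n --> \oo] --> 0.
  by move=> /ln_inv_cvg0 H; rewrite -[X in _ --> X](mulr0 C); exact: cvgMr.
split=> [delta Omegas Omega van HOs HO cvgO|delta Omega van HO].
  rewrite /energy0 -(fineK (admissible_perimeter_fin HO)) -EFinM.
  apply/lee_addgt0Pr => eta eta0.
  (* The field is chosen for the limit set and kept fixed along the sequence; this is where lower
     semicontinuity of the perimeter is hidden. *)
  have [phi Hphi Dp] := admissible_flux_adherent HO eta0.
  have lim : ((1 - lambda) * (\int[leb2 R]_(x in Omegas n) div phi x)%R -
      4 * lambda * m * (ln (delta n)^-1)^-1)%:E @[n --> \oo] -->
      ((1 - lambda) * (\int[leb2 R]_(x in Omega) div phi x)%R)%:E.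
    apply: cvg_EFin; first exact: nearW.
    rewrite -[X in _ --> X]subr0; apply: cvgB; last exact: invL.
    by apply: cvgMr; exact: flux_cvg HOs HO cvgO Hphi.1.
  have := le_limn_einf (fun n => energy_ge lambda_bounds (delta1 delta n van) (HOs n) Hphi) lim.
  move=> H; apply: le_trans (leeD2r eta%:E H); rewrite -EFinD lee_fin.
  move: Dp; move: (fine _) (Rintegral _ _ _) => p D Dp.
  have l10 : 0 <= 1 - lambda by rewrite subr_ge0 ltW.
  have := ler_wpM2l l10 (ltW Dp); rewrite mulrBr lerBlDr => /le_trans; apply.
  by rewrite lerD2l ler_piMl ?(ltW eta0) // lerBlDr lerDl ltW.
exists (fun=> Omega); split=> //.
  by rewrite /L1_cvg; under eq_fun do rewrite setYK measure0; exact: cvg_cst.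
rewrite /energy0 -(fineK (admissible_perimeter_fin HO)) -EFinM.
apply/lee_addgt0Pr => eta eta0.
(* [eta] is fixed before the limit, since [C] depends on it; the term [C / ln (1 / delta n)] then
   vanishes. *)
have [C HC] := energy_le lambda_bounds HO eta0.
apply: (limn_esup_le (fun n => HC _ (delta1 delta n van))).
rewrite -EFinD; apply: cvg_EFin; first exact: nearW.
rewrite -[X in _ --> X]addr0; apply: cvgD; first exact: cvg_cst.
exact: invL.
Qed.
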